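(* Assume: (i) $\delta_n=o(m_n)$ as $n\to\infty$; (ii) the map $\theta\mapsto f_\theta$ is injective on $\Theta$, for every $\lambda\in\operatorname{Sp}(W)$ the map $\theta\mapsto f_\theta(\lambda)$ is continuous, and $f_\theta\in\mathcal F_\rho$ for all $\theta\in\Theta$; (iii) there is a positive measure $\mu$ such that $\frac1{m_n}\sum_{i\in G_n}\mu_{ii}\to\mu$ in distribution (weakly) as $n\to\infty$. Then the sequences of estimators $(\hat\theta_n)$, $(\bar\theta_n)$ and $(\tilde\theta_n)$ converge, as $n\to\infty$, $P_{f_{\theta_0}}$-almost surely to the true value $\theta_0$. Suppose moreover that, for some integer $P>0$, we are in the $MA_P$ case or in the $AR_P$ case, that the set $V_P$ is finite and $n$ is large enough that for every $v\in V_P$ there is $(i,j)\in G_n^2$ with $\mu_{ij}=v$, and that there is a positive sequence $u_n\to0$ with $\sup_{i,j\in G_n}|B^{(n)}_{ij}-1|\le u_n$. Then also $\theta^{(u)}_n\to\theta_0$ as $n\to\infty$, $P_{f_{\theta_0}}$-almost surely.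
   Context: Graph. $\mathbf G=(G,W)$ is an infinite undirected weighted graph: $G$ is a countably infinite set of vertices and $W=(W_{ij})_{i,j\in G}$ is a real symmetric matrix; $i,j$ are neighbors iff $W_{ij}\ne0$. The degree $\deg(i)$ is the number of neighbors of $i$, $\deg(\mathbf G)=\max_i\deg(i)<\infty$, and $W$ is renormalized so that $|W_{ij}|\le 1/\deg(\mathbf G)$. $W$ acts on $l^2(G)$ by $(Wu)_i=\sum_jW_{ij}u_j$; it is bounded and self-adjoint with norm at most $1$. Let $E$ be its spectral resolution of identity, $W=\int_{\operatorname{Sp}(W)}\lambda\,dE(\lambda)$; with $\delta_i=(1_{k=i})_{k\in G}$, define the real measures $\mu_{ij}(\omega)=\langle E(\omega)\delta_i,\delta_j\rangle_{l^2(G)}$ for Borel $\omega\subset\operatorname{Sp}(W)$. $d_{\mathbf G}$ is the graph distance (length of a shortest path). Operators. For $f$ analytic on the convex hull of $\operatorname{Sp}(W)$, $\mathcal K(f)=\int f\,dE=f(W)$. $(\mathbf G_n)$ is an increasing sequence of finite nested subgraphs with vertex sets $G_n\subset G_{n+1}\subset G$ and weights the restriction of $W$; $m_n=\operatorname{Card}(G_n)$, $\delta_n=\operatorname{Card}\{i\in G_n:\exists j\in G\setminus G_n,\ W_{ij}\ne0\}$, and $\mathcal K_n(f)=(\mathcal K(f)_{ij})_{i,j\in G_n}$. Function classes. $\mathcal F$ is the set of positive analytic functions on the convex hull of $\operatorname{Sp}(W)$. For $f(x)=\sum_{k\in\mathbb N}f_kx^k$, $\alpha(f)=\sum_k|f_k|(k+1)$.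 For a fixed $\rho>0$, $\mathcal F_\rho=\{f\in\mathcal F:\alpha(\log f)\le\rho\}$. Model. $\Theta$ is a compact interval of $\mathbb R$, $(f_\theta)_{\theta\in\Theta}$ a family in $\mathcal F$, $\theta_0$ is in the interior of $\Theta$, and $(X_i)_{i\in G}$ is a centered Gaussian process with covariance operator $\mathcal K(f_{\theta_0})$ (its law is denoted $P_{f_{\theta_0}}$). One observes $X_n=(X_i)_{i\in G_n}\sim\mathcal N(0,\mathcal K_n(f_{\theta_0}))$. $MA_P$ case: the true density $f_{\theta_0}$ is a polynomial of degree at most $P$. $AR_P$ case: for every $\theta\in\Theta$, $1/f_\theta$ is a polynomial of degree at most $P$. Boundary correction. $V_P=\{\mu_{ij}:i,j\in G,\ d_{\mathbf G}(i,j)\le P\}$. For $i,j\in G_n$, $$B^{(n)}_{ij}=\frac{\operatorname{Card}\{(k,l)\in G_n\times G:\mu_{kl}=\mu_{ij}\}}{\operatorname{Card}\{(k,l)\in G_n\times G_n:\mu_{kl}=\mu_{ij}\}}\ \text{ if } d_{\mathbf G}(i,j)\le P,\qquad B^{(n)}_{ij}=1\ \text{ if } d_{\mathbf G}(i,j)>P,$$ and $\mathcal Q_n(f)=B^{(n)}\odot\mathcal K_n(f)$ (entrywise product). Contrasts and estimators. $L_n(\theta)=-\frac12\big(m_n\log(2\pi)+\log\det\mathcal K_n(f_\theta)+X_n^T\mathcal K_n(f_\theta)^{-1}X_n\big)$, $\bar L_n(\theta)=-\frac12\big(m_n\log(2\pi)+m_n\int\log f_\theta\,d\mu+X_n^T\mathcal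 K_n(f_\theta)^{-1}X_n\big)$, $\tilde L_n(\theta)=-\frac12\big(m_n\log(2\pi)+m_n\int\log f_\theta\,d\mu+X_n^T\mathcal K_n(1/f_\theta)X_n\big)$, $L_n^{(u)}(\theta)=-\frac12\big(m_n\log(2\pi)+m_n\int\log f_\theta\,d\mu+X_n^T\mathcal Q_n(1/f_\theta)X_n\big)$. $\hat\theta_n,\bar\theta_n,\tilde\theta_n,\theta_n^{(u)}$ denote maximizers over $\Theta$ of $L_n,\bar L_n,\tilde L_n,L_n^{(u)}$ respectively.
   Formalization: Injectivity of θ ↦ f_θ is required up to equality μ-almost everywhere, μ being the limit measure in (iii), since plain injectivity fails when μ has finite support (e.g. disjoint edges, f_θ(x)=exp(θ(1−x²))); Card(G_n)→∞ is stated explicitly. *)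

(* Defs.v *)
From HB Require Import structures.
From mathcomp Require Import all_boot all_order all_algebra finmap.
From mathcomp Require Import all_classical all_reals all_analysis.

Set Implicit Arguments.
Unset Strict Implicit.
Unset Printing Implicit Defensive.

Import Order.TTheory GRing.Theory Num.Theory.
Import numFieldNormedType.Exports.

Local Open Scope fset_scope.
Local Open Scope classical_set_scope.
Local Open Scope ring_scope.

Section Graph.
Context {R : realType} {G : countType}.
Implicit Types (W : G -> G -> R) (i j : G).

(* A vertex with a nonzero diagonal weight counts as its own neighbor. *)
Definition neighbors W i : set G := [set j | W i j != 0].

Definition deg W i : \bar R := counting (neighbors W i).

Definition graph_deg W : \bar R := ereal_sup (range (deg W)).

Definition is_graph W : Prop :=
  [/\ infinite_set [set: G],
      forall i j, W i j = W j i,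
      (graph_deg W < +oo)%E &
      forall i j, `|W i j| <= (fine (graph_deg W))^-1].

(* Equal to +oo when i and j lie in different components. *)
Definition graph_dist W i j : \bar R :=
  ereal_inf [set (size p)%:R%:E | p in
    [set p : seq G | path (fun k l => W k l != 0) i p /\ last i p = j]].

Definition boundary_size W (A : {fset G}) : nat :=
  #|` [fset i in A | `[< exists2 j, j \notin A & W i j != 0 >]]|.

End Graph.

Section Spectral.
Context {R : realType} {G : countType}.
Implicit Types (W : G -> G -> R) (u v : G -> R) (T : (G -> R) -> (G -> R)).
Implicit Types (E : set R -> (G -> R) -> (G -> R)).

Definition l2 : set (G -> R) :=
  [set u | summable [set: G] (fun i => (u i ^+ 2)%:E)].

(* The unconditional sum of u i * v i, as positive part minus negative part. *)
Definition ip u v : R :=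
  fine (\esum_(i in [set: G]) (Num.max (u i * v i) 0)%:E)
  - fine (\esum_(i in [set: G]) (Num.max (- (u i * v i)) 0)%:E).

Definition l2norm u : R := Num.sqrt (ip u u).

Definition dvec (i : G) : G -> R := fun k => (k == i)%:R.

Definition W_op W : (G -> R) -> (G -> R) :=
  fun u i => \sum_(j \in neighbors W i) W i j * u j.

Definition bounded_on_l2 T : Prop :=
  (forall u, l2 u -> l2 (T u)) /\
  exists C : R, forall u, l2 u -> l2norm (T u) <= C * l2norm u.

Definition linear_on_l2 T : Prop :=
  forall (a : R) u v, l2 u -> l2 v ->
    T (fun i => a * u i + v i) = (fun i => a * T u i + T v i).

(* W is a symmetric operator, so the spectra on real and complex l^2 agree. *)
Definition resolvent_set W : set R :=
  [set l | exists S : (G -> R) -> (G -> R),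
    [/\ linear_on_l2 S, bounded_on_l2 S,
        forall u, l2 u -> S (fun i => W_op W u i - l * u i) = u &
        forall u, l2 u -> (fun i => W_op W (S u) i - l * S u i) = u]].

Definition Sp W : set R := ~` resolvent_set W.

Definition hull W : set R := [set` Rhull (Sp W)].

Definition orthogonal_projection T : Prop :=
  [/\ linear_on_l2 T, (forall u, l2 u -> l2 (T u)),
      forall u, l2 u -> T (T u) = T u &
      forall u v, l2 u -> l2 v -> ip (T u) v = ip u (T v)].

Definition qmeasure E u : set R -> \bar R :=
  fun A => (ip (E A u) u)%:E.

(* The integral of f against the signed measure A |-> <E(A) u, v>, which by
   polarization is the difference of two positive finite measures. *)
Definition spec_int W E (f : R -> R) u v : R :=
  4^-1 * (fine (\int[qmeasure E (fun i => u i + v i)]_(x in Sp W) (f x)%:E)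
        - fine (\int[qmeasure E (fun i => u i - v i)]_(x in Sp W) (f x)%:E)).

(* E is a resolution of identity on the Borel sets of the line, carried by
   Sp W; the values of E at non-Borel sets are unconstrained. *)
Definition resolution_of_identity W E : Prop :=
  [/\ forall A, measurable A -> orthogonal_projection (E A),
      forall u, l2 u -> E set0 u = (fun=> 0) /\ E (Sp W) u = u,
      forall A B, measurable A -> measurable B ->
        forall u, l2 u -> E (A `&` B) u = E A (E B u) &
      forall u, l2 u -> semi_sigma_additive (qmeasure E u)].

Definition spectral_resolution W E : Prop :=
  resolution_of_identity W E /\
  forall u v, l2 u -> l2 v -> ip (W_op W u) v = spec_int W E idfun u v.

(* The value 0 off the Borel sets makes equality of mu E i j and mu E k l as
   functions the same as equality of the measures. *)
Definition mu E (i j : G) : set R -> R :=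
  fun A => if `[< measurable A >] then ip (E A (dvec i)) (dvec j) else 0.

Definition Kop W E (f : R -> R) (i j : G) : R :=
  spec_int W E f (dvec i) (dvec j).

Definition avg_mu E (A : {fset G}) : set R -> \bar R :=
  fun B => (#|` A|%:R^-1 * \sum_(i <- A) mu E i i B)%:E.

End Spectral.

Definition weak_cvg {R : realType} (nu : nat -> set R -> \bar R)
    (nuoo : set R -> \bar R) : Prop :=
  forall g : R -> R, continuous g -> (exists M, forall x, `|g x| <= M) ->
    (\int[nu n]_x (g x)%:E)%E @[n --> \oo] --> (\int[nuoo]_x (g x)%:E)%E.

Section Classes.
Context {R : realType}.
Implicit Types (D : set R) (f : R -> R) (a : nat -> R).

Definition analytic_on D f : Prop :=
  forall x0, D x0 -> exists r, exists a, 0 < r /\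
    forall x, D x -> `|x - x0| < r ->
      series (fun k => a k * (x - x0) ^+ k) @ \oo --> f x.

Definition alpha a : \bar R := (\sum_(0 <= k <oo) (`|a k| * k.+1%:R)%:E)%E.

Definition in_F D f : Prop := (forall x, D x -> 0 < f x) /\ analytic_on D f.

Definition in_Frho D (rho : R) f : Prop :=
  in_F D f /\
  exists a, (forall x, D x -> series (fun k => a k * x ^+ k) @ \oo --> ln (f x))
    /\ (alpha a <= rho%:E)%E.

Definition poly_on D (P : nat) f : Prop :=
  exists2 p : {poly R}, (size p <= P.+1)%N & forall x, D x -> f x = p.[x].

End Classes.

Section Model.
Context {R : realType} {G : countType} {d : measure_display}
  {Omega : measurableType d} (P : probability Omega R).

(* [normal_prob] takes the standard deviation and is not a point mass when it
   vanishes, hence the separate degenerate case. *)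
Definition centered_gaussian_process (X : G -> {RV P >-> R})
    (K : G -> G -> R) : Prop :=
  forall (A : {fset G}) (c : G -> R),
    let v := \sum_(i <- A) \sum_(j <- A) c i * c j * K i j in
    let Y := fun w => \sum_(i <- A) c i * X i w in
    0 <= v /\
    if v == 0 then {ae P, forall w, Y w = 0}
    else forall B : set R, measurable B ->
           P (Y @^-1` B) = normal_prob 0 (Num.sqrt v) B.

Definition obs (X : G -> {RV P >-> R}) (A : {fset G}) (w : Omega)
    : 'cV[R]_#|{: A}| :=
  \col_i X (val (enum_val i)) w.

End Model.

Section Contrasts.
Context {R : realType} {G : countType}.
Implicit Types (A : {fset G}) (f : R -> R) (nu : set R -> \bar R).
Variables (W : G -> G -> R) (E : set R -> (G -> R) -> (G -> R)).

Definition restr_mx (k : G -> G -> R) A : 'M[R]_#|{: A}| :=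
  \matrix_(i, j) k (val (enum_val i)) (val (enum_val j)).

Definition Kmx f A : 'M[R]_#|{: A}| := restr_mx (Kop W E f) A.

Definition qform n (M : 'M[R]_n) (x : 'cV[R]_n) : R := (x^T *m M *m x) 0 0.

Definition log_int nu f : R := fine (\int[nu]_(x in Sp W) (ln (f x))%:E).

Definition VP (P : nat) : set (set R -> R) :=
  [set mu E p.1 p.2 | p in [set p | (graph_dist W p.1 p.2 <= P%:R%:E)%E]].

(* The numerator can be infinite, so the ratio is an extended real; for i and
   j in A the denominator is a positive finite number. *)
Definition Bcorr (P : nat) A (i j : G) : \bar R :=
  if (graph_dist W i j <= P%:R%:E)%E then
    (counting [set p : G * G | p.1 \in A /\ mu E p.1 p.2 = mu E i j] *
     (fine (counting [set p : G * G |
              [/\ p.1 \in A, p.2 \in A & mu E p.1 p.2 = mu E i j]]))^-1%:E)%E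
  else 1%E.

Definition Qmx (P : nat) f A : 'M[R]_#|{: A}| :=
  restr_mx (fun i j => fine (Bcorr P A i j) * Kop W E f i j) A.

Definition L_hat f A (x : 'cV[R]_#|{: A}|) : R :=
  - 2^-1 * (#|` A|%:R * ln (2 * pi) + ln (\det (Kmx f A))
            + qform (invmx (Kmx f A)) x).

Definition L_bar nu f A (x : 'cV[R]_#|{: A}|) : R :=
  - 2^-1 * (#|` A|%:R * ln (2 * pi) + #|` A|%:R * log_int nu f
            + qform (invmx (Kmx f A)) x).

Definition L_tilde nu f A (x : 'cV[R]_#|{: A}|) : R :=
  - 2^-1 * (#|` A|%:R * ln (2 * pi) + #|` A|%:R * log_int nu f
            + qform (Kmx (fun y => (f y)^-1) A) x).

Definition L_u (P : nat) nu f A (x : 'cV[R]_#|{: A}|) : R :=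
  - 2^-1 * (#|` A|%:R * ln (2 * pi) + #|` A|%:R * log_int nu f
            + qform (Qmx P (fun y => (f y)^-1) A) x).

End Contrasts.

Definition maximizes {R : realType} (D : set R) (L : R -> R) (t : R) : Prop :=
  D t /\ forall s, D s -> L s <= L t.

(* Main.v *)
(* For f a uniform limit on Sp W of polynomials p with sum |p_k| (k+1) <= C,
   the rows of the kernel K(f) have l^1-norm at most C, and the entries of
   K_A(f) K_A(g) - K_A(f g) sum to at most C C' times the boundary of A.
   This class of functions is stable under products and exponentials, so it
   contains f_t and 1/f_t as soon as ln f_t has a series with alpha <= rho.
   Hence, up to O(delta_n), ln det K_n(f) is Tr K_n(ln f) (integrate along
   exp(s ln f)), and Tr K_n(f_0 / f) is the mean both of X' K_n(1/f) X and of
   X' K_n(f)^-1 X.  Isserlis' formula bounds the variances of these forms by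
   O(m_n).  The second form increases with the index set, because it is the
   supremum of 2 X'y - y' K_n(f) y, and the first is a difference of two
   increasing forms; so Chebyshev and Borel-Cantelli along the levels
   m_n ~ k^2, together with monotonicity between consecutive levels, give
   almost sure convergence for each fixed parameter.  The contrasts are
   equicontinuous in t, and their limit, the integral of ln f_t + f_0 / f_t,
   has its only minimum at theta0 because exp y - 1 - y > 0 for y <> 0.  The
   boundary correction perturbs the contrast by O(u_n) only. *)
Require Import Defs.
From HB Require Import structures.
From mathcomp Require Import all_boot all_order all_algebra finmap.
From mathcomp Require Import all_classical all_reals all_analysis.
From mathcomp Require Import measurable_realfun ring lra zify.

Set Implicit Arguments.
Unset Strict Implicit.
Unset Printing Implicit Defensive.

Import Order.TTheory GRing.Theory Num.Theory.
Import numFieldNormedType.Exports.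

Local Open Scope classical_set_scope.
Local Open Scope ring_scope.

(** * Square-summable functions *)

(** Nothing is known on the growth of m_n beyond m_n -> oo: it may stay constant over long stretches
    or jump far in one step. The variances O(1/m_n) of the normalized forms need not be summable in
    n, and a subsequence alone would leave gaps. This is why every form is reduced to forms that
    increase with the index set, and why two indices are kept for each k: the first with m_n >= k^2
    and the last with m_n < (k+1)^2. The weight k + 1 in alpha has two effects: it makes the norm on
    coefficients submultiplicative, and it pays for the k steps in which a path of length k may
    leave the index set, whence the boundary bound. For the inverse matrices only the entries and
    the operator norm are bounded, so every estimate on them is either a trace against an entrywise
    summable error or a variational inequality. All randomness is confined to countably many almost
    sure limits ([regular_path]); from there on the argument is deterministic on a fixed path. *)

Lemma cvg_sumr {R : realType} (I : Type) (r : seq I) (s : I -> nat -> R) (l : I -> R) :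
  (forall i, s i @ \oo --> l i) ->
  \sum_(i <- r) s i n @[n --> \oo] --> \sum_(i <- r) l i.
Proof.
move=> h; elim: r => [|i r IH].
  by under eq_fun do rewrite big_nil; rewrite big_nil; exact: cvg_cst.
by under eq_fun do rewrite big_cons; rewrite big_cons; apply: cvgD.
Qed.

Section L2.
Context {R : realType} {G : countType}.
Implicit Types (f p n u v w : G -> R) (F : {fset G}).

(** Meant for nonnegative families; [fine] turns an infinite sum into 0, so the value is the sum
    only under [asummable]. *)
Definition total f : R := fine (\esum_(i in [set: G]) (f i)%:E).

Definition asummable f := exists C : R, forall F, \sum_(i <- F) `|f i| <= C.

(** The body of [ip] with an arbitrary family in place of the products, so that [ipE] holds by
    conversion. *)
Definition asum f : R :=
  total (fun i => Num.max (f i) 0) - total (fun i => Num.max (- f i) 0).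

Lemma esum_leP p (C : R) : (forall i, 0 <= p i) ->
  ((\esum_(i in [set: G]) (p i)%:E <= C%:E)%E <->
   forall F, \sum_(i <- F) p i <= C).
Proof.
move=> p0; split=> [h F|h].
  rewrite -lee_fin; apply: le_trans h; rewrite -sumEFin.
  apply: ereal_sup_ubound; exists [set` F] => //.
  by rewrite fsbig_finite//= set_fsetK.
apply: ge_ereal_sup => _ /= [A [finA _] <-].
by rewrite fsbig_finite//= sumEFin lee_fin.
Qed.

Lemma total_fin p : (forall i, 0 <= p i) -> asummable p ->
  (\esum_(i in [set: G]) (p i)%:E)%E = (total p)%:E.
Proof.
move=> p0 [C hC]; rewrite /total fineK// ge0_fin_numE; last first.
  by apply: esum_ge0 => i _; rewrite lee_fin.
apply: (@le_lt_trans _ _ C%:E); last exact: ltry.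
apply/esum_leP => // F; apply: le_trans (hC F).
by apply: ler_sum => i _; exact: ler_norm.
Qed.

Lemma total_ub p F : (forall i, 0 <= p i) -> asummable p ->
  \sum_(i <- F) p i <= total p.
Proof. by move=> p0 sp; move: F; apply/esum_leP => //; rewrite total_fin. Qed.

Lemma total_le p C : (forall i, 0 <= p i) -> (forall F, \sum_(i <- F) p i <= C) ->
  total p <= C.
Proof.
move=> p0 h; rewrite -lee_fin -total_fin//; first exact/esum_leP.
by exists C => F; apply: le_trans (h F); apply: ler_sum => i _; rewrite ger0_norm.
Qed.

Lemma total_ge0 p : (forall i, 0 <= p i) -> 0 <= total p.
Proof. by move=> p0; rewrite fine_ge0// esum_ge0// => i _; rewrite lee_fin. Qed.

Lemma asummable_le f g : (forall i, `|f i| <= `|g i|) -> asummable g -> asummable f.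
Proof.
move=> fg [C hC]; exists C => F; apply: le_trans (hC F).
by apply: ler_sum => i _.
Qed.

Lemma asummableD f g : asummable f -> asummable g ->
  asummable (fun i => f i + g i).
Proof.
move=> [C hC] [D hD]; exists (C + D) => F.
apply: le_trans (lerD (hC F) (hD F)); rewrite -big_split/=.
by apply: ler_sum => i _; exact: ler_normD.
Qed.

Lemma asummableZ (a : R) f : asummable f -> asummable (fun i => a * f i).
Proof.
move=> [C hC]; exists (`|a| * C) => F.
apply: le_trans (ler_wpM2l (normr_ge0 a) (hC F)); rewrite mulr_sumr.
by apply: ler_sum => i _; rewrite normrM.
Qed.

Lemma totalD p n : (forall i, 0 <= p i) -> (forall i, 0 <= n i) ->
  asummable p -> asummable n -> total (fun i => p i + n i) = total p + total n.
Proof.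
move=> p0 n0 sp sn; apply: EFin_inj.
rewrite EFinD -!total_fin//; last 2 first.
- by move=> i; rewrite addr_ge0.
- exact: asummableD.
rewrite -esumD//; by move=> i _; rewrite lee_fin.
Qed.

Lemma totalZ (a : R) p : 0 <= a -> (forall i, 0 <= p i) -> asummable p ->
  total (fun i => a * p i) = a * total p.
Proof.
rewrite le_eqVlt => /predU1P[<- p0 sp|a0 p0 sp].
  rewrite mul0r; apply/eqP; rewrite eq_le; apply/andP; split; last first.
    by apply: total_ge0 => i; rewrite mul0r.
  apply: total_le => [i|F]; first by rewrite mul0r.
  by rewrite big1// => i _; rewrite mul0r.
have ap0 i : 0 <= a * p i by rewrite mulr_ge0// ltW.
apply/eqP; rewrite eq_le; apply/andP; split.
  apply: total_le => // F; rewrite -mulr_sumr.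
  by apply: ler_wpM2l; [exact: ltW|exact: total_ub].
rewrite -ler_pdivlMl//; apply: total_le => // F.
rewrite ler_pdivlMl// mulr_sumr; apply: total_ub => //; exact: asummableZ.
Qed.

Lemma asummable_pos f : asummable f -> asummable (fun i => Num.max (f i) 0).
Proof.
apply: asummable_le => i; rewrite /Num.max; case: ifP => //.
by rewrite normr0.
Qed.

Lemma asummable_neg f : asummable f -> asummable (fun i => Num.max (- f i) 0).
Proof.
by move=> sf; apply: asummable_pos; apply: asummable_le sf => i; rewrite normrN.
Qed.

(** [p] plus the negative part of [f] equals [n] plus the positive part, and totals of nonnegative
    families add. The linearity of [asum], hence of [ip], rests on this freedom in the splitting. *)
Lemma asumE f p n : (forall i, 0 <= p i) -> (forall i, 0 <= n i) ->
  asummable p -> asummable n -> (forall i, f i = p i - n i) ->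
  asum f = total p - total n.
Proof.
move=> p0 n0 sp sn fE.
have sf : asummable f.
  apply: (@asummable_le _ (fun i => p i + n i)); last exact: asummableD.
  move=> i; rewrite fE (ger0_norm (addr_ge0 (p0 i) (n0 i))).
  by rewrite (le_trans (ler_normB _ _))// !ger0_norm.
apply/eqP; rewrite /asum subr_eq addrAC eq_sym subr_eq -!totalD//;
  try by move=> i; rewrite le_max lexx orbT.
- apply/eqP; congr total; apply/funext => i; rewrite fE /Num.max.
  have := p0 i; have := n0 i; move: (p i) (n i) => x y.
  by case: ltP => ?; case: ltP => ? ? ?; lra.
- exact: asummable_pos.
- exact: asummable_neg.
Qed.

Lemma max_sub (x : R) : x = Num.max x 0 - Num.max (- x) 0.
Proof. by rewrite /Num.max; case: ltP => ?; case: ltP => ?; lra. Qed.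

Lemma asumD f g : asummable f -> asummable g ->
  asum (fun i => f i + g i) = asum f + asum g.
Proof.
move=> sf sg.
have h x : 0 <= Num.max x 0 :> R by rewrite le_max lexx orbT.
rewrite (@asumE _ (fun i => Num.max (f i) 0 + Num.max (g i) 0)
  (fun i => Num.max (- f i) 0 + Num.max (- g i) 0)).
- rewrite !totalD//; try exact: asummable_pos; try exact: asummable_neg.
  by rewrite /asum; ring.
- by move=> i; rewrite addr_ge0.
- by move=> i; rewrite addr_ge0.
- by apply: asummableD; exact: asummable_pos.
- by apply: asummableD; exact: asummable_neg.
- by move=> i; rewrite [in LHS](max_sub (f i)) [in LHS](max_sub (g i)); ring.
Qed.

Lemma asumZ (a : R) f : asummable f -> asum (fun i => a * f i) = a * asum f.
Proof.
move=> sf.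
have h x : 0 <= Num.max x 0 :> R by rewrite le_max lexx orbT.
have sp := asummable_pos sf; have sn := asummable_neg sf.
have [a0|a0] := leP 0 a.
  rewrite (@asumE _ (fun i => a * Num.max (f i) 0) (fun i => a * Num.max (- f i) 0));
    try exact: asummableZ; try by move=> i; rewrite mulr_ge0.
    by rewrite !totalZ// /asum; ring.
  by move=> i; rewrite [in LHS](max_sub (f i)); ring.
have na0 : 0 <= - a by rewrite oppr_ge0 ltW.
rewrite (@asumE _ (fun i => - a * Num.max (- f i) 0) (fun i => - a * Num.max (f i) 0));
  try exact: asummableZ; try by move=> i; rewrite mulr_ge0.
  by rewrite !totalZ// /asum; ring.
by move=> i; rewrite [in LHS](max_sub (f i)); ring.
Qed.

Lemma asum_pos p : (forall i, 0 <= p i) -> asum p = total p.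
Proof.
move=> p0; rewrite /asum (_ : (fun i => Num.max (p i) 0) = p); last first.
  by apply/funext => i; rewrite max_l.
rewrite (_ : (fun i => Num.max (- p i) 0) = fun=> 0); last first.
  by apply/funext => i; rewrite max_r// oppr_le0.
by rewrite [X in _ - X]/total esum1// fine0 subr0.
Qed.

Lemma total_dvec p j : (forall i, 0 <= p i) ->
  total (fun i => p i * dvec j i) = p j.
Proof.
move=> p0; have h0 i : 0 <= p i * dvec j i :> R by rewrite mulr_ge0// /dvec ler0n.
have hF F : \sum_(i <- F) p i * dvec j i <= p j.
  have [jF|jF] := boolP (j \in F).
    rewrite (big_fsetD1 j)//= /dvec eqxx mulr1 big_seq big1 ?addr0//.
    by move=> i; rewrite !inE => /andP[/negbTE -> _]; rewrite mulr0.
  rewrite big_seq big1// => i iF; rewrite /dvec.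
  by case: eqP => [ij|_]; [rewrite -ij iF in jF|rewrite mulr0].
apply/eqP; rewrite eq_le total_le//=.
have -> : p j = \sum_(i <- [fset j]%fset) p i * dvec j i.
  by rewrite big_seq_fset1 /dvec eqxx mulr1.
apply: total_ub => //; exists (p j) => F; apply: le_trans (hF F).
by apply: ler_sum => i _; rewrite ger0_norm.
Qed.

(** A norm bound expressed on finite sums only: operator bounds are proved one finite set at a time,
    and the bound passes to pointwise limits ([l2_le_cvg]). *)
Definition l2_le u (C : R) := 0 <= C /\ forall F, \sum_(i <- F) u i ^+ 2 <= C ^+ 2.

Lemma l2P u : l2 u <-> exists C, l2_le u C.
Proof.
rewrite /l2/= /summable.
have -> : (\esum_(x in [set: G]) `|(u x ^+ 2)%:E|)%E =
          (\esum_(x in [set: G]) (u x ^+ 2)%:E)%E.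
  by apply: eq_esum => i _; rewrite gee0_abs// lee_fin sqr_ge0.
have u0 i : 0 <= u i ^+ 2 by exact: sqr_ge0.
split=> [h|[C [C0 hC]]]; last first.
  apply: (@le_lt_trans _ _ (C ^+ 2)%:E); last exact: ltry.
  exact/esum_leP.
set s := esum _ _ in h.
have s0 : (0 <= s)%E by apply: esum_ge0 => i _; rewrite lee_fin.
have sfin : s \is a fin_num by rewrite ge0_fin_numE.
exists (Num.sqrt (fine s)); split; first exact: sqrtr_ge0.
rewrite sqr_sqrtr ?fine_ge0//; apply/esum_leP => //.
by rewrite fineK.
Qed.

Lemma l2_le_asummable u v C D : l2_le u C -> l2_le v D ->
  asummable (fun i => u i * v i).
Proof.
move=> [C0 hC] [D0 hD]; exists (C ^+ 2 + D ^+ 2) => F.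
apply: le_trans (lerD (hC F) (hD F)); rewrite -big_split/=.
apply: ler_sum => i _; rewrite normrM -!(real_normK (num_real (_ i))).
have := normr_ge0 (u i); have := normr_ge0 (v i); nra.
Qed.

Lemma l2_asummable u v : l2 u -> l2 v -> asummable (fun i => u i * v i).
Proof. by move=> /l2P[C hC] /l2P[D hD]; exact: l2_le_asummable hC hD. Qed.

Lemma ipE u v : ip u v = asum (fun i => u i * v i).
Proof. by []. Qed.

Lemma ipC u v : ip u v = ip v u.
Proof. by rewrite !ipE; congr asum; apply/funext => i; rewrite mulrC. Qed.

Lemma ipDl u v w : l2 u -> l2 v -> l2 w ->
  ip (fun i => u i + v i) w = ip u w + ip v w.
Proof.
move=> hu hv hw; rewrite !ipE -asumD; try exact: l2_asummable.
by congr asum; apply/funext => i; rewrite mulrDl.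
Qed.

Lemma ipZl (a : R) u w : l2 u -> l2 w -> ip (fun i => a * u i) w = a * ip u w.
Proof.
move=> hu hw; rewrite !ipE -asumZ; last exact: l2_asummable.
by congr asum; apply/funext => i; rewrite mulrA.
Qed.

Lemma ip_ge0 u : 0 <= ip u u.
Proof.
rewrite ipE asum_pos; first apply: total_ge0;
  by move=> i; rewrite -expr2 sqr_ge0.
Qed.

Lemma ip_ub u F : l2 u -> \sum_(i <- F) u i ^+ 2 <= ip u u.
Proof.
move=> hu; rewrite ipE asum_pos; last by move=> i; rewrite -expr2 sqr_ge0.
rewrite (_ : (fun i => u i * u i) = fun i => u i ^+ 2); last first.
  by apply/funext => i; rewrite expr2.
apply: total_ub => [i|]; first exact: sqr_ge0.
by have := l2_asummable hu hu; apply: asummable_le => i; rewrite expr2.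
Qed.

Lemma ip_le u C : l2_le u C -> ip u u <= C ^+ 2.
Proof.
move=> [C0 hC]; rewrite ipE asum_pos; last by move=> i; rewrite -expr2 sqr_ge0.
apply: total_le => [i|F]; first by rewrite -expr2 sqr_ge0.
by apply: le_trans (hC F); apply: ler_sum => i _; rewrite expr2.
Qed.

Lemma l2_l2norm u : l2 u -> l2_le u (l2norm u).
Proof.
move=> hu; split=> [|F]; first exact: sqrtr_ge0.
by rewrite sqr_sqrtr ?ip_ge0//; exact: ip_ub.
Qed.

Lemma l2norm_le u C : l2_le u C -> l2norm u <= C.
Proof.
move=> hC; rewrite -[leRHS]ger0_norm ?(proj1 hC)// -sqrtr_sqr.
by rewrite ler_wsqrtr// ip_le.
Qed.

Lemma l2_leW u C D : C <= D -> l2_le u C -> l2_le u D.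
Proof.
move=> CD [C0 hC]; split; first exact: le_trans CD.
by move=> F; rewrite (le_trans (hC F))// lerXn2r// nnegrE// (le_trans C0).
Qed.

Lemma l2_le_coord u C i : l2_le u C -> `|u i| <= C.
Proof.
move=> [C0 hC]; have := hC [fset i]%fset; rewrite big_seq_fset1.
rewrite -[in X in X <= _](real_normK (num_real (u i))).
by rewrite ler_pXn2r// nnegrE.
Qed.

Lemma l2_le0 u : l2_le u 0 -> u = fun=> 0.
Proof.
move=> h; apply/funext => i; apply/eqP.
by rewrite -normr_le0 (l2_le_coord i h).
Qed.

Lemma l2_le_zero C : 0 <= C -> l2_le (fun=> 0) C.
Proof.
move=> C0; split=> // F.
by rewrite big1 ?sqr_ge0// => i _; rewrite expr0n.
Qed.

(** Minkowski's inequality: (u + v)^2 <= (1 + D/C) u^2 + (1 + C/D) v^2 sums to exactly (C + D)^2.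
    The divisions force the cases C = 0 and D = 0 to be treated apart. *)
Lemma l2_leD u v C D : l2_le u C -> l2_le v D -> l2_le (fun i => u i + v i) (C + D).
Proof.
move=> hu hv; have [C0 hC] := hu; have [D0 hD] := hv.
split=> [|F]; first exact: addr_ge0.
have [C00|Cn0] := eqVneq C 0.
  rewrite C00 add0r; rewrite C00 in hu.
  by rewrite (l2_le0 hu); under eq_bigr do rewrite add0r.
have [D00|Dn0] := eqVneq D 0.
  rewrite D00 addr0; rewrite D00 in hv.
  by rewrite (l2_le0 hv); under eq_bigr do rewrite addr0.
have {C0 Cn0}C0 : 0 < C by rewrite lt_neqAle eq_sym Cn0.
have {D0 Dn0}D0 : 0 < D by rewrite lt_neqAle eq_sym Dn0.
apply: (@le_trans _ _ ((1 + D / C) * C ^+ 2 + (1 + C / D) * D ^+ 2)); last first.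
  by rewrite le_eqVlt; apply/orP; left; apply/eqP; field; rewrite !gt_eqF.
have p1 : 0 <= 1 + D / C by rewrite addr_ge0// divr_ge0// ltW.
have p2 : 0 <= 1 + C / D by rewrite addr_ge0// divr_ge0// ltW.
apply: le_trans (lerD (ler_wpM2l p1 (hC F)) (ler_wpM2l p2 (hD F))).
rewrite !mulr_sumr -big_split/=; apply: ler_sum => i _.
rewrite -subr_ge0.
have -> : (1 + D / C) * u i ^+ 2 + (1 + C / D) * v i ^+ 2 - (u i + v i) ^+ 2 =
  (D * u i - C * v i) ^+ 2 / (C * D) by field; rewrite !gt_eqF.
by rewrite divr_ge0 ?sqr_ge0// mulr_ge0 ?ltW.
Qed.

Lemma l2_leZ (a : R) u C : l2_le u C -> l2_le (fun i => a * u i) (`|a| * C).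
Proof.
move=> [C0 hC]; split=> [|F]; first by rewrite mulr_ge0.
under eq_bigr do rewrite exprMn.
by rewrite -mulr_sumr exprMn real_normK ?num_real// ler_wpM2l ?sqr_ge0.
Qed.

Lemma l2_le_cvg (s : nat -> G -> R) u C : 0 <= C ->
  (forall i, s ^~ i @ \oo --> u i) -> (\forall n \near \oo, l2_le (s n) C) ->
  l2_le u C.
Proof.
move=> C0 su sC; split=> // F.
have su2 : \sum_(i <- F) s n i ^+ 2 @[n --> \oo] --> \sum_(i <- F) u i ^+ 2.
  by apply: cvg_sumr => i; rewrite expr2; apply: cvgM; exact: su.
apply: (cvgr_to_le su2); near=> n.
by apply: (near sC n _).2.
Unshelve. all: by end_near. Qed.

Lemma l2D u v : l2 u -> l2 v -> l2 (fun i => u i + v i).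
Proof.
by move=> /l2P[C hC] /l2P[D hD]; apply/l2P; exists (C + D); exact: l2_leD.
Qed.

Lemma l2Z (a : R) u : l2 u -> l2 (fun i => a * u i).
Proof. by move=> /l2P[C hC]; apply/l2P; exists (`|a| * C); exact: l2_leZ. Qed.

Lemma l2N u : l2 u -> l2 (fun i => - u i).
Proof.
by move=> /(l2Z (-1)); congr l2; apply/funext => i; rewrite mulN1r.
Qed.

Lemma l2B u v : l2 u -> l2 v -> l2 (fun i => u i - v i).
Proof. by move=> hu /l2N; exact: l2D. Qed.

Lemma l2_0 : l2 ((fun=> 0) : G -> R).
Proof. by apply/l2P; exists 0; exact: l2_le_zero. Qed.

Lemma l2_sum (I : Type) (r : seq I) (s : I -> G -> R) : (forall k, l2 (s k)) ->
  l2 (fun i => \sum_(k <- r) s k i).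
Proof.
move=> hs; elim: r => [|k r IH].
  by under eq_fun do rewrite big_nil; exact: l2_0.
by under eq_fun do rewrite big_cons; exact: l2D.
Qed.

Lemma ip_suml (I : Type) (r : seq I) (s : I -> G -> R) v :
  (forall k, l2 (s k)) -> l2 v ->
  ip (fun i => \sum_(k <- r) s k i) v = \sum_(k <- r) ip (s k) v.
Proof.
move=> hs hv; elim: r => [|k r IH].
  under eq_fun do rewrite big_nil.
  rewrite big_nil (_ : (fun=> 0) = fun i => 0 * v i); last first.
    by apply/funext => i; rewrite mul0r.
  by rewrite ipZl// mul0r.
under eq_fun do rewrite big_cons.
by rewrite ipDl//; [rewrite big_cons IH|exact: l2_sum].
Qed.

Lemma dvec_l2 j : l2 (dvec j : G -> R).
Proof.
apply/l2P; exists 1; split=> // F; rewrite expr1n.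
have [jF|jF] := boolP (j \in F).
  rewrite (big_fsetD1 j)//= /dvec eqxx expr1n big_seq big1 ?addr0//.
  by move=> i; rewrite !inE => /andP[/negbTE -> _]; rewrite expr0n.
rewrite big_seq big1// => i iF; rewrite /dvec.
by case: eqP => [ij|_]; [rewrite -ij iF in jF|rewrite expr0n].
Qed.

(** The products vanish off [j], so both parts of the sum are finite for every [u], in [l2] or
    not. *)
Lemma ip_dvec u j : ip u (dvec j) = u j.
Proof.
rewrite ipE (_ : (fun i => u i * dvec j i) =
  fun i => Num.max (u i) 0 * dvec j i - Num.max (- u i) 0 * dvec j i); last first.
  by apply/funext => i; rewrite -mulrBl -max_sub.
have h x : 0 <= Num.max x 0 :> R by rewrite le_max lexx orbT.
have sd x : (forall i, 0 <= x i) -> asummable (fun i => x i * dvec j i).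
  move=> x0; exists (x j) => F.
  have x0' i : 0 <= x i * dvec j i by rewrite mulr_ge0// /dvec ler0n.
  under eq_bigr do rewrite ger0_norm//.
  have [jF|jF] := boolP (j \in F).
    rewrite (big_fsetD1 j)//= /dvec eqxx mulr1 big_seq big1 ?addr0//.
    by move=> i; rewrite !inE => /andP[/negbTE -> _]; rewrite mulr0.
  rewrite big_seq big1// => i iF; rewrite /dvec.
  by case: eqP => [ij|_]; [rewrite -ij iF in jF|rewrite mulr0].
rewrite (@asumE _ (fun i => Num.max (u i) 0 * dvec j i)
  (fun i => Num.max (- u i) 0 * dvec j i))//; try (by apply: sd);
  try by move=> i; rewrite mulr_ge0// /dvec ler0n.
rewrite !(total_dvec (p := fun i => Num.max (_ i) 0))//.
by rewrite (total_dvec (p := fun i => Num.max (- u i) 0))// -max_sub.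
Qed.

End L2.

(** * Neumann series and the spectrum *)

Section LinearOnL2.
Context {R : realType} {G : countType} (T : (G -> R) -> G -> R).
Hypothesis linT : linear_on_l2 T.

Lemma linear_l2D u v : l2 u -> l2 v ->
  T (fun i => u i + v i) = fun i => T u i + T v i.
Proof.
move=> hu hv; have := linT 1 hu hv.
rewrite (_ : (fun i => 1 * u i + v i) = fun i => u i + v i); last first.
  by apply/funext => i; rewrite mul1r.
by move=> ->; apply/funext => i; rewrite mul1r.
Qed.

Lemma linear_l20 : T (fun=> 0) = fun=> 0.
Proof.
have := linear_l2D l2_0 l2_0; rewrite (_ : (fun i : G => 0 + 0) = fun=> 0 :> R).
  move=> h; apply/funext => i; have := congr1 (fun g => g i) h => /= /eqP.
  by rewrite -subr_eq subrr eq_sym => /eqP.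
by apply/funext => i; rewrite addr0.
Qed.

Lemma linear_l2Z a u : l2 u -> T (fun i => a * u i) = fun i => a * T u i.
Proof.
move=> hu; have := linT a hu l2_0; rewrite linear_l20.
rewrite (_ : (fun i => a * u i + 0) = fun i => a * u i); last first.
  by apply/funext => i; rewrite addr0.
by move=> ->; apply/funext => i; rewrite addr0.
Qed.

Lemma linear_l2N u : l2 u -> T (fun i => - u i) = fun i => - T u i.
Proof.
move=> /(linear_l2Z (-1)); rewrite (_ : (fun i => -1 * u i) = fun i => - u i).
  by move=> ->; apply/funext => i; rewrite mulN1r.
by apply/funext => i; rewrite mulN1r.
Qed.

Lemma linear_l2B u v : l2 u -> l2 v ->
  T (fun i => u i - v i) = fun i => T u i - T v i.
Proof. by move=> hu hv; rewrite linear_l2D ?linear_l2N//; exact: l2N. Qed.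

Lemma linear_l2_sum (I : Type) (r : seq I) (s : I -> G -> R) :
  (forall k, l2 (s k)) ->
  T (fun i => \sum_(k <- r) s k i) = fun i => \sum_(k <- r) T (s k) i.
Proof.
move=> hs; elim: r => [|k r IH].
  rewrite (_ : (fun i => \sum_(k <- [::]) s k i) = fun=> 0).
    by rewrite linear_l20; apply/funext => i; rewrite big_nil.
  by apply/funext => i; rewrite big_nil.
rewrite (_ : (fun i => \sum_(k <- k :: r) s k i) =
  fun i => s k i + \sum_(j <- r) s j i); last first.
  by apply/funext => i; rewrite big_cons.
rewrite linear_l2D ?IH//; last exact: l2_sum.
by apply/funext => i; rewrite big_cons.
Qed.

End LinearOnL2.

Section Neumann.
Context {R : realType} {G : countType} (T : (G -> R) -> G -> R) (c : R).
Hypotheses (linT : linear_on_l2 T) (c0 : 0 <= c) (c1 : c < 1).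
Hypothesis Tc : forall u C, l2_le u C -> l2_le (T u) (c * C).

(** The sum of T^k u, taken coordinate by coordinate: each coordinate is dominated by a geometric
    series, and norm bounds survive the pointwise limit. *)
Definition neumann (u : G -> R) : G -> R :=
  fun i => limn (series (fun k => iter k T u i)).

Let l2T u : l2 u -> l2 (T u).
Proof. by move=> /l2P[C hC]; apply/l2P; exists (c * C); exact: Tc. Qed.

Let l2_iter k u : l2 u -> l2 (iter k T u).
Proof. by move=> hu; elim: k => //= k; exact: l2T. Qed.

Let iter_le k u C : l2_le u C -> l2_le (iter k T u) (c ^+ k * C).
Proof.
move=> hu; elim: k => [|k IH]; first by rewrite expr0 mul1r.
by rewrite iterS exprS -mulrA; exact: Tc.
Qed.

Let partial_le n u C : l2_le u C ->
  l2_le (fun i => series (fun k => iter k T u i) n) (C / (1 - c)).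
Proof.
have hc : 0 < 1 - c by rewrite subr_gt0.
move=> hu; have C0 := proj1 hu.
apply: (@l2_leW _ _ _ (C * (1 - c ^+ n) / (1 - c))).
  rewrite ler_pM2r ?invr_gt0// -{2}(mulr1 C) ler_wpM2l// lerBlDr lerDl.
  exact: exprn_ge0.
elim: n => [|n IH].
  rewrite expr0 subrr mulr0 mul0r /series/=.
  under eq_fun do rewrite big_nil.
  exact: l2_le_zero.
rewrite /series/=; under eq_fun do rewrite big_nat_recr//=.
have -> : C * (1 - c ^+ n.+1) / (1 - c) = C * (1 - c ^+ n) / (1 - c) + c ^+ n * C.
  by rewrite exprS; field; rewrite gt_eqF.
exact: l2_leD IH (iter_le n hu).
Qed.

Lemma neumann_cvg u i : l2 u ->
  series (fun k => iter k T u i) n @[n --> \oo] --> neumann u i.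
Proof.
move=> /l2P[C hC]; have C0 := proj1 hC.
suff : cvgn (series (fun k => iter k T u i)) by [].
apply: normed_cvg; apply: (@series_le_cvg _ _ (geometric C c)).
- by move=> n /=; exact: normr_ge0.
- by move=> n; rewrite /geometric/= mulr_ge0// exprn_ge0.
- move=> n; rewrite /geometric/= mulrC.
  by apply: l2_le_coord; exact: iter_le.
- by apply: is_cvg_geometric_series; rewrite ger0_norm.
Qed.

Lemma neumann_le u C : l2_le u C -> l2_le (neumann u) (C / (1 - c)).
Proof.
move=> hu; have l2u : l2 u by apply/l2P; exists C.
apply: (@l2_le_cvg _ _ (fun n i => series (fun k => iter k T u i) n)).
- by rewrite divr_ge0 ?(proj1 hu)// subr_ge0 ltW.
- by move=> i; exact: neumann_cvg.
- by near=> n; exact: partial_le.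
Unshelve. all: by end_near. Qed.

Lemma neumann_l2 u : l2 u -> l2 (neumann u).
Proof. by move=> /l2P[C /neumann_le h]; apply/l2P; exists (C / (1 - c)). Qed.

Lemma iter_linear k : linear_on_l2 (iter k T).
Proof.
move=> a u v hu hv; elim: k => //= k ->.
by rewrite linT//; exact: l2_iter.
Qed.

Lemma neumann_linear : linear_on_l2 neumann.
Proof.
move=> a u v hu hv; apply/funext => i.
have hl : l2 (fun i => a * u i + v i) by apply: l2D => //; exact: l2Z.
have h1 := @neumann_cvg _ i hl.
have h2 : series (fun k => iter k T (fun i => a * u i + v i) i) n @[n --> \oo]
    --> a * neumann u i + neumann v i.
  rewrite (_ : (fun n => _) = (fun n => a * series (fun k => iter k T u i) n +
    series (fun k => iter k T v i) n)).
    apply: cvgD; last exact: neumann_cvg.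
    by apply: cvgMr; exact: neumann_cvg.
  apply/funext => n; rewrite /series/= mulr_sumr -big_split/=.
  by apply: eq_bigr => k _; rewrite iter_linear.
exact: (cvg_unique _ h1 h2).
Qed.

Lemma neumannS u : l2 u -> neumann u = fun i => u i + neumann (T u) i.
Proof.
move=> hu; apply/funext => i.
have h1 := @neumann_cvg _ i hu; rewrite -cvg_shiftS/= in h1.
have h2 : series (fun k => iter k T u i) n.+1 @[n --> \oo]
    --> u i + neumann (T u) i.
  under eq_fun => n.
    rewrite /series/= big_nat_recl//=.
    under eq_bigr do rewrite -iterS iterSr.
    over.
  by apply: cvgD; [exact: cvg_cst|exact: neumann_cvg (l2T hu)].
exact: (cvg_unique _ h1 h2).
Qed.

Lemma neumann_left u : l2 u -> neumann (fun i => u i - T u i) = u.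
Proof.
move=> hu; rewrite (linear_l2B neumann_linear)//; last exact: l2T.
by apply/funext => i; rewrite (neumannS hu) addrK.
Qed.

Lemma l2_small (u : G -> R) C : (forall n, l2_le u (c ^+ n * C)) -> u = fun=> 0.
Proof.
move=> h; apply/funext => i; apply/eqP; rewrite -normr_le0.
have h0 : c ^+ n * C @[n --> \oo] --> (0 : R).
  rewrite -[X in _ --> X](mul0r C); apply: cvgMl.
  by apply: cvg_expr; rewrite ger0_norm.
by apply: (cvgr_to_ge h0); near=> n; apply: l2_le_coord.
Unshelve. all: by end_near. Qed.

(** [T] cannot be exchanged with a limit that is only pointwise. Instead, splitting off the first
    term of the series shows that the defect T N u - N T u does not change when [u] is replaced by T
    u; after n replacements its norm is at most a constant times c^n, so it is zero. *)
Lemma neumann_comm u : l2 u -> T (neumann u) = neumann (T u).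
Proof.
move=> hu.
have dE n : (fun i => T (neumann u) i - neumann (T u) i) =
    (fun i => T (neumann (iter n T u)) i - neumann (T (iter n T u)) i).
  elim: n => // n ->; have hn := l2_iter n hu; rewrite iterS.
  move: (iter n T u) hn => v hv.
  have E2 i : neumann (T v) i = T v i + neumann (T (T v)) i.
    by rewrite (neumannS (l2T hv)).
  have E3 i : T (neumann v) i = T v i + T (neumann (T v)) i.
    by rewrite (neumannS hv) linear_l2D//; exact: neumann_l2 (l2T hv).
  by apply/funext => i; rewrite E3 E2 opprD addrACA subrr add0r.
have /l2P[C hC] := hu; have C0 := proj1 hC.
suff : (fun i => T (neumann u) i - neumann (T u) i) = fun=> 0.
  move=> h; apply/funext => i; apply/eqP; rewrite -subr_eq0.
  by have /= -> := congr1 (fun g => g i) h.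
apply: (@l2_small _ (2 * (C / (1 - c)))) => n; rewrite (dE n).
have hb : 0 <= c ^+ n * C by rewrite mulr_ge0// exprn_ge0.
have hc : 0 < 1 - c by rewrite subr_gt0.
have -> : c ^+ n * (2 * (C / (1 - c))) = c ^+ n * C / (1 - c) + c ^+ n * C / (1 - c).
  by field; rewrite gt_eqF.
apply: l2_leD.
  apply: (l2_leW _ (Tc (neumann_le (iter_le n hC)))).
  rewrite ler_piMl//; last exact: ltW.
  by rewrite divr_ge0//; exact: ltW.
rewrite (_ : (fun i => - _) = fun i => -1 * neumann (T (iter n T u)) i); last first.
  by apply/funext => i; rewrite mulN1r.
have -> : c ^+ n * C / (1 - c) = `|-1| * (c ^+ n * C / (1 - c)).
  by rewrite normrN1 mul1r.
apply: l2_leZ; apply: neumann_le; apply: (l2_leW _ (Tc (iter_le n hC))).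
by rewrite ler_piMl// ltW.
Qed.

Lemma neumann_right u : l2 u -> (fun i => neumann u i - T (neumann u) i) = u.
Proof.
move=> hu; rewrite neumann_comm//; apply/funext => i.
by rewrite (neumannS hu) addrK.
Qed.

End Neumann.

(** Cauchy-Schwarz with weights |a_j|: twice the right side, symmetrized in (j, k), exceeds twice
    the left side by at least the sum of |a_j| |a_k| (|u_j| - |u_k|)^2. *)
Lemma weighted_sum_sqr {R : realType} (I : Type) (r : seq I) (a u : I -> R) :
  (\sum_(j <- r) a j * u j) ^+ 2 <=
  (\sum_(j <- r) `|a j|) * \sum_(j <- r) `|a j| * u j ^+ 2.
Proof.
have E1 : (\sum_(j <- r) `|a j|) * (\sum_(j <- r) `|a j| * u j ^+ 2) =
    \sum_(j <- r) \sum_(k <- r) `|a j| * `|a k| * u k ^+ 2.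
  rewrite mulr_suml; apply: eq_bigr => j _; rewrite mulr_sumr.
  by apply: eq_bigr => k _; rewrite mulrA.
have E2 : (\sum_(j <- r) `|a j|) * (\sum_(j <- r) `|a j| * u j ^+ 2) =
    \sum_(j <- r) \sum_(k <- r) `|a j| * `|a k| * u j ^+ 2.
  rewrite E1 exchange_big/=; apply: eq_bigr => j _; apply: eq_bigr => k _.
  by rewrite (mulrC `|a k|).
rewrite -(ler_pM2l (ltr0n R 2)) [in leRHS]mulr_natl [leRHS]mulr2n.
rewrite [X in _ <= X + _]E1 [X in _ <= _ + X]E2 -big_split/= expr2 mulr_suml mulr_sumr; apply: ler_sum => j _.
rewrite mulr_sumr mulr_sumr -big_split/=; apply: ler_sum => k _.
apply: le_trans (ler_norm _) _; rewrite !normrM normr_nat.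
rewrite -(real_normK (num_real (u j))) -(real_normK (num_real (u k))).
have := normr_ge0 (a j); have := normr_ge0 (a k).
move: `|u j| `|u k| `|a j| `|a k| => x y p q p0 q0.
rewrite -subr_ge0 (_ : _ - _ = p * q * (x - y) ^+ 2); last by ring.
by rewrite mulr_ge0 ?sqr_ge0// mulr_ge0.
Qed.

(** * The graph operator on l^2 and the compactness of its spectrum *)

Section GraphOperator.
Context {R : realType} {G : countType} (W : G -> G -> R).
Hypothesis hW : is_graph W.
Implicit Types (u v : G -> R) (A : {fset G}).

Definition nbs (i : G) : {fset G} := fset_set (neighbors W i).

Let Wsym i j : W i j = W j i. Proof. by case: hW. Qed.

Lemma neighbors_finite i : finite_set (neighbors W i).
Proof.
case: hW => _ _ + _; apply: contraPP => infi; apply/negP; rewrite -leNgt.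
apply: (@le_trans _ _ (deg W i)); first by rewrite /deg /counting asboolF.
by apply: ereal_sup_ubound; exists i.
Qed.

Lemma mem_nbs i j : (j \in nbs i) = (W i j != 0).
Proof.
rewrite /nbs in_fset_set; last exact: neighbors_finite.
by apply/idP/idP => [/set_mem|/mem_set].
Qed.

Lemma W_opE u i : W_op W u i = \sum_(j <- nbs i) W i j * u j.
Proof. by rewrite /W_op fsbig_finite//; exact: neighbors_finite. Qed.

Lemma W_out i j : j \notin nbs i -> W i j = 0.
Proof. by rewrite mem_nbs negbK => /eqP. Qed.

(** At most [graph_deg W] entries are nonzero, each at most the inverse of that number. An isolated
    vertex is set aside because the division needs a positive degree. *)
Lemma row_sum_le1 i : \sum_(j <- nbs i) `|W i j| <= 1.
Proof.
have [_ _ dfin Wd] := hW.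
have [n0|n0] := eqVneq #|` nbs i| 0%N.
  by move/eqP: n0; rewrite cardfs_eq0 => /eqP ->; rewrite big_seq_fset0.
have dge : ((#|` nbs i|)%:R%:E <= graph_deg W)%E.
  apply: (@le_trans _ _ (deg W i)); last by apply: ereal_sup_ubound; exists i.
  by rewrite /deg /counting asboolT//; exact: neighbors_finite.
have dn0 : 0 < (#|` nbs i|)%:R :> R by rewrite ltr0n lt0n.
have dfn : graph_deg W \is a fin_num.
  by rewrite ge0_fin_numE//; apply: le_trans dge; rewrite lee_fin.
have dge' : (#|` nbs i|)%:R <= fine (graph_deg W) by rewrite -lee_fin fineK.
apply: (@le_trans _ _ (\sum_(j <- nbs i) (fine (graph_deg W))^-1)).
  by apply: ler_sum => j _; exact: Wd.
rewrite big_const_seq count_predT iter_addr_0 -mulr_natr mulrC.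
by rewrite ler_pdivrMr ?mul1r// (lt_le_trans dn0).
Qed.

Lemma sum_fset_sub (A B : {fset G}) (g : G -> R) : (A `<=` B)%fset ->
  (forall i, i \notin A -> g i = 0) -> \sum_(i <- B) g i = \sum_(i <- A) g i.
Proof.
move=> AB gA; rewrite (big_fsetID _ (mem A))/=.
rewrite [X in _ + X]big1_seq ?addr0; last first.
  by move=> i /andP[_]; rewrite !inE/= => /andP[_ /gA].
apply: eq_fbigl => i; rewrite !inE/=; apply: andb_idl => iA.
exact: (fsubsetP AB).
Qed.

Lemma W_opE_sub u i B : (nbs i `<=` B)%fset ->
  W_op W u i = \sum_(j <- B) W i j * u j.
Proof.
move=> iB; rewrite W_opE; symmetry; apply: sum_fset_sub => // j /W_out ->.
by rewrite mul0r.
Qed.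

Lemma row_sum_fset i A : \sum_(j <- A) `|W i j| <= 1.
Proof.
apply: le_trans (row_sum_le1 i).
rewrite -(@sum_fset_sub (nbs i) (A `|` nbs i)%fset); last 2 first.
- exact: fsubsetUr.
- by move=> j /W_out ->; rewrite normr0.
rewrite [leRHS](big_fsetID _ (mem A))/=.
rewrite (_ : [fset x | x in (A `|` nbs i)%fset & mem A x]%fset = A); last first.
  by apply/fsetP => j; rewrite !inE/= andbC; apply: andb_idr => ->.
by rewrite lerDl sumr_ge0.
Qed.

Lemma W_op_linear : linear_on_l2 (W_op W).
Proof.
move=> a u v _ _; apply/funext => i; rewrite !W_opE mulr_sumr -big_split/=.
by apply: eq_bigr => j _; ring.
Qed.

(* Schur's test: each row and column of |W| has sum at most 1. *)
Lemma W_op_le u C : l2_le u C -> l2_le (W_op W u) C.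
Proof.
move=> [C0 hC]; split=> // F.
pose B := (\bigcup_(i <- F) nbs i)%fset.
apply: le_trans (hC B).
have h i : i \in F -> (W_op W u i) ^+ 2 <= \sum_(j <- B) `|W i j| * u j ^+ 2.
  move=> iF; have iB : (nbs i `<=` B)%fset.
    by apply/fsubsetP => j ji; apply/bigfcupP; exists i => //; rewrite iF.
  rewrite (W_opE_sub _ iB).
  have := @weighted_sum_sqr _ _ B (W i) u.
  move=> /le_trans; apply; rewrite ler_piMl ?row_sum_fset//.
  by apply: sumr_ge0 => j _; rewrite mulr_ge0 ?sqr_ge0.
rewrite big_seq; apply: (@le_trans _ _
  (\sum_(i <- F | i \in F) \sum_(j <- B) `|W i j| * u j ^+ 2)).
  by apply: ler_sum => i iF; exact: h.
rewrite -big_seq exchange_big/=; apply: ler_sum => j _.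
rewrite -mulr_suml ler_piMl ?sqr_ge0//.
by under eq_bigr do rewrite Wsym; exact: row_sum_fset.
Qed.

Lemma W_op_l2 u : l2 u -> l2 (W_op W u).
Proof. by move=> /l2P[C hC]; apply/l2P; exists C; exact: W_op_le. Qed.

(** As W has norm at most 1, W / l is a strict contraction, and -l^-1 times the Neumann series of W
    / l inverts W - l. *)
Lemma resolvent_big (l : R) : 1 < `|l| -> resolvent_set W l.
Proof.
move=> l1; have l0 : l != 0.
  by apply: contraTneq l1 => ->; rewrite normr0 ltr10.
pose T u := fun i => l^-1 * W_op W u i.
have c0 : 0 <= `|l|^-1 by rewrite invr_ge0.
have c1 : `|l|^-1 < 1 by rewrite invf_lt1// (lt_trans ltr01).
have linT : linear_on_l2 T.
  move=> a u v hu hv; apply/funext => i.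
  by rewrite /T W_op_linear//; ring.
have Tc u C : l2_le u C -> l2_le (T u) (`|l|^-1 * C).
  by move=> /W_op_le hu; rewrite -normfV; exact: l2_leZ.
have T2 u : l2 u -> l2 (T u).
  by move=> hu; apply: l2Z; exact: W_op_l2.
have N2 u : l2 u -> l2 (neumann T u) by exact: (neumann_l2 c0 c1 Tc).
have linN := neumann_linear linT c0 c1 Tc.
exists (fun u i => - l^-1 * neumann T u i); split.
- move=> a u v hu hv; apply/funext => i; rewrite linN//; ring.
- split=> [u hu|]; first by apply: l2Z; exact: N2.
  exists (`|- l^-1| * (1 - `|l|^-1)^-1) => u hu.
  apply: l2norm_le; rewrite -mulrA; apply: l2_leZ; rewrite mulrC.
  by apply: (neumann_le c0 c1 Tc); exact: l2_l2norm.
- move=> u hu; have hT := neumann_left linT c0 c1 Tc hu.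
  have -> : (fun i => W_op W u i - l * u i) = fun i => - l * (u i - T u i).
    by apply/funext => i; rewrite /T; field.
  rewrite (linear_l2Z linN); last by apply: l2B => //; exact: T2.
  by rewrite hT; apply/funext => i; field.
- move=> u hu; have hT := neumann_right linT c0 c1 Tc hu.
  rewrite (linear_l2Z W_op_linear); last exact: N2.
  rewrite -[RHS]hT; apply/funext => i; rewrite /T; field.
  by rewrite l0.
Qed.

(** With S the resolvent at [l0] and z = l - l0, one has W - l = (W - l0)(1 - z S), so the Neumann
    series of z S composed with S inverts W - l as soon as |z| times the norm of S is below 1. *)
Lemma resolvent_near (l0 : R) : resolvent_set W l0 ->
  exists2 e : R, 0 < e & forall l, `|l - l0| < e -> resolvent_set W l.
Proof.
move=> [S [linS [S2 [C SC]] Sl Sr]].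
(* [C] comes from an existential and may be zero or negative; the maximum makes the radius D^-1
   positive. *)
pose D := Num.max C 1; have D0 : 0 < D by rewrite lt_max ltr01 orbT.
have SD u B : l2_le u B -> l2_le (S u) (D * B).
  move=> hu; have l2u : l2 u by apply/l2P; exists B.
  apply: (l2_leW _ (l2_l2norm (S2 _ l2u))).
  apply: le_trans (SC u l2u) _.
  apply: (@le_trans _ _ (D * l2norm u)).
    by rewrite ler_wpM2r ?sqrtr_ge0// le_max lexx.
  by apply: ler_wpM2l; [exact: ltW|exact: l2norm_le].
exists D^-1; first by rewrite invr_gt0.
move=> l ll0; pose z := l - l0; pose T u := fun i => z * S u i.
pose c := `|z| * D.
have c0 : 0 <= c by rewrite mulr_ge0// ltW.
have c1 : c < 1 by rewrite /c -ltr_pdivlMr// mul1r.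
have linT : linear_on_l2 T.
  by move=> a u v hu hv; apply/funext => i; rewrite /T linS//; ring.
have Tc u B : l2_le u B -> l2_le (T u) (c * B).
  by move=> /SD hu; rewrite /c -mulrA; exact: l2_leZ.
have T2 u : l2 u -> l2 (T u) by move=> /S2; exact: l2Z.
have N2 u : l2 u -> l2 (neumann T u) by exact: (neumann_l2 c0 c1 Tc).
have linN := neumann_linear linT c0 c1 Tc.
(* The series N and S commute: write u = N u - T N u, push S through by linearity, and recognize the
   left inverse property at S N u. The right inverse below relies on this. *)
have NS u : l2 u -> neumann T (S u) = S (neumann T u).
  move=> hu; rewrite -[in LHS](neumann_right linT c0 c1 Tc hu).
  rewrite (linear_l2B linS); last 2 first.
  - exact: N2.
  - by apply: T2; exact: N2.
  rewrite -[RHS](neumann_left linT c0 c1 Tc (S2 _ (N2 _ hu))).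
  congr neumann; apply/funext => i; congr (_ - _).
  by rewrite /T (linear_l2Z linS)//; apply: S2; exact: N2.
exists (fun u => neumann T (S u)); split.
- move=> a u v hu hv; rewrite linS// linN//; exact: S2.
- split=> [u hu|]; first by apply: N2; exact: S2.
  exists (D / (1 - c)) => u hu; apply: l2norm_le.
  have -> : D / (1 - c) * l2norm u = D * l2norm u / (1 - c) by ring.
  by apply: (neumann_le c0 c1 Tc); apply: SD; exact: l2_l2norm.
- move=> u hu; rewrite -[RHS](neumann_left linT c0 c1 Tc hu); congr neumann.
  have -> : (fun i => W_op W u i - l * u i) =
      fun i => (W_op W u i - l0 * u i) - z * u i.
    by apply/funext => i; rewrite /z; ring.
  rewrite (linear_l2B linS); last 2 first.
  + by apply: l2B; [exact: W_op_l2|exact: l2Z].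
  + exact: l2Z.
  by rewrite Sl// (linear_l2Z linS).
- move=> u hu; rewrite NS// -[RHS](neumann_right linT c0 c1 Tc hu).
  have h := Sr _ (N2 _ hu); apply/funext => i.
  have hi := congr1 (fun g => g i) h; rewrite /= in hi.
  by rewrite -[X in _ = X - _]hi /T /z; ring.
Qed.

Lemma Sp_le1 (x : R) : Sp W x -> `|x| <= 1.
Proof. by move=> Spx; rewrite leNgt; apply/negP => /resolvent_big. Qed.

Lemma Sp_closed : closed (Sp W : set R^o).
Proof.
rewrite /Sp; apply: open_closedC; rewrite openE => l /resolvent_near[e e0 he].
apply/nbhs_ballP; exists e => //= y; rewrite /ball/= distrC; exact: he.
Qed.

Lemma Sp_measurable : measurable (Sp W : set R).
Proof. exact: closed_measurable Sp_closed. Qed.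

End GraphOperator.

(** * Spectral measures *)

Section Density.
Local Open Scope ereal_scope.
Context d (T : measurableType d) (R : realType).
Variables (m : {measure set T -> \bar R}) (g : T -> R).
Hypotheses (g0 : forall x, (0 <= g x)%R) (mg : measurable_fun setT g).

Import HBNNSimple.

(** The given equality covers indicators; simple functions follow by linearity, and nonnegative [f]
    by monotone convergence on both sides. *)
Lemma ge0_integral_density (nu : {measure set T -> \bar R}) (f : T -> \bar R) :
  (forall A, measurable A -> nu A = \int[m]_(x in A) (g x)%:E) ->
  (forall x, 0 <= f x) -> measurable_fun setT f ->
  \int[nu]_x f x = \int[m]_x (f x * (g x)%:E).
Proof.
move=> nuE f0 mf; pose h := nnsfun_approx measurableT mf.
have mgE : measurable_fun setT (EFin \o g) by exact/measurable_EFinP.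
have -> : \int[nu]_x f x = limn (fun n => \int[nu]_x (EFin \o h n) x).
  have fE x : f x = limn (fun n => (EFin \o h n) x).
    by apply/esym/cvg_lim => //; exact: cvg_nnsfun_approx.
  under eq_integral do rewrite fE.
  apply: monotone_convergence => //.
  - by move=> n; apply/measurable_EFinP.
  - by move=> n x _ //=; rewrite lee_fin.
  - by move=> x _ a b ab; rewrite lee_fin; exact/lefP/nd_nnsfun_approx.
have -> : \int[m]_x (f x * (g x)%:E) =
    limn (fun n => \int[m]_x ((EFin \o h n) x * (g x)%:E)).
  have fg x : f x * (g x)%:E = limn (fun n => (EFin \o h n) x * (g x)%:E).
    by apply/esym/cvg_lim => //; apply: cvgeZr => //; exact: cvg_nnsfun_approx.
  under eq_integral do rewrite fg.
  apply: monotone_convergence => //.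
  - by move=> n; apply: emeasurable_funM => //; exact/measurable_EFinP.
  - by move=> n x _ /=; rewrite mule_ge0 ?lee_fin.
  - move=> x _ a b ab /=; rewrite lee_wpmul2r ?lee_fin//.
    exact/lefP/nd_nnsfun_approx.
congr (limn _); apply/funext => n.
transitivity (\int[nu]_x
   (\sum_(y \in range (h n)) (y * \1_(h n @^-1` [set y]) x)%:E)).
  by apply: eq_integral => t _; rewrite /= fimfunE -fsumEFin.
have indich r : measurable_fun setT (fun x => (r * \1_(h n @^-1` [set r]) x)%:E).
  by apply/measurable_EFinP; exact: measurable_funM.
rewrite ge0_integral_fsum//; last by move=> y x _; exact: nnfun_muleindic_ge0.
transitivity (\int[m]_x (\sum_(y \in range (h n))
    (y * \1_(h n @^-1` [set y]) x)%:E * (g x)%:E)); last first.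
  apply: eq_integral => x _.
  rewrite -ge0_mule_fsuml => [|y]; last exact: nnfun_muleindic_ge0.
  by rewrite fsumEFin // -(fimfunE _ x).
rewrite ge0_integral_fsum//; last 2 first.
  - by move=> y; apply: emeasurable_funM.
- by move=> y x _; apply: mule_ge0; [exact: nnfun_muleindic_ge0|rewrite lee_fin].
apply: eq_fsbigr => r rhn.
have r0 : (0 <= r)%R by move: rhn => /set_mem[x _ <-].
rewrite integralZl_indic_nnsfun// integral_indic// setIT nuE//.
under [RHS]eq_integral do rewrite EFinM -muleA.
rewrite ge0_integralZl//; first last.
- by move=> x _; rewrite mule_ge0 ?lee_fin.
- by apply: emeasurable_funM => //; exact/measurable_EFinP.
congr (_ * _); rewrite [LHS]integral_mkcond; apply: eq_integral => x _.
by rewrite epatch_indic/= muleC.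
Qed.

Definition density (A : set T) : \bar R := \int[m]_(x in A) (g x)%:E.

Let density0 : density set0 = 0.
Proof. by rewrite /density integral_set0. Qed.

Let density_ge0 A : 0 <= density A.
Proof. by apply: integral_ge0 => x _; rewrite lee_fin. Qed.

Let density_sigma_additive : semi_sigma_additive density.
Proof.
move=> /= A mA tA mUA; rewrite /density ge0_integral_bigcup//; last 2 first.
- by apply: measurable_funTS; exact/measurable_EFinP.
- by move=> x _; rewrite lee_fin.
apply: is_cvg_ereal_nneg_natsum_cond => n _ _.
by apply: integral_ge0 => /= x _; rewrite lee_fin.
Qed.

HB.instance Definition _ := isMeasure.Build _ _ _
  density density0 density_ge0 density_sigma_additive.

Definition density_measure : {measure set T -> \bar R} := density.

End Density.

Section RawIntegral.
Import HBNNSimple.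

(** The integral is defined for a bare set function but reads it on measurable sets only. So
    [qmeasure] and [avg_mu], which are not declared measures, can be replaced by genuine measures
    that agree with them on Borel sets. *)
Lemma eq_integral_measurable d (T : measurableType d) (R : realType)
    (m1 m2 : set T -> \bar R) (D : set T) (f : T -> \bar R) :
  (forall A, measurable A -> m1 A = m2 A) ->
  (\int[m1]_(x in D) f x = \int[m2]_(x in D) f x)%E.
Proof.
move=> m12; rewrite /integral.
have E (h : {nnsfun T >-> R}) : sintegral m1 h = sintegral m2 h.
  by apply: eq_fsbigr => r _; rewrite m12//; exact: measurable_sfunP.
congr (ereal_sup _ - ereal_sup _)%E; apply/seteqP; split=> _ [h hf <-];
  by exists h => //; rewrite E.
Qed.

Lemma eq_integral_raw d (T : measurableType d) (R : realType)
    (m : set T -> \bar R) (D : set T) (f g : T -> \bar R) :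
  (forall x, D x -> f x = g x) ->
  (\int[m]_(x in D) f x = \int[m]_(x in D) g x)%E.
Proof.
move=> fg; rewrite /integral (_ : (fun x => f x) \_ D = (fun x => g x) \_ D)//.
by apply/funext => x; rewrite !patchE; case: ifPn => // /set_mem/fg.
Qed.

End RawIntegral.

(** An identity between signed measures, with every negative term moved to the other side: each side
    is then a positive measure, and the identity can be integrated against any nonnegative [f], even
    where the integrals are infinite. *)
Lemma integral_density_exchange d (T : measurableType d) (R : realType)
    (p1 p2 p3 q1 q2 q3 : {measure set T -> \bar R}) (g : T -> R)
    (f : T -> \bar R) :
  (forall x, 0 <= g x) -> measurable_fun setT g ->
  (forall x, 0 <= f x)%E -> measurable_fun setT f ->
  (forall A, measurable A -> (p1 A + (p2 A + \int[p3]_(x in A) (g x)%:E) =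
    q1 A + (q2 A + \int[q3]_(x in A) (g x)%:E))%E) ->
  (\int[p1]_x f x + (\int[p2]_x f x + \int[p3]_x (f x * (g x)%:E)) =
   \int[q1]_x f x + (\int[q2]_x f x + \int[q3]_x (f x * (g x)%:E)))%E.
Proof.
move=> g0 mg f0 mf h.
have D (p : {measure set T -> \bar R}) :
    (\int[p]_x (f x * (g x)%:E) = \int[density_measure p g0 mg]_x f x)%E.
  by symmetry; exact: ge0_integral_density.
have A3 (a b c : {measure set T -> \bar R}) :
    (\int[a]_x f x + (\int[b]_x f x + \int[c]_x f x) =
     \int[measure_add a (measure_add b c)]_x f x)%E.
  by rewrite !ge0_integral_measure_add.
rewrite !D !A3; apply: eq_integral_measurable => A mA.
have M (a b c : {measure set T -> \bar R}) :
    (measure_add a (measure_add b c) A = a A + (b A + c A))%E.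
  by rewrite measure_addE; congr (_ + _)%E; exact: measure_addE.
by rewrite !M; exact: h.
Qed.

Fact moment_rearrange1 {R : realType} (a b c p q s t : R) : 4 * p = s - t ->
  a + 2 * p + b + (c + 2 * q + b + (c - 2 * q + b + t)) =
  a - 2 * p + b + (c - 2 * q + b + (c + 2 * q + b + s)).
Proof. by move=> h; lra. Qed.

Fact moment_rearrange2 {R : realType} (a b c d p q r s : R) : p - q = c - d ->
  p + a - (q + b) = c + r - (d + s) -> r - s = a - b.
Proof. by move=> *; lra. Qed.

Fact moment_rearrange3 {R : realType} (a b c d p q : R) :
  a + (c + (d + q)) = b + (d + (c + p)) -> a - b = p - q.
Proof. by move=> h; lra. Qed.

(** * Spectral measures and moments of the graph operator *)

Section SpectralMeasure.
Context {R : realType} {G : countType} (W : G -> G -> R).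
Context (E : set R -> (G -> R) -> (G -> R)).
Hypotheses (hW : is_graph W) (hE : spectral_resolution W E).
Implicit Types (u v w : G -> R) (A B : set R) (f g : R -> R).

Let mSp := Sp_measurable hW.

Let E_lin A : measurable A -> linear_on_l2 (E A).
Proof. by case: hE => -[+ _ _ _] _ => /[apply] -[]. Qed.

Let E_l2 A u : measurable A -> l2 u -> l2 (E A u).
Proof. by case: hE => -[+ _ _ _] _ mA => /(_ _ mA)[_ + _ _]; exact. Qed.

Let E_idem A u : measurable A -> l2 u -> E A (E A u) = E A u.
Proof. by case: hE => -[+ _ _ _] _ mA => /(_ _ mA)[_ _ + _]; exact. Qed.

Let E_sa A u v : measurable A -> l2 u -> l2 v -> ip (E A u) v = ip u (E A v).
Proof. by case: hE => -[+ _ _ _] _ mA => /(_ _ mA)[_ _ _ +]; exact. Qed.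

Let E_0 u : l2 u -> E set0 u = fun=> 0.
Proof. by case: hE => -[_ + _ _] _ => /[apply] -[]. Qed.

Let E_Sp u : l2 u -> E (Sp W) u = u.
Proof. by case: hE => -[_ + _ _] _ => /[apply] -[]. Qed.

Let E_I A B u : measurable A -> measurable B -> l2 u ->
  E (A `&` B) u = E A (E B u).
Proof. by case: hE => -[_ _ + _] _ => h mA mB; exact: h. Qed.

Section Measure.
Variables (u : G -> R) (hu : l2 u).

(** [E] is unconstrained on sets that are not Borel; forcing 0 there makes the function nonnegative
    on all sets, as the measure structure demands. *)
Definition spectral_measure_fun A : \bar R :=
  if `[< measurable A >] then qmeasure E u A else 0%E.

Let q0 : spectral_measure_fun set0 = 0%E.
Proof.
rewrite /spectral_measure_fun asboolT// /qmeasure E_0//.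
rewrite (_ : (fun=> 0) = fun i => 0 * u i); last first.
  by apply/funext => i; rewrite mul0r.
by rewrite ipZl// mul0r.
Qed.

Let q_ge0 A : (0 <= spectral_measure_fun A)%E.
Proof.
rewrite /spectral_measure_fun; case: ifPn => // /asboolP mA.
rewrite lee_fin -E_idem// E_sa//; last exact: E_l2.
exact: ip_ge0.
Qed.

Let q_sigma_additive : semi_sigma_additive spectral_measure_fun.
Proof.
case: hE => -[_ _ _ /(_ _ hu) h] _ F mF tF mUF.
rewrite /spectral_measure_fun asboolT//.
rewrite (_ : (fun n => _) = (fun n => \sum_(0 <= i < n) qmeasure E u (F i))%E).
  exact: h.
by apply/funext => n; apply: eq_bigr => i _; rewrite asboolT.
Qed.

HB.instance Definition _ := isMeasure.Build _ _ _
  spectral_measure_fun q0 q_ge0 q_sigma_additive.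

Definition spectral_measure : {measure set R -> \bar R} := spectral_measure_fun.

Lemma spectral_measureE A : measurable A -> spectral_measure A = (ip (E A u) u)%:E.
Proof. by move=> mA; rewrite /= /spectral_measure_fun asboolT. Qed.

Lemma spectral_measure_Sp : spectral_measure (Sp W) = (ip u u)%:E.
Proof. by rewrite spectral_measureE// E_Sp. Qed.

Lemma spectral_measureI_Sp A : measurable A ->
  spectral_measure (A `&` Sp W) = spectral_measure A.
Proof.
move=> mA; rewrite !spectral_measureE//; last exact: measurableI.
by rewrite E_I// E_Sp.
Qed.

Lemma spectral_measure_fin A : measurable A -> (spectral_measure A < +oo)%E.
Proof. by move=> mA; rewrite spectral_measureE// ltry. Qed.

End Measure.

Definition Jint u f : R := fine (\int[qmeasure E u]_(x in Sp W) (f x)%:E).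

Definition bounded_meas f := measurable_fun (Sp W) f /\
  exists M : R, forall x, Sp W x -> `|f x| <= M.

Lemma JintE u (hu : l2 u) f :
  Jint u f = \int[spectral_measure hu]_(x in Sp W) f x.
Proof.
rewrite /Jint /Rintegral; congr fine; apply: eq_integral_measurable => A mA.
by rewrite spectral_measureE.
Qed.

Lemma spec_intE f u v : spec_int W E f u v =
  4^-1 * (Jint (fun i => u i + v i) f - Jint (fun i => u i - v i) f).
Proof. by []. Qed.

Lemma bounded_meas_integrable u (hu : l2 u) f : bounded_meas f ->
  (spectral_measure hu).-integrable (Sp W) (EFin \o f).
Proof.
move=> [mf [M fM]]; apply: measurable_bounded_integrable => //.
  exact: spectral_measure_fin.
exists M; split; first exact: num_real.
by move=> x Mx y Sy; apply: le_trans (ltW Mx); exact: fM.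
Qed.

Lemma bounded_measD f g : bounded_meas f -> bounded_meas g ->
  bounded_meas (fun x => f x + g x).
Proof.
move=> [mf [M fM]] [mg [N gN]]; split; first exact: measurable_funD.
exists (M + N) => x Sx.
by apply: le_trans (ler_normD _ _) _; apply: lerD; [exact: fM|exact: gN].
Qed.

Lemma bounded_measM f g : bounded_meas f -> bounded_meas g ->
  bounded_meas (fun x => f x * g x).
Proof.
move=> [mf [M fM]] [mg [N gN]]; split; first exact: measurable_funM.
by exists (M * N) => x Sx; rewrite normrM; apply: ler_pM => //; [exact: fM|exact: gN].
Qed.

Lemma bounded_meas_cst c : bounded_meas (fun=> c).
Proof. by split=> //; exists `|c|. Qed.

Lemma bounded_meas_id : bounded_meas idfun.
Proof. by split; [exact: measurable_id|exists 1 => x; exact: (Sp_le1 hW)]. Qed.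

Lemma bounded_measX k : bounded_meas (fun x => x ^+ k).
Proof.
elim: k => [|k IH].
  by rewrite (_ : (fun x => _) = fun=> 1) //; exact: bounded_meas_cst.
rewrite (_ : (fun x => _) = fun x => idfun x * x ^+ k); last first.
  by apply/funext => x; rewrite exprS.
exact: bounded_measM bounded_meas_id IH.
Qed.

Lemma JintD u f g : l2 u -> bounded_meas f -> bounded_meas g ->
  Jint u (fun x => f x + g x) = Jint u f + Jint u g.
Proof.
move=> hu bf bg; rewrite !JintE.
by rewrite RintegralD//; exact: bounded_meas_integrable.
Qed.

Lemma JintZ u c f : l2 u -> bounded_meas f ->
  Jint u (fun x => c * f x) = c * Jint u f.
Proof.
by move=> hu bf; rewrite !JintE RintegralZl//; exact: bounded_meas_integrable.
Qed.

Lemma Jint_cst u c : l2 u -> Jint u (fun=> c) = c * ip u u.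
Proof. by move=> hu; rewrite JintE Rintegral_cst// spectral_measure_Sp. Qed.

Lemma Jint_le u f g : l2 u -> bounded_meas f -> bounded_meas g ->
  (forall x, Sp W x -> f x <= g x) -> Jint u f <= Jint u g.
Proof.
move=> hu bf bg fg; rewrite !JintE le_Rintegral//; exact: bounded_meas_integrable.
Qed.

Lemma Jint_norm_le u f M : l2 u -> bounded_meas f ->
  (forall x, Sp W x -> `|f x| <= M) -> `|Jint u f| <= M * ip u u.
Proof.
move=> hu bf fM; rewrite ler_norml -mulNr -!Jint_cst//.
by apply/andP; split; apply: Jint_le => //; try exact: bounded_meas_cst;
  move=> x /fM; rewrite ler_norml => /andP[].
Qed.

Lemma eq_Jint u f g : (forall x, Sp W x -> f x = g x) -> Jint u f = Jint u g.
Proof.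
by move=> fg; congr fine; apply: eq_integral_raw => x Sx; rewrite fg.
Qed.

Let ipDr u v w : l2 u -> l2 v -> l2 w ->
  ip w (fun i => u i + v i) = ip w u + ip w v.
Proof. by move=> hu hv hw; rewrite ipC ipDl// !(ipC w). Qed.

Lemma qmeasureD A u v : measurable A -> l2 u -> l2 v ->
  ip (E A (fun i => u i + v i)) (fun i => u i + v i) =
  ip (E A u) u + 2 * ip (E A u) v + ip (E A v) v.
Proof.
move=> mA hu hv; rewrite linear_l2D//; last exact: E_lin.
have hEu := E_l2 mA hu; have hEv := E_l2 mA hv.
rewrite ipDl//; last exact: l2D.
rewrite !ipDr// (E_sa mA hv hu) (ipC v); ring.
Qed.

Let ipNr u v : l2 u -> l2 v -> ip u (fun i => - v i) = - ip u v.
Proof.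
move=> hu hv; rewrite ipC (_ : (fun i => - v i) = fun i => -1 * v i); last first.
  by apply/funext => i; rewrite mulN1r.
by rewrite ipZl// mulN1r ipC.
Qed.

Lemma qmeasureB A u v : measurable A -> l2 u -> l2 v ->
  ip (E A (fun i => u i - v i)) (fun i => u i - v i) =
  ip (E A u) u - 2 * ip (E A u) v + ip (E A v) v.
Proof.
move=> mA hu hv; rewrite qmeasureD//; last exact: l2N.
have hEu := E_l2 mA hu; have hEv := E_l2 mA hv.
rewrite linear_l2N//; last exact: E_lin.
rewrite ipNr// ipNr//; last exact: l2N.
by rewrite (ipC (fun i => - E A v i)) ipNr// (ipC v); ring.
Qed.

Lemma polarization u v : l2 u -> l2 v ->
  ip u v = 4^-1 * (ip (fun i => u i + v i) (fun i => u i + v i) -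
                   ip (fun i => u i - v i) (fun i => u i - v i)).
Proof.
move=> hu hv; have := qmeasureD mSp hu hv; have := qmeasureB mSp hu hv.
rewrite !E_Sp//; [|exact: l2D|exact: l2B].
by move=> -> ->; field.
Qed.

(** Localization: the spectral identity gives only total integrals, but applied to E(A) v instead of
    v it sees only the part in A, because E(A) E(B) is the projection of the intersection. *)
Lemma qmeasure_split A B u v : measurable A -> measurable B -> l2 u -> l2 v ->
  (B `<=` A -> ip (E B (fun i => u i + E A v i)) (fun i => u i + E A v i) =
     ip (E B (fun i => u i + v i)) (fun i => u i + v i)) /\
  (B `<=` ~` A -> ip (E B (fun i => u i + E A v i)) (fun i => u i + E A v i) =
     ip (E B u) u).
Proof.
move=> mA mB hu hv; have hEv := E_l2 mA hv.
have hI w : l2 w -> ip (E B w) (E A v) = ip (E (A `&` B) w) v.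
  by move=> hw; rewrite E_I// (E_sa mA (E_l2 mB hw) hv).
rewrite qmeasureD// !hI// -E_I//; last exact: measurableI.
split=> [BA|BA].
  rewrite qmeasureD// (_ : A `&` B = B); last by apply/setIidPr.
  by rewrite (_ : B `&` A = B)//; apply/setIidPl.
have AB0 : A `&` B = set0.
  by apply/seteqP; split=> x // -[Ax /BA].
rewrite setIAC setIid AB0 !E_0//.
rewrite (_ : (fun=> 0) = fun i => 0 * v i); last by apply/funext => i; rewrite mul0r.
by rewrite ipZl// mul0r; ring.
Qed.

Let integral_id_split A u v (hu : l2 u) (hv : l2 v) : measurable A ->
  Jint (fun i => u i + E A v i) idfun =
  \int[spectral_measure (l2D hu hv)]_(x in Sp W `&` A) x +
  \int[spectral_measure hu]_(x in Sp W `&` ~` A) x.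
Proof.
move=> mA; have hEv := E_l2 mA hv; rewrite (JintE (l2D hu hEv)).
have SA : Sp W = (Sp W `&` A) `|` (Sp W `&` ~` A).
  by rewrite -setIUr setUv setIT.
have mSA : measurable (Sp W `&` A) by exact: measurableI.
have mSA' : measurable (Sp W `&` ~` A).
  by apply: measurableI => //; exact: measurableC.
rewrite [in LHS]SA Rintegral_setU//; last 2 first.
- by rewrite -SA; apply: bounded_meas_integrable; exact: bounded_meas_id.
- by apply/disj_setPS => x [[_ Ax] [_]].
congr (_ + _); congr fine; apply: eq_measure_integral => B mB BS;
  rewrite !spectral_measureE//; congr EFin.
- by apply: (qmeasure_split mA mB hu hv).1 => x /BS[].
- by apply: (qmeasure_split mA mB hu hv).2 => x /BS[].
Qed.

(* The signed measure <E u, v> multiplied by x is <E (W u), v>. *)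
Let qmeasure_W A u v (hu : l2 u) (hv : l2 v) : measurable A ->
  4 * ip (E A (W_op W u)) v =
  \int[spectral_measure (l2D hu hv)]_(x in Sp W `&` A) x -
  \int[spectral_measure (l2B hu hv)]_(x in Sp W `&` A) x.
Proof.
move=> mA; have hEv := E_l2 mA hv; have hWu := W_op_l2 hW hu.
rewrite E_sa// (proj2 hE)// spec_intE.
rewrite (integral_id_split hu hv mA).
have -> : (fun i => u i - E A v i) = (fun i => u i + E A (fun j => - v j) i).
  by rewrite linear_l2N//; exact: E_lin.
rewrite (integral_id_split hu (l2N hv) mA).
(* [spectral_measure] takes as argument the proof that its vector is in [l2]; u - v and u + (- v)
   are convertible and only the proofs differ. *)
have -> : l2D hu (l2N hv) = l2B hu hv by exact: Prop_irrelevance.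
by field.
Qed.

Lemma integral_spectral u (hu : l2 u) f : (forall x, Sp W x -> 0 <= f x) ->
  bounded_meas f ->
  (\int[spectral_measure hu]_x ((f \_ (Sp W)) x)%:E = (Jint u f)%:E)%E.
Proof.
move=> f0 bf; rewrite (JintE hu).
rewrite (_ : (fun x => ((f \_ (Sp W)) x)%:E) = (EFin \o f) \_ (Sp W)); last first.
  by rewrite restrict_EFin.
rewrite -integral_mkcond /Rintegral fineK//.
have := integrable_fin_num mSp (bounded_meas_integrable hu bf).
by [].
Qed.

(** This integrates x <E u, v> = <E (W u), v>. As x changes sign, the density 1 + x is used,
    nonnegative on the spectrum since |x| <= 1, and the extra copy of each measure is balanced on
    the opposite side. *)
Lemma Jint_W_ge0 u v f : l2 u -> l2 v ->
  bounded_meas f -> (forall x, Sp W x -> 0 <= f x) ->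
  Jint (fun i => W_op W u i + v i) f - Jint (fun i => W_op W u i - v i) f =
  Jint (fun i => u i + v i) (fun x => x * f x) -
  Jint (fun i => u i - v i) (fun x => x * f x).
Proof.
move=> hu hv bf f0; have hWu := W_op_l2 hW hu.
have hp := l2D hu hv; have hm := l2B hu hv.
have hWp := l2D hWu hv; have hWm := l2B hWu hv.
pose g0 := fun x : R => 1 + x; pose g := g0 \_ (Sp W).
have bg0 : bounded_meas g0.
  by apply: bounded_measD; [exact: bounded_meas_cst|exact: bounded_meas_id].
have g00 x : Sp W x -> 0 <= g0 x.
  by move=> /(Sp_le1 hW); rewrite ler_norml => /andP[h _]; rewrite /g0; lra.
have gg0 x : 0 <= g x by rewrite /g patchE; case: ifPn => // /set_mem; exact: g00.
have mg : measurable_fun setT g by apply/(measurable_restrictT _ mSp); exact: bg0.1.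
pose F := fun x => ((f \_ (Sp W)) x)%:E.
have F0 x : (0 <= F x)%E.
  by rewrite lee_fin patchE; case: ifPn => // /set_mem; exact: f0.
have mF : measurable_fun setT F.
  by apply/measurable_EFinP/(measurable_restrictT _ mSp); exact: bf.1.
have dens w (hw : l2 w) A : measurable A ->
    (\int[spectral_measure hw]_(x in A) (g x)%:E)%E = ((ip (E A w) w) +
      \int[spectral_measure hw]_(x in Sp W `&` A) x)%:E.
  move=> mA; rewrite /g.
  rewrite (_ : (fun x => ((g0 \_ (Sp W)) x)%:E) = (EFin \o g0) \_ (Sp W)); last first.
    by rewrite restrict_EFin.
  rewrite -integral_mkcondr setIC.
  have mSA : measurable (Sp W `&` A) by exact: measurableI.
  have bi h : bounded_meas h -> (spectral_measure hw).-integrable (Sp W `&` A) (EFin \o h).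
    move=> bh; apply: (integrableS mSp) => //.
    exact: bounded_meas_integrable.
  rewrite -[LHS]fineK; last by apply: integrable_fin_num => //; exact: bi.
  congr EFin; rewrite -/(Rintegral _ _ _) RintegralD//; last 2 first.
  - by apply: bi; exact: bounded_meas_cst.
  - by apply: bi; exact: bounded_meas_id.
  rewrite Rintegral_cst// mul1r setIC; congr (_ + _).
  by rewrite spectral_measureI_Sp// spectral_measureE.
have D w (hw : l2 w) :
    (\int[spectral_measure hw]_x (F x * (g x)%:E) = (Jint w (fun x => f x * g0 x))%:E)%E.
  rewrite -(@integral_spectral _ hw); last 2 first.
  - by move=> x Sx; rewrite mulr_ge0 ?f0 ?g00.
  - exact: bounded_measM.
  apply: eq_integral => x _; rewrite /F /g -EFinM; congr EFin.
  by rewrite !patchE; case: ifPn => //; rewrite mulr0.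
have H : (\int[spectral_measure hWp]_x F x + (\int[spectral_measure hp]_x F x +
     \int[spectral_measure hm]_x (F x * (g x)%:E)) =
   \int[spectral_measure hWm]_x F x + (\int[spectral_measure hm]_x F x +
     \int[spectral_measure hp]_x (F x * (g x)%:E)))%E.
  apply: integral_density_exchange => // A mA.
  rewrite !spectral_measureE//.
  rewrite (dens _ hm _ mA) (dens _ hp _ mA).
  rewrite -!EFinD; congr EFin.
  have := qmeasure_W hu hv mA.
  rewrite (qmeasureD mA hWu hv) (qmeasureD mA hu hv).
  rewrite (qmeasureB mA hWu hv) (qmeasureB mA hu hv).
  exact: moment_rearrange1.
move: H; rewrite !D !integral_spectral// -!EFinD => -[].
have Dx w : l2 w -> Jint w (fun x => f x * g0 x) = Jint w f + Jint w (fun x => x * f x).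
  move=> hw; rewrite -JintD//; last exact: bounded_measM bounded_meas_id _.
  by apply: eq_Jint => x _; rewrite /g0; ring.
rewrite !Dx//; exact: moment_rearrange3.
Qed.

(** [Jint_W_ge0] wants a nonnegative function: it is applied to 1 and to 1 + x^k, and the difference
    gives x^k, whatever its sign. *)
Lemma spec_intXS u v k : l2 u -> l2 v ->
  spec_int W E (fun x => x ^+ k.+1) u v =
  spec_int W E (fun x => x ^+ k) (W_op W u) v.
Proof.
move=> hu hv; have hWu := W_op_l2 hW hu.
have b1 := bounded_meas_cst 1; have bk := bounded_measX k.
have bx := bounded_meas_id; have bk1 := bounded_measX k.+1.
have h1 := @Jint_W_ge0 u v (fun=> 1) hu hv b1 (fun _ _ => ler01).
have h2 : forall x, Sp W x -> 0 <= 1 + x ^+ k.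
  move=> x /(Sp_le1 hW) x1; have : `|x ^+ k| <= 1 by rewrite normrX exprn_ile1.
  by rewrite ler_norml => /andP[? _]; lra.
have {h2}h2 := Jint_W_ge0 hu hv (bounded_measD b1 bk) h2.
have e w : l2 w -> Jint w (fun x => x * (1 + x ^+ k)) =
    Jint w (fun x => x * 1) + Jint w (fun x => x ^+ k.+1).
  move=> hw; rewrite -JintD//; last first.
    exact: bounded_measM bx b1.
  by apply: eq_Jint => x _; rewrite exprS; ring.
rewrite !(JintD _ b1 bk) in h2; try exact: l2D; try exact: l2B.
rewrite !e in h2; try exact: l2D; try exact: l2B.
by rewrite !spec_intE; congr (_ * _); exact: moment_rearrange2 h1 h2.
Qed.

Lemma spec_intX u v k : l2 u -> l2 v ->
  spec_int W E (fun x => x ^+ k) u v = ip (iter k (W_op W) u) v.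
Proof.
move=> hu hv; elim: k u hu => [|k IH] u hu.
  have -> : (fun x : R => x ^+ 0) = fun=> 1 by apply/funext => x; rewrite expr0.
  rewrite spec_intE.
  by rewrite [RHS](polarization hu hv) !Jint_cst ?mul1r//; [exact: l2B|exact: l2D].
by rewrite spec_intXS// IH ?iterSr//; exact: W_op_l2.
Qed.

Lemma Jint_zero f : bounded_meas f -> Jint (fun=> 0) f = 0.
Proof.
move=> bf; have [_ [M fM]] := bf; apply/eqP; rewrite -normr_le0.
apply: le_trans (Jint_norm_le l2_0 bf fM) _.
suff -> : ip (fun _ : G => 0) (fun=> 0) = 0 :> R by rewrite mulr0.
apply/eqP; rewrite eq_le ip_ge0 andbT.
by have := ip_le (@l2_le_zero R G 0 (lexx 0)); rewrite expr0n.
Qed.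

(** The measure of 2u is 4 times that of u. The bound [M] is added to [f] so that a nonnegative
    function is integrated, then removed. *)
Lemma Jint_double u f : l2 u -> bounded_meas f ->
  Jint (fun i => u i + u i) f = 4 * Jint u f.
Proof.
move=> hu bf; have [_ [M fM]] := bf; have hd := l2D hu hu.
have bM := bounded_meas_cst M; have bfM := bounded_measD bf bM.
have fM0 x : Sp W x -> 0 <= f x + M.
  by move=> /fM; rewrite ler_norml => /andP[? _]; lra.
have four0 : 0 <= 4 :> R by [].
have E4 w A : l2 w -> measurable A ->
    ip (E A (fun i => w i + w i)) (fun i => w i + w i) = 4 * ip (E A w) w.
  by move=> hw mA; rewrite qmeasureD//; ring.
have : (\int[spectral_measure hd]_x (((fun x => f x + M) \_ (Sp W)) x)%:E =
    \int[spectral_measure hu]_x ((((fun x => f x + M) \_ (Sp W)) x)%:E * 4%:E))%E.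
  apply: (ge0_integral_density (g := fun=> 4)) => //.
  - move=> A mA; rewrite integral_cst// !spectral_measureE// E4//.
  - by move=> x; rewrite lee_fin patchE; case: ifPn => // /set_mem/fM0.
  - by apply/measurable_EFinP/(measurable_restrictT _ mSp); exact: bfM.1.
rewrite ge0_integralZr//; last 2 first.
- by apply/measurable_EFinP/(measurable_restrictT _ mSp); exact: bfM.1.
- by move=> x _; rewrite lee_fin patchE; case: ifPn => // /set_mem/fM0.
rewrite !integral_spectral// -EFinM => -[].
rewrite !JintD// !Jint_cst//.
have := E4 u _ hu mSp; rewrite !E_Sp// => ->.
by move=> h; apply: (addIr (M * (4 * ip u u))); rewrite h; ring.
Qed.

Lemma spec_int_diag u f : l2 u -> bounded_meas f -> spec_int W E f u u = Jint u f.
Proof.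
move=> hu bf; rewrite spec_intE Jint_double//.
have -> : (fun i => u i - u i) = fun=> 0 by apply/funext => i; rewrite subrr.
by rewrite Jint_zero//; field.
Qed.

Lemma JintX u k : l2 u -> Jint u (fun x => x ^+ k) = ip (iter k (W_op W) u) u.
Proof.
by move=> hu; rewrite -spec_intX// spec_int_diag//; exact: bounded_measX.
Qed.

Lemma spec_int_sym u v f : l2 u -> l2 v -> bounded_meas f ->
  spec_int W E f u v = spec_int W E f v u.
Proof.
move=> hu hv bf; rewrite !spec_intE; congr (_ * _).
have -> : (fun i => u i + v i) = fun i => v i + u i.
  by apply/funext => i; rewrite addrC.
congr (_ - _); congr fine; apply: eq_integral_measurable => A mA.
rewrite /qmeasure !qmeasureB//; congr EFin.
rewrite (E_sa mA hu hv) (ipC u); ring.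
Qed.

End SpectralMeasure.

(** * Polynomial approximation with weighted coefficients *)

Section PolyAlpha.
Context {R : realType}.
Implicit Types (p q : {poly R}).

Definition palpha p : R := \sum_(k < size p) `|p`_k| * k.+1%:R.

Lemma palphaE n p : (size p <= n)%N -> palpha p = \sum_(k < n) `|p`_k| * k.+1%:R.
Proof.
move=> pn; rewrite /palpha (big_ord_widen n (fun k => `|p`_k| * k.+1%:R) pn).
rewrite big_mkcond/=; apply: eq_bigr => k _; case: ltnP => // pk.
by rewrite nth_default// normr0 mul0r.
Qed.

Lemma palpha_ge0 p : 0 <= palpha p.
Proof. by apply: sumr_ge0 => k _; rewrite mulr_ge0. Qed.

Lemma palphaD p q : palpha (p + q) <= palpha p + palpha q.
Proof.
have h1 := leq_maxl (size p) (size q); have h2 := leq_maxr (size p) (size q).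
rewrite (palphaE (size_polyD p q)) (palphaE h1) (palphaE h2) -big_split/=.
apply: ler_sum => k _; rewrite coefD -mulrDl ler_wpM2r//; exact: ler_normD.
Qed.

Lemma palphaZ c p : palpha (c *: p) = `|c| * palpha p.
Proof.
rewrite (palphaE (size_scale_leq c p)) /palpha mulr_sumr; apply: eq_bigr => k _.
by rewrite coefZ normrM mulrA.
Qed.

Lemma palphaC c : palpha c%:P = `|c|.
Proof.
by rewrite (palphaE (size_polyC_leq1 c)) big_ord1 coefC/= mulr1.
Qed.

Lemma palpha_sum (I : Type) (r : seq I) (P : pred I) (F : I -> {poly R}) :
  palpha (\sum_(k <- r | P k) F k) <= \sum_(k <- r | P k) palpha (F k).
Proof.
elim/big_ind2 : _ => // [|p a q b h1 h2]; first by rewrite palphaC normr0.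
by apply: le_trans (palphaD _ _) _; exact: lerD.
Qed.

(** The weight pays off here: n + k + 1 <= (n + 1)(k + 1). It makes [palpha] submultiplicative, so
    that products and exponentials stay in the class. *)
Lemma palphaXnM n p : palpha ('X^n * p) <= n.+1%:R * palpha p.
Proof.
have h : (size ('X^n * p)%R <= n + size p)%N.
  by apply: leq_trans (size_polyMleq _ _) _; rewrite size_polyXn.
rewrite (palphaE h) big_split_ord/= [X in X + _]big1 ?add0r; last first.
  by move=> i _; rewrite coefXnM ltn_ord normr0 mul0r.
rewrite mulr_sumr; apply: ler_sum => k _.
rewrite coefXnM ltnNge leq_addr/= addKn mulrCA ler_wpM2l// -natrM ler_nat.
by rewrite mulSn mulnS; lia.
Qed.

Lemma palphaM p q : palpha (p * q) <= palpha p * palpha q.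
Proof.
rewrite -[in leLHS](coefK p) poly_def mulr_suml.
apply: le_trans (palpha_sum _ _ _) _; rewrite [X in _ <= X * _]/palpha mulr_suml.
apply: ler_sum => k _; rewrite -scalerAl palphaZ -mulrA ler_wpM2l//.
exact: palphaXnM.
Qed.

Lemma palphaX p n : palpha (p ^+ n) <= palpha p ^+ n.
Proof.
elim: n => [|n IH]; first by rewrite !expr0 palphaC normr1.
rewrite !exprS; apply: le_trans (palphaM _ _) _.
by rewrite ler_wpM2l// palpha_ge0.
Qed.

Lemma horner_palpha p x : `|x| <= 1 -> `|p.[x]| <= palpha p.
Proof.
move=> x1; rewrite horner_coef; apply: le_trans (ler_norm_sum _ _ _) _.
apply: ler_sum => k _; rewrite normrM ler_wpM2l// normrX.
by apply: (@le_trans _ _ 1); rewrite ?exprn_ile1// ler1n.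
Qed.

End PolyAlpha.

Section ExpApprox.
Context {R : realType}.

Lemma expR_partial_sum (y C : R) n : `|y| <= C ->
  `|expR y - series (exp_coeff y) n| <= expR C - series (exp_coeff C) n.
Proof.
move=> yC; have C0 : 0 <= C by apply: le_trans yC.
have h1 : `|series (exp_coeff y) m - series (exp_coeff y) n| @[m --> \oo] -->
    `|expR y - series (exp_coeff y) n|.
  apply: (@cvg_norm _ R^o); apply: cvgB; last exact: cvg_cst.
  exact: is_cvg_series_exp_coeff.
have h2 : series (exp_coeff C) m - series (exp_coeff C) n @[m --> \oo] -->
    expR C - series (exp_coeff C) n.
  apply: cvgB; last exact: cvg_cst.
  exact: is_cvg_series_exp_coeff.
apply: (ler_cvg_to h1 h2); near=> m.
have nm : (n <= m)%N by near: m; exact: nbhs_infty_ge.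
rewrite !sub_series_geq//; apply: le_trans (ler_norm_sum _ _ _) _.
apply: ler_sum => k _; rewrite /exp_coeff/= normrM normrX normfV normr_nat.
by rewrite ler_wpM2r ?invr_ge0// lerXn2r// nnegrE.
Unshelve. all: by end_near. Qed.

Lemma expR_lip (M a b : R) : a <= M -> b <= M ->
  `|expR a - expR b| <= expR M * `|a - b|.
Proof.
wlog ab : a b / b <= a => [h aM bM|aM bM].
  have [ab|ab] := leP b a; first exact: h.
  by rewrite distrC (distrC a); apply: h => //; exact: ltW.
rewrite ger0_norm ?subr_ge0 ?ler_expR// ger0_norm ?subr_ge0//.
apply: (@le_trans _ _ (expR a * (a - b))); last first.
  by rewrite ler_wpM2r ?subr_ge0// ler_expR.
have : expR b = expR a * expR (b - a) by rewrite -expRD; congr expR; ring.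
move=> ->; have := expR_ge1Dx (b - a); have := expR_gt0 a.
by move: (expR a) (expR (b - a)) => x y; nra.
Qed.

End ExpApprox.

(** * A weighted Wiener algebra on a subset of [-1, 1] *)

Section Wiener.
Context {R : realType} (D : set R).
Hypothesis D1 : forall x, D x -> `|x| <= 1.
Implicit Types (f g h : R -> R) (p q : {poly R}) (C : R).

(** The approximants share one bound [C], so every estimate is proved for polynomials and then
    passes to the limit; the coefficients of [f] itself never appear. *)
Definition wiener C f := forall e : R, 0 < e ->
  exists2 p, palpha p <= C & forall x, D x -> `|f x - p.[x]| <= e.

Lemma wiener_ge0 C f : wiener C f -> 0 <= C.
Proof. by move=> /(_ 1 ltr01)[p pC _]; rewrite (le_trans (palpha_ge0 p)). Qed.

Lemma wiener_bound C f x : wiener C f -> D x -> `|f x| <= C.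
Proof.
move=> fC Dx; apply/ler_addgt0Pr => e e0; have [p pC /(_ x Dx) fp] := fC e e0.
have -> : f x = p.[x] + (f x - p.[x]) by ring.
apply: le_trans (ler_normD _ _) _; apply: lerD => //.
exact: le_trans (horner_palpha p (D1 Dx)) pC.
Qed.

Lemma wiener_poly p : wiener (palpha p) (horner p).
Proof. by move=> e e0; exists p => // x _; rewrite subrr normr0 ltW. Qed.

Lemma wiener_cst c : wiener `|c| (fun=> c).
Proof.
by move=> e e0; exists c%:P; rewrite ?palphaC// => x _; rewrite hornerC subrr normr0 ltW.
Qed.

Lemma eq_wiener C f g : (forall x, D x -> f x = g x) -> wiener C f -> wiener C g.
Proof.
by move=> fg h e /h[p pC hp]; exists p => // x Dx; rewrite -fg//; exact: hp.
Qed.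

Lemma wienerW C C' f : C <= C' -> wiener C f -> wiener C' f.
Proof. by move=> CC h e /h[p pC hp]; exists p => //; exact: le_trans CC. Qed.

Lemma wienerD C C' f g : wiener C f -> wiener C' g -> wiener (C + C') (fun x => f x + g x).
Proof.
move=> hf hg e e0; have e2 : 0 < e / 2 by rewrite divr_gt0.
have [p pC fp] := hf _ e2; have [q qC gq] := hg _ e2.
exists (p + q); first by apply: le_trans (palphaD _ _) _; exact: lerD.
move=> x Dx; rewrite hornerD opprD addrACA [leRHS]splitr.
by apply: le_trans (ler_normD _ _) _; apply: lerD; [exact: fp|exact: gq].
Qed.

Lemma wienerZ C c f : wiener C f -> wiener (`|c| * C) (fun x => c * f x).
Proof.
move=> hf e e0; have c1 : 0 < `|c| + 1 by rewrite ltr_wpDl.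
have [p pC fp] := hf _ (divr_gt0 e0 c1).
exists (c *: p); first by rewrite palphaZ ler_wpM2l.
move=> x Dx; rewrite hornerZ -mulrBr normrM.
apply: (@le_trans _ _ (`|c| * (e / (`|c| + 1)))); first by rewrite ler_wpM2l// fp.
by rewrite mulrA ler_pdivrMr// mulrC ler_wpM2l ?(ltW e0)// lerDl.
Qed.

Lemma wienerM C C' f g : wiener C f -> wiener C' g -> wiener (C * C') (fun x => f x * g x).
Proof.
move=> hf hg e e0; have C0 := wiener_ge0 hf; have C0' := wiener_ge0 hg.
pose K := C + C' + 1; have K0 : 0 < K by rewrite /K ltr_wpDl// addr_ge0.
have [p pC fp] := hf _ (divr_gt0 e0 K0); have [q qC gq] := hg _ (divr_gt0 e0 K0).
exists (p * q).
  by apply: le_trans (palphaM _ _) _; apply: ler_pM => //; exact: palpha_ge0.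
move=> x Dx; rewrite hornerM.
have -> : f x * g x - p.[x] * q.[x] = f x * (g x - q.[x]) + q.[x] * (f x - p.[x]) by ring.
apply: le_trans (ler_normD _ _) _; rewrite !normrM.
have q1 := le_trans (horner_palpha q (D1 Dx)) qC.
apply: (@le_trans _ _ (C * (e / K) + C' * (e / K))).
  by apply: lerD; apply: ler_pM => //; [exact: wiener_bound hf _|exact: gq|exact: fp].
rewrite -mulrDl mulrA ler_pdivrMr// mulrC ler_wpM2l ?(ltW e0)//.
by rewrite /K lerDl.
Qed.

Definition exp_poly (n : nat) (p : {poly R}) : {poly R} :=
  \sum_(1 <= k < n) k`!%:R^-1 *: p ^+ k.

(** Subtracting 1 removes the constant term of the exponential series; every remaining term carries
    s^k with k >= 1, whence the factor |s|. That factor makes the errors of the many short steps in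
    [ln_det_expf_le] add up to a bounded amount. *)
Lemma wiener_exp C h s : wiener C h -> `|s| <= 1 ->
  wiener (`|s| * expR C) (fun x => expR (s * h x) - 1).
Proof.
move=> hh s1 e e0; have C0 := wiener_ge0 hh.
have e2 : 0 < e / 2 by rewrite divr_gt0.
have [p pC hp] := hh _ (divr_gt0 e2 (expR_gt0 C)).
have [n [n0 hn]] : exists n : nat, (0 < n)%N /\ expR C - series (exp_coeff C) n <= e / 2.
  have h0 : expR C - series (exp_coeff C) n @[n --> \oo] --> (0 : R).
    rewrite -(subrr (expR C)); apply: cvgB; first exact: cvg_cst.
    exact: is_cvg_series_exp_coeff.
  have /cvgrPdist_le/(_ _ e2)[N _ hN] := h0.
  exists N.+1; split=> //; have := hN N.+1 (leqnSn N).
  by rewrite /= sub0r normrN; apply: le_trans; exact: ler_norm.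
have serE y : series (exp_coeff y) n = 1 + \sum_(1 <= k < n) k`!%:R^-1 * y ^+ k :> R.
  rewrite /series/= big_ltn// /exp_coeff/= expr0 fact0 divr1; congr (_ + _).
  by apply: eq_bigr => k _; rewrite mulrC.
exists (exp_poly n (s *: p)).
  apply: le_trans (palpha_sum _ _ _) _.
  apply: (@le_trans _ _ (\sum_(1 <= k < n) `|s| * (k`!%:R^-1 * C ^+ k))).
    rewrite big_nat_cond [leRHS]big_nat_cond; apply: ler_sum => k /andP[/andP[k1 _] _].
    rewrite palphaZ ger0_norm ?invr_ge0// mulrCA ler_wpM2l ?invr_ge0//.
    rewrite exprZn palphaZ normrX.
    apply: ler_pM => //; first exact: palpha_ge0.
      by case: k k1 => // k _; rewrite exprS ler_piMr// exprn_ile1.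
    apply: le_trans (palphaX _ _) _; apply: lerXn2r => //.
      by rewrite nnegrE palpha_ge0.
  rewrite -mulr_sumr ler_wpM2l//.
  have := @expR_partial_sum R C C n; rewrite ger0_norm// => /(_ (lexx _)).
  move=> /(le_trans (normr_ge0 _)); rewrite subr_ge0 serE.
  by apply: le_trans; rewrite lerDr.
move=> x Dx.
have -> : (exp_poly n (s *: p)).[x] = series (exp_coeff (s * p.[x])) n - 1.
  rewrite serE addrC addKr /exp_poly horner_sum; apply: eq_bigr => k _.
  by rewrite hornerZ horner_exp hornerZ.
have -> : expR (s * h x) - 1 - (series (exp_coeff (s * p.[x])) n - 1) =
  (expR (s * h x) - expR (s * p.[x])) +
  (expR (s * p.[x]) - series (exp_coeff (s * p.[x])) n) by ring.
have bnd y : `|y| <= C -> `|s * y| <= C.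
  by move=> yC; rewrite normrM (le_trans (ler_piMl _ s1)).
have hxC : `|s * h x| <= C by apply: bnd; exact: wiener_bound hh Dx.
have pxC : `|s * p.[x]| <= C.
  by apply: bnd; exact: le_trans (horner_palpha p (D1 Dx)) pC.
apply: le_trans (ler_normD _ _) _; rewrite [leRHS]splitr; apply: lerD.
  apply: le_trans (expR_lip (le_trans (ler_norm _) hxC) (le_trans (ler_norm _) pxC)) _.
  rewrite -mulrBr normrM mulrCA.
  apply: (@le_trans _ _ (1 * (expR C * `|h x - p.[x]|))).
    by rewrite ler_wpM2r// mulr_ge0// expR_ge0.
  rewrite mul1r -ler_pdivlMl ?expR_gt0// mulrC; exact: hp.
exact: le_trans (expR_partial_sum _ pxC) hn.
Qed.

(** The partial sums have [palpha] at most [alpha a]; they converge uniformly on [D] because the sum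
    of |a_k| converges and |x| <= 1. *)
Lemma wiener_series (a : nat -> R) (C : R) f : (alpha a <= C%:E)%E ->
  (forall x, D x -> series (fun k => a k * x ^+ k) @ \oo --> f x) -> wiener C f.
Proof.
move=> aC fE.
have part n : \sum_(0 <= k < n) `|a k| * k.+1%:R <= C.
  rewrite -lee_fin -sumEFin; apply: le_trans aC; apply: nneseries_lim_ge => k _ _.
  by rewrite lee_fin mulr_ge0.
pose s n := \sum_(0 <= k < n) `|a k|.
have sC n : s n <= C.
  apply: le_trans (part n); apply: ler_sum => k _.
  by rewrite ler_peMr// ler1n.
have cs : cvgn s.
  apply: nondecreasing_is_cvgn.
    by apply/nondecreasing_seqP => n; rewrite /s big_nat_recr//= lerDl.
  by exists C => _ [n _ <-]; exact: sC.
move=> e e0.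
have /cvgrPdist_le/(_ _ e0)[N _ hN] := cs.
exists (\poly_(k < N) a k).
  rewrite (palphaE (size_poly _ _)); apply: le_trans (part N).
  by rewrite big_mkord; apply: ler_sum => k _; rewrite coef_poly ltn_ord.
move=> x Dx.
have -> : (\poly_(k < N) a k).[x] = series (fun k => a k * x ^+ k) N.
  by rewrite horner_poly /series/= big_mkord.
have h1 : `|series (fun k => a k * x ^+ k) n - series (fun k => a k * x ^+ k) N|
    @[n --> \oo] --> `|f x - series (fun k => a k * x ^+ k) N|.
  by apply: (@cvg_norm _ R^o); apply: cvgB; [exact: fE|exact: cvg_cst].
apply: (cvgr_to_le h1); near=> n.
have Nn : (N <= n)%N by near: n; exact: nbhs_infty_ge.
rewrite sub_series_geq//.
apply: le_trans (ler_norm_sum _ _ _) _.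
apply: (@le_trans _ _ (s n - s N)).
  have -> : s n - s N = \sum_(N <= i < n) `|a i|.
    by apply/eqP; rewrite subr_eq addrC /s -big_cat_nat.
  apply: ler_sum => k _; rewrite normrM normrX ler_piMr//.
  by rewrite exprn_ile1// D1.
apply: (@le_trans _ _ (limn s - s N)).
  rewrite lerD2r; apply: nondecreasing_cvgn_le => //.
  by apply/nondecreasing_seqP => m; rewrite /s big_nat_recr//= lerDl.
by apply: le_trans (hN N (leqnn N)); exact: ler_norm.
Unshelve. all: by end_near. Qed.

(** x^k is k-Lipschitz on [-1, 1] and k <= k + 1. A Lipschitz constant common to the whole ball will
    turn pointwise continuity in the parameter into uniform closeness on the compact spectrum. *)
Lemma wiener_lip C f x y : wiener C f -> D x -> D y -> `|f x - f y| <= C * `|x - y|.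
Proof.
move=> fC Dx Dy; apply/ler_addgt0Pr => e e0; have e2 : 0 < e / 2 by rewrite divr_gt0.
have [p pC fp] := fC _ e2.
have -> : f x - f y = (p.[x] - p.[y]) + ((f x - p.[x]) - (f y - p.[y])) by ring.
apply: le_trans (ler_normD _ _) _; apply: lerD; last first.
  apply: le_trans (ler_normB _ _) _; rewrite [leRHS]splitr.
  by apply: lerD; exact: fp.
apply: (@le_trans _ _ (palpha p * `|x - y|)); last by rewrite ler_wpM2r.
rewrite !horner_coef -sumrB mulr_suml; apply: le_trans (ler_norm_sum _ _ _) _.
apply: ler_sum => k _; rewrite -mulrBr normrM -mulrA ler_wpM2l//.
rewrite subrXX normrM mulrC ler_wpM2r//; apply: le_trans (ler_norm_sum _ _ _) _.
apply: (@le_trans _ _ (\sum_(i < k) 1)).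
  apply: ler_sum => i _; rewrite normrM !normrX.
  by rewrite mulr_ile1 ?exprn_ge0// exprn_ile1// D1.
by rewrite sumr_const card_ord ler_nat.
Qed.

End Wiener.

(** * Kernels of functions of the graph operator *)

Lemma sum_fset_le {R : realType} {G : choiceType} (A B : {fset G}) (g : G -> R) :
  (A `<=` B)%fset -> (forall i, 0 <= g i) -> \sum_(i <- A) g i <= \sum_(i <- B) g i.
Proof.
move=> AB g0; rewrite [leRHS](big_fsetID _ (mem A))/=.
rewrite (_ : [fset x | x in B & mem A x]%fset = A); last first.
  apply/fsetP => i; rewrite !inE/=; apply: andb_idl; exact: (fsubsetP AB).
by rewrite lerDl sumr_ge0.
Qed.

Section KernelMonomials.
Context {R : realType} {G : countType} (W : G -> G -> R).
Hypothesis hW : is_graph W.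
Implicit Types (A : {fset G}).

Definition wpow (k : nat) (i j : G) : R := iter k (W_op W) (dvec j) i.

Lemma wpow0 i j : wpow 0 i j = (i == j)%:R.
Proof. by []. Qed.

Lemma wpowS k i j : wpow k.+1 i j = \sum_(s <- nbs W i) W i s * wpow k s j.
Proof. by rewrite /wpow iterS (W_opE hW). Qed.

Lemma sum_indic A (i : G) (F : G -> R) : \sum_(j <- A) (i == j)%:R * F j =
  if i \in A then F i else 0.
Proof.
case: ifPn => iA; last first.
  rewrite big_seq big1// => j jA; case: eqP => [ij|_]; last by rewrite mul0r.
  by rewrite ij jA in iA.
rewrite (big_fsetD1 i)//= eqxx mul1r big_seq big1 ?addr0// => j.
by rewrite !inE => /andP[/negbTE + _]; rewrite eq_sym => ->; rewrite mul0r.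
Qed.

Lemma wpow_row k i A : \sum_(j <- A) `|wpow k i j| <= 1.
Proof.
elim: k i => [|k IH] i.
  under eq_bigr => j _ do rewrite wpow0 normr_nat -(mulr1 (_%:R)).
  by rewrite sum_indic; case: ifP.
apply: (@le_trans _ _ (\sum_(j <- A) \sum_(s <- nbs W i) `|W i s| * `|wpow k s j|)).
  apply: ler_sum => j _; rewrite wpowS; apply: le_trans (ler_norm_sum _ _ _) _.
  by apply: ler_sum => s _; rewrite normrM.
rewrite exchange_big/=; apply: le_trans (row_sum_le1 hW i); apply: ler_sum => s _.
by rewrite -mulr_sumr ler_piMr.
Qed.

(** By matrix multiplication this is minus the sum over the [p] outside [A]: the weight, up to sign,
    of the paths of length k + l from [i] to [j] that are outside [A] after [k] steps. *)
Definition trunc_err A k l i j : R :=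
  \sum_(p <- A) wpow k i p * wpow l p j - wpow (k + l) i j.

Lemma trunc_err0 A l i j : trunc_err A 0 l i j = if i \in A then 0 else - wpow l i j.
Proof.
rewrite /trunc_err add0n; under eq_bigr do rewrite wpow0.
by rewrite sum_indic; case: ifP; rewrite ?subrr ?sub0r.
Qed.

Lemma trunc_errS A k l i j : trunc_err A k.+1 l i j =
  \sum_(s <- nbs W i) W i s * trunc_err A k l s j.
Proof.
rewrite /trunc_err addSn wpowS.
under [in RHS]eq_bigr do rewrite mulrBr.
rewrite sumrB; congr (_ - _).
under [in RHS]eq_bigr do rewrite mulr_sumr.
rewrite exchange_big/=; apply: eq_bigr => p _.
by rewrite (W_opE hW) mulr_suml; apply: eq_bigr => s _; rewrite mulrA.
Qed.

Lemma trunc_err_row A k l i : \sum_(j <- A) `|trunc_err A k l i j| <= 1.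
Proof.
elim: k i => [|k IH] i.
  apply: le_trans (wpow_row l i A); apply: ler_sum => j _.
  by rewrite trunc_err0; case: ifP; rewrite ?normr0 ?normrN.
apply: (@le_trans _ _
    (\sum_(j <- A) \sum_(s <- nbs W i) `|W i s| * `|trunc_err A k l s j|)).
  apply: ler_sum => j _; rewrite trunc_errS; apply: le_trans (ler_norm_sum _ _ _) _.
  by apply: ler_sum => s _; rewrite normrM.
rewrite exchange_big/=; apply: le_trans (row_sum_le1 hW i); apply: ler_sum => s _.
by rewrite -mulr_sumr ler_piMr.
Qed.

(** Induction on [k], by the first step of the path. A step within [A] reproduces the previous
    error, and column sums of |W| at most 1 preserve its total; a step out of [A] starts at a
    boundary vertex and costs at most 1 by [trunc_err_row]. Each unit of [k] thus costs one
    boundary. *)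
Lemma trunc_err_sum A k l :
  \sum_(i <- A) \sum_(j <- A) `|trunc_err A k l i j| <=
  k%:R * (boundary_size W A)%:R.
Proof.
elim: k => [|k IH].
  rewrite mul0r big_seq big1// => i iA; rewrite big1// => j _.
  by rewrite trunc_err0 iA normr0.
pose r s := \sum_(j <- A) `|trunc_err A k l s j|.
have r0 s : 0 <= r s by exact: sumr_ge0.
have r1 s : r s <= 1 by exact: trunc_err_row.
apply: (@le_trans _ _ (\sum_(i <- A) \sum_(s <- nbs W i) `|W i s| * r s)).
  apply: ler_sum => i _.
  apply: (@le_trans _ _
      (\sum_(j <- A) \sum_(s <- nbs W i) `|W i s| * `|trunc_err A k l s j|)).
    apply: ler_sum => j _; rewrite trunc_errS; apply: le_trans (ler_norm_sum _ _ _) _.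
    by apply: ler_sum => s _; rewrite normrM.
  by rewrite exchange_big/=; apply: ler_sum => s _; rewrite mulr_sumr.
pose out i := `[< exists2 j, j \notin A & W i j != 0 >].
have step i : i \in A -> \sum_(s <- nbs W i) `|W i s| * r s <=
    \sum_(s <- A) `|W i s| * r s + (out i)%:R.
  move=> iA; rewrite (big_fsetID _ (mem A))/=; apply: lerD.
    apply: sum_fset_le => [|s]; last by rewrite mulr_ge0.
    by apply/fsubsetP => s; rewrite !inE/= => /andP[].
  have [/asboolP o|/asboolP no] := boolP (out i).
    apply: le_trans (row_sum_fset hW i [fset x | x in nbs W i & ~~ mem A x]%fset).
    by apply: ler_sum => s _; rewrite ler_piMr.
  rewrite big_seq big1// => s; rewrite !inE/= => /andP[sn sA].
  by exfalso; apply: no; exists s => //; rewrite -(mem_nbs hW).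
apply: (@le_trans _ _ (\sum_(i <- A) (\sum_(s <- A) `|W i s| * r s + (out i)%:R))).
  by rewrite big_seq [leRHS]big_seq; apply: ler_sum => i iA; exact: step.
rewrite big_split/= -natr1 mulrDl mul1r; apply: lerD.
  rewrite exchange_big/=; apply: le_trans IH; apply: ler_sum => s _.
  rewrite -mulr_suml ler_piMl//.
  have Wsym : forall i j, W i j = W j i by case: hW.
  by under eq_bigr do rewrite Wsym; exact: row_sum_fset.
rewrite /boundary_size (big_fsetID _ out)/= [X in _ + X]big1_seq ?addr0; last first.
  by move=> s /andP[_]; rewrite !inE/= => /andP[_ /negbTE ->].
rewrite -sum1_size natr_sum; apply: ler_sum => s _.
by rewrite lern1 leq_b1.
Qed.

End KernelMonomials.

Lemma ler_addMe {R : realType} (x y M : R) : 0 <= M ->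
  (forall e, 0 < e -> x <= y + M * e) -> x <= y.
Proof.
move=> M0 h; apply/ler_addgt0Pr => e e0.
have M1 : 0 < M + 1 by rewrite ltr_wpDl.
apply: le_trans (h _ (divr_gt0 e0 M1)) _; rewrite lerD2l mulrA ler_pdivrMr//.
by rewrite mulrC ler_wpM2l ?(ltW e0)// lerDl.
Qed.

Lemma sum_const_fset {R : realType} {G : choiceType} (A : {fset G}) (c : R) :
  \sum_(i <- A) c = #|` A|%:R * c.
Proof. by rewrite big_const_seq count_predT iter_addr_0 mulr_natl. Qed.

(** * Entrywise, quadratic and product estimates for the kernels K(f) *)

Section Kernel.
Context {R : realType} {G : countType} (W : G -> G -> R).
Context (E : set R -> (G -> R) -> (G -> R)).
Hypotheses (hW : is_graph W) (hE : spectral_resolution W E).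
Implicit Types (f g : R -> R) (p q : {poly R}) (i j : G) (A : {fset G}) (y : G -> R).

Local Notation K := (Kop W E).
Local Notation bmeas := (@bounded_meas R G W).
Local Notation wien := (wiener (Sp W)).

Let Sp1 x : Sp W x -> `|x| <= 1. Proof. exact: Sp_le1. Qed.

Let dl2D i j : l2 (fun k => dvec i k + dvec j k : R).
Proof. by apply: l2D; exact: dvec_l2. Qed.

Let dl2B i j : l2 (fun k => dvec i k - dvec j k : R).
Proof. by apply: l2B; exact: dvec_l2. Qed.

Lemma KopD f g i j : bmeas f -> bmeas g ->
  K (fun x => f x + g x) i j = K f i j + K g i j.
Proof.
by move=> bf bg; rewrite /Kop !spec_intE !(JintD hW hE)//; ring.
Qed.

Lemma KopZ c f i j : bmeas f -> K (fun x => c * f x) i j = c * K f i j.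
Proof. by move=> bf; rewrite /Kop !spec_intE !(JintZ hW hE)//; ring. Qed.

Lemma eq_Kop f g i j : (forall x, Sp W x -> f x = g x) -> K f i j = K g i j.
Proof. by move=> fg; rewrite /Kop !spec_intE !(eq_Jint E _ fg). Qed.

Lemma Kop_sym f i j : bmeas f -> K f i j = K f j i.
Proof. by move=> bf; apply: (spec_int_sym hE) => //; exact: dvec_l2. Qed.

Lemma bounded_meas_sum (I : Type) (r : seq I) (c : I -> R) (F : I -> R -> R) :
  (forall k, bmeas (F k)) -> bmeas (fun x => \sum_(k <- r) c k * F k x).
Proof.
move=> bF; elim: r => [|k r IH].
  rewrite (_ : (fun x => _) = fun=> 0); first exact: bounded_meas_cst.
  by apply/funext => x; rewrite big_nil.
rewrite (_ : (fun x => _) = fun x => (fun=> c k) x * F k x + \sum_(k <- r) c k * F k x).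
  apply: bounded_measD => //; apply: bounded_measM => //; exact: bounded_meas_cst.
by apply/funext => x; rewrite big_cons.
Qed.

Lemma bounded_measZ c f : bmeas f -> bmeas (fun x => c * f x).
Proof. by move=> bf; exact: bounded_measM (bounded_meas_cst W c) bf. Qed.

Lemma Jint_sum (I : Type) (r : seq I) (c : I -> R) (F : I -> R -> R) u : l2 u ->
  (forall k, bmeas (F k)) ->
  Jint W E u (fun x => \sum_(k <- r) c k * F k x) = \sum_(k <- r) c k * Jint W E u (F k).
Proof.
move=> hu bF; elim: r => [|k r IH].
  rewrite big_nil (_ : (fun x => _) = fun=> 0) ?(Jint_cst hW hE) ?mul0r//.
  by apply/funext => x; rewrite big_nil.
rewrite big_cons -IH -(JintZ hW hE)// -(JintD hW hE)//.
- by congr Jint; apply/funext => x; rewrite big_cons.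
- exact: bounded_measZ.
- exact: bounded_meas_sum.
Qed.

Lemma Kop_sum (I : Type) (r : seq I) (c : I -> R) (F : I -> R -> R) i j :
  (forall k, bmeas (F k)) ->
  K (fun x => \sum_(k <- r) c k * F k x) i j = \sum_(k <- r) c k * K (F k) i j.
Proof.
move=> bF; rewrite /Kop spec_intE !Jint_sum// -sumrB mulr_sumr.
by apply: eq_bigr => k _; rewrite spec_intE; ring.
Qed.

Lemma KopX k i j : K (fun x => x ^+ k) i j = wpow W k i j.
Proof.
rewrite Kop_sym; last exact: bounded_measX.
rewrite /Kop (spec_intX hW hE) ?ip_dvec//; exact: dvec_l2.
Qed.

Lemma bounded_meas_poly p : bmeas (horner p).
Proof.
rewrite (_ : horner p = fun x => \sum_(k < size p) p`_k * x ^+ k).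
  by apply: bounded_meas_sum => k; exact: bounded_measX.
by apply/funext => x; rewrite horner_coef.
Qed.

Lemma Kop_poly p i j : K (horner p) i j = \sum_(k < size p) p`_k * wpow W k i j.
Proof.
rewrite (_ : horner p = fun x => \sum_(k < size p) p`_k * x ^+ k).
  by rewrite Kop_sum => [|k]; [under eq_bigr do rewrite KopX|exact: bounded_measX].
by apply/funext => x; rewrite horner_coef.
Qed.

Lemma wiener_bounded_meas C f : wien C f -> bmeas f.
Proof.
move=> hf; split; last by exists C => x; exact: (wiener_bound Sp1 hf).
have e0 n : 0 < n.+1%:R^-1 :> R by rewrite invr_gt0.
pose p n := sval (cid2 (hf _ (e0 n))).
have hp n x : Sp W x -> `|f x - (p n).[x]| <= n.+1%:R^-1.
  by rewrite /p; case: cid2 => q /= _; exact.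
apply: (measurable_fun_cvg (h := fun n x => (p n).[x])).
  by move=> n; exact: (bounded_meas_poly (p n)).1.
move=> x Sx; apply/cvgrPdist_le => e he.
have := @cvg_harmonic R => /cvgrPdist_le/(_ _ he)[N _ hN].
exists N => // n Nn; apply: le_trans (hp n x Sx) _.
have := hN n Nn; rewrite sub0r normrN /harmonic.
by apply: le_trans; exact: ler_norm.
Qed.

Lemma Jint_dist u f g e : l2 u -> bmeas f -> bmeas g ->
  (forall x, Sp W x -> `|f x - g x| <= e) ->
  `|Jint W E u f - Jint W E u g| <= e * ip u u.
Proof.
move=> hu bf bg fg.
have bNg := bounded_measZ (-1) bg.
have -> : Jint W E u f - Jint W E u g = Jint W E u (fun x => f x + -1 * g x).
  by rewrite (JintD hW hE)// (JintZ hW hE)// mulN1r.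
apply: (Jint_norm_le hW hE) => //; first exact: bounded_measD.
by move=> x; rewrite mulN1r; exact: fg.
Qed.

Lemma ip_dvec2 i j : ip (dvec i) (dvec j) = (i == j)%:R :> R.
Proof. by rewrite ip_dvec /dvec eq_sym. Qed.

(** By polarization an entry is a quarter of a difference of two integrals, against measures of
    masses |delta_i + delta_j|^2 and |delta_i - delta_j|^2. These add up to 4 by the parallelogram
    law, which cancels the quarter. *)
Lemma Kop_dist f g i j e : bmeas f -> bmeas g ->
  (forall x, Sp W x -> `|f x - g x| <= e) -> `|K f i j - K g i j| <= e.
Proof.
move=> bf bg fg; rewrite /Kop !spec_intE.
set up := (fun k => dvec i k + dvec j k); set um := (fun k => dvec i k - dvec j k).
pose a := Jint W E up f - Jint W E up g; pose b := Jint W E um g - Jint W E um f.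
have -> : 4^-1 * (Jint W E up f - Jint W E um f) -
    4^-1 * (Jint W E up g - Jint W E um g) = 4^-1 * (a + b) by rewrite /a /b; ring.
have ha : `|a| <= e * ip (fun k => dvec i k + dvec j k) (fun k => dvec i k + dvec j k).
  by apply: Jint_dist => //; exact: dl2D.
have hb : `|b| <= e * ip (fun k => dvec i k - dvec j k) (fun k => dvec i k - dvec j k).
  by rewrite distrC; apply: Jint_dist => //; exact: dl2B.
have hi := dvec_l2 (R := R) i; have hj := dvec_l2 (R := R) j.
have pl : ip (fun k => dvec i k + dvec j k) (fun k => dvec i k + dvec j k) +
    ip (fun k => dvec i k - dvec j k) (fun k => dvec i k - dvec j k) = 4 :> R.
  have Dr u v w : l2 u -> l2 v -> l2 w ->
      ip w (fun i => u i + v i) = ip w u + ip w v :> R.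
    by move=> hu hv hw; rewrite ipC ipDl// !(ipC w).
  have -> : (fun k => dvec i k - dvec j k) = fun k => dvec i k + -1 * dvec j k :> R.
    by apply/funext => k; rewrite mulN1r.
  have hNj := l2Z (-1) hj.
  rewrite !ipDl ?Dr//; try exact: l2D.
  rewrite !ipZl// ![ip _ (fun k => -1 * _)]ipC !ipZl//.
  by rewrite (ipC (dvec i) (dvec j)) !ip_dvec2 !eqxx /=; ring.
rewrite normrM ger0_norm ?invr_ge0// -ler_pdivlMl ?invr_gt0// invrK.
apply: le_trans (ler_normD _ _) _; apply: le_trans (lerD ha hb) _.
by rewrite -mulrDr pl mulrC.
Qed.

(** For a polynomial, each power of W has row sums at most 1. The approximation costs e per entry,
    |A| e in total, which vanishes as e -> 0 for fixed [A]. *)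
Lemma Kop_row C f i A : wien C f -> \sum_(j <- A) `|K f i j| <= C.
Proof.
move=> hf; have bf := wiener_bounded_meas hf.
apply: (@ler_addMe _ _ _ (#|` A|)%:R) => // e e0.
have [p pC fp] := hf _ e0.
apply: (@le_trans _ _ (\sum_(j <- A) (`|K (horner p) i j| + e))).
  apply: ler_sum => j _; rewrite -lerBlDl; apply: le_trans (lerB_dist _ _) _.
  by apply: Kop_dist => //; exact: bounded_meas_poly.
rewrite big_split/= sum_const_fset; apply: lerD => //.
apply: le_trans pC.
apply: (@le_trans _ _ (\sum_(j <- A) \sum_(k < size p) `|p`_k| * `|wpow W k i j|)).
  apply: ler_sum => j _; rewrite Kop_poly; apply: le_trans (ler_norm_sum _ _ _) _.
  by apply: ler_sum => k _; rewrite normrM.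
rewrite exchange_big/=; apply: ler_sum => k _; rewrite -mulr_sumr ler_wpM2l//.
by apply: le_trans (wpow_row hW _ _ _) _; rewrite ler1n.
Qed.

Lemma Kop_bound C f i j : wien C f -> `|K f i j| <= C.
Proof. by move=> /(Kop_row i [fset j]%fset); rewrite big_seq_fset1. Qed.

Lemma Kop_col C f j A : wien C f -> \sum_(i <- A) `|K f i j| <= C.
Proof.
move=> hf; under eq_bigr do rewrite (Kop_sym _ _ (wiener_bounded_meas hf)).
exact: Kop_row.
Qed.

Definition fvec A y : G -> R := fun k => \sum_(i <- A) y i * dvec i k.

Lemma fvec_l2 A y : l2 (fvec A y).
Proof. by apply: l2_sum => i; apply: l2Z; exact: dvec_l2. Qed.

Lemma ip_fvec u A y : l2 u -> ip u (fvec A y) = \sum_(i <- A) y i * u i.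
Proof.
move=> hu; rewrite ipC ip_suml//; last by move=> i; apply: l2Z; exact: dvec_l2.
apply: eq_bigr => i _; rewrite ipZl//; last exact: dvec_l2.
by rewrite ipC ip_dvec.
Qed.

Lemma fvecE A y k : fvec A y k = if k \in A then y k else 0.
Proof.
rewrite /fvec; under eq_bigr do rewrite mulrC.
by rewrite /dvec sum_indic.
Qed.

Lemma ip_fvec_self A y : ip (fvec A y) (fvec A y) = \sum_(i <- A) y i ^+ 2.
Proof.
rewrite ip_fvec; last exact: fvec_l2.
rewrite big_seq [RHS]big_seq; apply: eq_bigr => i iA.
by rewrite fvecE iA expr2.
Qed.

Lemma iter_W_fvec k A y i :
  iter k (W_op W) (fvec A y) i = \sum_(j <- A) y j * wpow W k i j.
Proof.
have hc u C : l2_le u C -> l2_le (W_op W u) (1 * C).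
  by rewrite mul1r; exact: W_op_le.
have lin := iter_linear (W_op_linear hW) hc k.
rewrite /fvec (linear_l2_sum lin); last by move=> j; apply: l2Z; exact: dvec_l2.
by apply: eq_bigr => j _; rewrite (linear_l2Z lin)//; exact: dvec_l2.
Qed.

Lemma quad_poly A y p :
  \sum_(i <- A) \sum_(j <- A) y i * y j * K (horner p) i j =
  Jint W E (fvec A y) (horner p).
Proof.
have -> : Jint W E (fvec A y) (horner p) =
    \sum_(k < size p) p`_k * ip (iter k (W_op W) (fvec A y)) (fvec A y).
  rewrite -(eq_bigr _ (fun k _ => congr1 _ (JintX hW hE _ (fvec_l2 A y)))).
  rewrite -Jint_sum => [| |k]; [|exact: fvec_l2|exact: bounded_measX].
  by congr Jint; apply/funext => x; rewrite horner_coef.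
have l2i k : l2 (iter k (W_op W) (fvec A y)).
  by elim: k => [|k IH]; [exact: fvec_l2|exact: W_op_l2].
under [RHS]eq_bigr => k _ do (rewrite ip_fvec// mulr_sumr;
  under eq_bigr do rewrite iter_W_fvec mulr_sumr mulr_sumr).
rewrite [RHS]exchange_big/=; apply: eq_bigr => i _.
rewrite [RHS]exchange_big/=; apply: eq_bigr => j _.
by rewrite Kop_poly mulr_sumr; apply: eq_bigr => k _; ring.
Qed.

(** The form is an integral against the spectral measure of a finitely supported vector, so bounds
    of [f] on the spectrum become bounds on the form in [quad_le] and [quad_ge]. *)
Lemma quad_Jint C f A y : wien C f ->
  \sum_(i <- A) \sum_(j <- A) y i * y j * K f i j = Jint W E (fvec A y) f.
Proof.
move=> hf; have bf := wiener_bounded_meas hf.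
apply/eqP; rewrite -subr_eq0 -normr_le0.
pose N := \sum_(i <- A) \sum_(j <- A) `|y i * y j|.
have N0 : 0 <= N by apply: sumr_ge0 => i _; exact: sumr_ge0.
apply: (@ler_addMe _ _ _ (N + ip (fvec A y) (fvec A y))) => [|e e0].
  by rewrite addr_ge0// ip_ge0.
have [p pC fp] := hf _ e0; have bp := bounded_meas_poly p.
set X := \sum_(i <- A) _.
have -> : X - Jint W E (fvec A y) f =
    (X - \sum_(i <- A) \sum_(j <- A) y i * y j * K (horner p) i j) +
    (Jint W E (fvec A y) (horner p) - Jint W E (fvec A y) f).
  by rewrite quad_poly; ring.
rewrite add0r mulrDl; apply: le_trans (ler_normD _ _) _; apply: lerD; last first.
  by rewrite distrC mulrC; apply: Jint_dist => //; exact: fvec_l2.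
rewrite /X -sumrB; apply: le_trans (ler_norm_sum _ _ _) _; rewrite /N mulr_suml.
apply: ler_sum => i _; rewrite -sumrB; apply: le_trans (ler_norm_sum _ _ _) _.
rewrite mulr_suml; apply: ler_sum => j _; rewrite -mulrBr normrM ler_wpM2l//.
exact: Kop_dist.
Qed.

Lemma quad_le C f M A y : wien C f -> (forall x, Sp W x -> `|f x| <= M) ->
  `|\sum_(i <- A) \sum_(j <- A) y i * y j * K f i j| <= M * \sum_(i <- A) y i ^+ 2.
Proof.
move=> hf fM; rewrite (quad_Jint _ _ hf) -ip_fvec_self.
by apply: (Jint_norm_le hW hE) => //; [exact: fvec_l2|exact: wiener_bounded_meas hf].
Qed.

Lemma quad_ge C f c A y : wien C f -> (forall x, Sp W x -> c <= f x) ->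
  c * (\sum_(i <- A) y i ^+ 2) <= \sum_(i <- A) \sum_(j <- A) y i * y j * K f i j.
Proof.
move=> hf fc; rewrite (quad_Jint _ _ hf) -ip_fvec_self -(Jint_cst hW hE); last exact: fvec_l2.
apply: (Jint_le hW hE) => //; first exact: fvec_l2.
  exact: bounded_meas_cst.
exact: wiener_bounded_meas hf.
Qed.

Lemma Kop_diag f i : bmeas f -> K f i i = Jint W E (dvec i) f.
Proof. by move=> bf; apply: (spec_int_diag hW hE) => //; exact: dvec_l2. Qed.

Lemma Kop1 i j : K (fun=> 1) i j = (i == j)%:R.
Proof. by rewrite -[RHS](KopX 0); apply: eq_Kop => x _; rewrite expr0. Qed.

Definition prod_err A f g i j : R :=
  \sum_(p <- A) K f i p * K g p j - K (fun x => f x * g x) i j.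

(** The error is bilinear in the coefficients, and the factor k of [trunc_err_sum] is absorbed by
    the weights: k <= (k + 1)(l + 1). *)
Lemma prod_err_poly A p q :
  \sum_(i <- A) \sum_(j <- A) `|prod_err A (horner p) (horner q) i j| <=
  palpha p * palpha q * (boundary_size W A)%:R.
Proof.
have KM i j : K (fun x => p.[x] * q.[x]) i j =
    \sum_(k < size p) \sum_(l < size q) p`_k * q`_l * wpow W (k + l) i j.
  rewrite (_ : (fun x => _) = fun x =>
      \sum_(k < size p) p`_k * (\sum_(l < size q) q`_l * x ^+ (k + l))).
    rewrite Kop_sum => [|k]; last by apply: bounded_meas_sum => l; exact: bounded_measX.
    apply: eq_bigr => k _; rewrite Kop_sum => [|l]; last exact: bounded_measX.
    by rewrite mulr_sumr; apply: eq_bigr => l _; rewrite KopX mulrA.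
  apply/funext => x; rewrite !horner_coef mulr_suml; apply: eq_bigr => k _.
  by rewrite !mulr_sumr; apply: eq_bigr => l _; rewrite exprD; ring.
have RE i j : prod_err A (horner p) (horner q) i j =
    \sum_(k < size p) \sum_(l < size q) p`_k * q`_l * trunc_err W A k l i j.
  rewrite /prod_err KM; under eq_bigr do rewrite !Kop_poly mulr_suml.
  rewrite exchange_big/= -sumrB; apply: eq_bigr => k _.
  under eq_bigr do rewrite mulr_sumr.
  rewrite exchange_big/= -sumrB; apply: eq_bigr => l _.
  rewrite /trunc_err mulrBr mulr_sumr; congr (_ - _).
  by apply: eq_bigr => s _; ring.
apply: (@le_trans _ _ (\sum_(i <- A) \sum_(j <- A) \sum_(k < size p) \sum_(l < size q)
    `|p`_k| * `|q`_l| * `|trunc_err W A k l i j|)).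
  apply: ler_sum => i _; apply: ler_sum => j _; rewrite RE.
  apply: le_trans (ler_norm_sum _ _ _) _; apply: ler_sum => k _.
  apply: le_trans (ler_norm_sum _ _ _) _; apply: ler_sum => l _.
  by rewrite !normrM.
under eq_bigr do (rewrite exchange_big/=; under eq_bigr do rewrite exchange_big/=).
rewrite exchange_big/=; under eq_bigr do rewrite exchange_big/=.
rewrite [X in X * _]mulr_suml mulr_suml; apply: ler_sum => k _.
rewrite mulr_sumr mulr_suml; apply: ler_sum => l _.
under eq_bigr do rewrite -mulr_sumr.
rewrite -mulr_sumr.
have -> : `|p`_k| * k.+1%:R * (`|q`_l| * l.+1%:R) * (boundary_size W A)%:R =
  `|p`_k| * `|q`_l| * (k.+1%:R * l.+1%:R * (boundary_size W A)%:R) by ring.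
rewrite ler_wpM2l ?mulr_ge0//; apply: le_trans (trunc_err_sum hW _ _ _) _.
rewrite ler_wpM2r// -natrM ler_nat.
by rewrite mulnS -[X in (X <= _)%N]addn0; apply: leq_add.
Qed.

Lemma prod_err_sum C C' A f g : wien C f -> wien C' g ->
  \sum_(i <- A) \sum_(j <- A) `|prod_err A f g i j| <=
  C * C' * (boundary_size W A)%:R.
Proof.
move=> hf hg; have C0 := wiener_ge0 hf; have C0' := wiener_ge0 hg.
have bf := wiener_bounded_meas hf; have bg := wiener_bounded_meas hg.
pose n : R := (#|` A|)%:R; pose M := C + C'.
have M0 : 0 <= M by rewrite addr_ge0.
have n0 : 0 <= n by [].
(* The constant is the cost of replacing [f] and [g] by polynomials: (n M + M) e for each of the n^2
   entries. It depends on [A], which is fixed while e -> 0. *)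
apply: (@ler_addMe _ _ _ (n * (n * (n * M + M)))) => [|e e0].
  by rewrite !mulr_ge0// addr_ge0// mulr_ge0.
have [p pC fp] := hf _ e0; have [q qC gq] := hg _ e0.
have bp := bounded_meas_poly p; have bq := bounded_meas_poly q.
have qC' x : Sp W x -> `|q.[x]| <= C'.
  by move=> Sx; apply: le_trans (horner_palpha q (Sp1 Sx)) _.
have key (a a' b b' : R) : `|a| <= C -> `|b'| <= C' -> `|a - a'| <= e ->
    `|b - b'| <= e -> `|a * b - a' * b'| <= M * e.
  move=> ha hb haa hbb.
  have -> : a * b - a' * b' = a * (b - b') + b' * (a - a') by ring.
  apply: le_trans (ler_normD _ _) _; rewrite !normrM mulrDl.
  by apply: lerD; exact: ler_pM.
have step i j : `|prod_err A f g i j| <=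
    `|prod_err A (horner p) (horner q) i j| + (n * M + M) * e.
  rewrite -lerBlDl; apply: le_trans (lerB_dist _ _) _.
  have -> : prod_err A f g i j - prod_err A (horner p) (horner q) i j =
    \sum_(s <- A) (K f i s * K g s j - K (horner p) i s * K (horner q) s j) -
    (K (fun x => f x * g x) i j - K (fun x => p.[x] * q.[x]) i j).
    by rewrite /prod_err sumrB; ring.
  apply: le_trans (ler_normB _ _) _; rewrite mulrDl; apply: lerD.
    apply: le_trans (ler_norm_sum _ _ _) _.
    apply: (@le_trans _ _ (\sum_(s <- A) M * e)).
      apply: ler_sum => s _; apply: key.
      - exact: Kop_bound hf.
      - by apply: le_trans qC; exact: Kop_bound (wiener_poly _ q).
      - exact: Kop_dist.
      - exact: Kop_dist.
    by rewrite sum_const_fset mulrA.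
  apply: Kop_dist; [exact: bounded_measM|exact: bounded_measM|].
  move=> x Sx; apply: key; [|exact: qC'|exact: fp|exact: gq].
  exact: wiener_bound hf Sx.
apply: (@le_trans _ _ (\sum_(i <- A) \sum_(j <- A)
    (`|prod_err A (horner p) (horner q) i j| + (n * M + M) * e))).
  by apply: ler_sum => i _; apply: ler_sum => j _; exact: step.
under eq_bigr do rewrite big_split/= sum_const_fset.
rewrite big_split/= sum_const_fset; apply: lerD.
  apply: le_trans (prod_err_poly _ _ _) _; rewrite ler_wpM2r//.
  by apply: ler_pM => //; exact: palpha_ge0.
by rewrite !mulrA.
Qed.

End Kernel.

(** * Positive definite matrices *)

Section PositiveDefinite.
Context {R : realType}.

Definition posdef n (M : 'M[R]_n) : Prop :=
  M^T = M /\ forall x : 'cV[R]_n, x != 0 -> 0 < (x^T *m M *m x) 0 0.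

(* Elimination of the first variable (Schur complement). *)
Lemma posdef_block n (M : 'M[R]_(1 + n)) : posdef M ->
  exists (a : R) (C : 'M[R]_n) (Q : 'M[R]_(1 + n)),
    [/\ 0 < a, posdef C, \det Q = 1, Q^T *m M *m Q = block_mx a%:M 0 0 C &
        a + \tr C <= \tr M].
Proof.
move=> [Msym Mpos].
pose a := (ulsubmx M) 0 0; pose b := ursubmx M; pose D := drsubmx M.
have aE : ulsubmx M = a%:M by exact: mx11_scalar.
have bE : dlsubmx M = b^T by rewrite /b trmx_ursub Msym.
have DE : D^T = D by rewrite /D trmx_drsub Msym.
have ME : M = block_mx a%:M b b^T D by rewrite -aE -bE submxK.
have a0 : 0 < a.
  pose x : 'cV[R]_(1 + n) := col_mx 1%:M 0.
  have x0 : x != 0.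
    apply/eqP => /(congr1 usubmx); rewrite col_mxKu linear0 => /matrixP/(_ 0 0).
    by rewrite !mxE/= => /eqP; rewrite oner_eq0.
  have := Mpos x x0.
  rewrite ME /x tr_col_mx !trmx1 trmx0 mul_row_block !mul1mx !mul0mx !addr0.
  by rewrite mul_row_col mulmx1 mulmx0 addr0 mxE eqxx mulr1n.
have an0 : a != 0 by rewrite gt_eqF.
pose v := a^-1 *: b; pose C := D - a^-1 *: (b^T *m b).
pose Q : 'M[R]_(1 + n) := block_mx 1%:M (- v) 0 1%:M.
have QMQ : Q^T *m M *m Q = block_mx a%:M 0 0 C.
  have vT : (- v)^T = - (a^-1 *: b^T) by rewrite /v linearN/= linearZ.
  rewrite ME /Q tr_block_mx !trmx1 trmx0 vT mulmx_block !mul1mx !mul0mx !addr0.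
  rewrite mulmx_block !mulmx1 !mulmx0 !addr0.
  have e1 : - (a^-1 *: b^T) *m a%:M + b^T = 0.
    by rewrite mulNmx mul_mx_scalar scalerA divff// scale1r addNr.
  have e2 : a%:M *m - v + b = 0.
    by rewrite /v mulmxN mul_scalar_mx scalerA divff// scale1r addNr.
  rewrite e1 e2 mul0mx add0r; congr block_mx.
  by rewrite mulNmx -scalemxAl addrC.
have QP y : (col_mx (0 : 'cV[R]_1) y)^T *m (block_mx a%:M 0 0 C) *m (col_mx 0 y) = y^T *m C *m y.
  rewrite tr_col_mx trmx0 mul_row_block !mul0mx !mulmx0 !add0r.
  by rewrite mul_row_col mul0mx add0r.
exists a, C, Q; split => //.
- split.
    by rewrite /C linearB/= DE linearZ/= trmx_mul trmxK.
  move=> y y0; rewrite -QP -QMQ.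
  have -> : (col_mx 0 y)^T *m (Q^T *m M *m Q) *m col_mx 0 y =
      (Q *m col_mx 0 y)^T *m M *m (Q *m col_mx 0 y).
    by rewrite trmx_mul !mulmxA.
  apply: Mpos; apply: contraNneq y0 => /(congr1 dsubmx).
  by rewrite /Q mul_block_col col_mxKd mul0mx mul1mx add0r linear0 => ->.
- by rewrite /Q det_ublock !det1 mulr1.
- rewrite ME mxtrace_block mxtrace_scalar mulr1n lerD2l /C linearB/=.
  rewrite lerBlDr lerDl linearZ/= mulr_ge0 ?invr_ge0 ?(ltW a0)//.
  apply: sumr_ge0 => i _; rewrite mxE big_ord1 !mxE -expr2; exact: sqr_ge0.
Qed.

(** Eliminate one variable: the determinant factors as a det C, while a + tr C <= tr M and ln a <= a
    - 1. *)
Lemma posdef_ln_det n (M : 'M[R]_n) : posdef M ->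
  0 < \det M /\ ln (\det M) <= \tr M - n%:R.
Proof.
elim: n M => [|n IH] M hM.
  by rewrite det_mx00 ln1 /mxtrace big_ord0 subrr; split.
have [a [C [Q [a0 hC dQ QMQ trM]]]] := @posdef_block n M hM.
have [dC lC] := IH C hC.
have dM : \det M = a * \det C.
  have := congr1 determinant QMQ.
  by rewrite !det_mulmx det_tr dQ mul1r mulr1 det_ublock det_scalar1 => ->.
rewrite dM; split; first exact: mulr_gt0.
rewrite lnM ?posrE//; have := ln_sublinear a0; have := le_ln1Dx (x := a - 1).
rewrite addrCA subrr addr0 => h _.
have {}h : ln a <= a - 1 by apply: h; lra.
rewrite -natr1; move: trM; rewrite /=; lra.
Qed.

(** Repeated Schur elimination. It provides the factorization P P^T of the inverse by which
    [posdef_ln_det_le] normalizes [S] to the identity. *)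
Lemma posdef_congruent n (M : 'M[R]_n) : posdef M ->
  exists2 P : 'M[R]_n, P \in unitmx & P^T *m M *m P = 1%:M.
Proof.
elim: n M => [|n IH] M hM.
  by exists 1%:M; rewrite ?unitmx1// !flatmx0.
have [a [C [Q [a0 hC dQ QMQ _]]]] := @posdef_block n M hM.
have [P Pu PCP] := IH C hC.
pose s := (Num.sqrt a)^-1.
have s0 : s != 0 by rewrite invr_eq0 gt_eqF// sqrtr_gt0.
pose B : 'M[R]_(1 + n) := block_mx s%:M 0 0 P.
exists (Q *m B).
  have dB : \det B = s * \det P by rewrite /B (det_ublock s%:M 0 P) det_scalar1.
  by rewrite unitmxE det_mulmx dQ mul1r dB unitrM unitfE s0 -unitmxE.
rewrite trmx_mul -!mulmxA (mulmxA M) (mulmxA Q^T) (mulmxA Q^T) QMQ.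
have BT : B^T = block_mx s%:M 0 0 P^T.
  by rewrite /B (@tr_block_mx _ 1 n 1 n) !trmx0 tr_scalar_mx.
rewrite BT /B (@mulmx_block _ 1 n 1 n 1 n) (@mulmx_block _ 1 n 1 n 1 n).
rewrite !mul0mx !mulmx0 !addr0 !add0r.
have e1 : (s%:M : 'M[R]_1) *m (a%:M *m s%:M) = 1%:M.
  rewrite -!scalar_mxM; congr scalar_mx.
  by rewrite mulrCA -expr2 /s exprVn sqr_sqrtr ?(ltW a0)// divff// gt_eqF.
have e2 : P^T *m (C *m P) = 1%:M by rewrite mulmxA.
by rewrite e1 e2 !mulmx0 -(@scalar_mx_block _ 1 n 1).
Qed.

Lemma posdef_unit n (M : 'M[R]_n) : posdef M -> M \in unitmx.
Proof.
by move=> /posdef_ln_det[dM _]; rewrite unitmxE unitfE gt_eqF.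
Qed.

(** Concavity of ln det, as its tangent inequality at [S]: conjugation by P with P^T S P = 1 reduces
    it to S = 1, which is [posdef_ln_det]. *)
Lemma posdef_ln_det_le n (S T : 'M[R]_n) : posdef S -> posdef T ->
  ln (\det T) - ln (\det S) <= \tr (invmx S *m T) - n%:R.
Proof.
move=> hS hT; have [P Pu PSP] := posdef_congruent hS.
have Su := posdef_unit hS.
have Pd : \det P != 0 by rewrite -unitfE -unitmxE.
have dS : \det S = (\det P ^+ 2)^-1.
  have := congr1 determinant PSP; rewrite !det_mulmx det_tr det1 => h.
  apply: (mulfI (x := \det P ^+ 2)); first by rewrite expf_neq0.
  by rewrite divff ?expf_neq0// -h; ring.
have dS0 := (posdef_ln_det hS).1; have dT0 := (posdef_ln_det hT).1.
have P2 : 0 < \det P ^+ 2 by rewrite exprn_even_gt0.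
have invS : invmx S = P *m P^T.
  have h1 : P^T *m S = invmx P by rewrite -[LHS](mulmxK Pu) PSP mul1mx.
  have h2 : P *m P^T *m S = 1%:M by rewrite -mulmxA h1 mulmxV.
  by rewrite -[LHS]mul1mx -h2 mulmxK.
have hN : posdef (P^T *m T *m P).
  split; first by rewrite !trmx_mul trmxK hT.1 mulmxA.
  move=> x x0.
  have -> : x^T *m (P^T *m T *m P) *m x = (P *m x)^T *m T *m (P *m x).
    by rewrite trmx_mul !mulmxA.
  apply: hT.2; apply: contraNneq x0 => h.
  by rewrite -[x](mulKmx Pu) h mulmx0.
have [_] := posdef_ln_det hN.
have -> : \tr (P^T *m T *m P) = \tr (invmx S *m T).
  by rewrite mxtrace_mulC mulmxA invS.
apply: le_trans; rewrite !det_mulmx det_tr dS lnV ?posrE// opprK.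
rewrite -lnM ?posrE//; rewrite le_eqVlt; apply/orP; left; apply/eqP.
by congr ln; ring.
Qed.

End PositiveDefinite.

(** * Finite submatrices of kernels and their inverses *)

Section RestrictedMatrix.
Context {R : realType} {G : countType}.
Implicit Types (F M N : G -> G -> R) (A : {fset G}) (x y : G -> R).

Lemma sum_enum_val A (g : G -> R) :
  \sum_(k < #|{: A}|) g (val (enum_val k)) = \sum_(i <- A) g i.
Proof. by rewrite big_seq_fsetE/= (reindex _ (onW_bij _ (@enum_val_bij A))). Qed.

Definition vec A x : 'cV[R]_#|{: A}| := \col_k x (val (enum_val k)).

Lemma qform_restr M A x : qform (restr_mx M A) (vec A x) =
  \sum_(i <- A) \sum_(j <- A) x i * x j * M i j.
Proof.
rewrite /qform mxE -sum_enum_val exchange_big/= -sum_enum_val exchange_big/=.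
transitivity (\sum_(j < #|{: A}|) \sum_(k < #|{: A}|)
    x (val (enum_val k)) * x (val (enum_val j)) * M (val (enum_val k)) (val (enum_val j))).
  apply: eq_bigr => j _; rewrite !mxE mulr_suml; apply: eq_bigr => k _.
  by rewrite !mxE; ring.
exact: exchange_big.
Qed.

Lemma mxtrace_restr M N A : \tr (restr_mx M A *m restr_mx N A) =
  \sum_(i <- A) \sum_(j <- A) M i j * N j i.
Proof.
rewrite /mxtrace -sum_enum_val; apply: eq_bigr => k _.
by rewrite mxE -sum_enum_val; apply: eq_bigr => l _; rewrite !mxE.
Qed.

Definition unvec A (v : 'cV[R]_#|{: A}|) : G -> R :=
  fun i => if insub i is Some i' then v (enum_rank (i' : A)) 0 else 0.

Lemma unvecK A (v : 'cV[R]_#|{: A}|) : vec A (unvec v) = v.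
Proof.
apply/matrixP => k l; rewrite !mxE /unvec (ord1 l) valK.
by rewrite enum_valK.
Qed.

Definition coercive F A (c : R) := (forall i j, F i j = F j i) /\
  forall y, c * (\sum_(i <- A) y i ^+ 2) <= \sum_(i <- A) \sum_(j <- A) y i * y j * F i j.

Lemma coercive_posdef F A c : 0 < c -> coercive F A c -> posdef (restr_mx F A).
Proof.
move=> c0 [Fs Fc]; split.
  by apply/matrixP => k l; rewrite !mxE.
move=> x x0; rewrite -[x]unvecK -/(qform _ _) qform_restr.
apply: lt_le_trans (Fc _); rewrite mulr_gt0//.
rewrite lt_neqAle sumr_ge0 ?andbT; last by move=> i _; exact: sqr_ge0.
apply: contraNneq x0 => /esym h; rewrite -[x]unvecK.
apply/eqP/matrixP => k l; rewrite !mxE.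
rewrite -sum_enum_val in h.
have := psumr_eq0P (fun i _ => sqr_ge0 _) h => /(_ k isT)/eqP.
by rewrite sqrf_eq0 => /eqP.
Qed.

(** The inverse matrix transported back to indices in [G], and 0 outside [A], so that it can be
    summed like any other kernel. *)
Definition inv_kernel F A : G -> G -> R := fun i j =>
  if (insub i, insub j) is (Some i', Some j')
  then invmx (restr_mx F A) (enum_rank (i' : A)) (enum_rank (j' : A)) else 0.

Lemma restr_inv_kernel F A : restr_mx (inv_kernel F A) A = invmx (restr_mx F A).
Proof. by apply/matrixP => k l; rewrite mxE /inv_kernel !valK !enum_valK. Qed.

Lemma restr_mul_entry M N A i j (iA : i \in A) (jA : j \in A) :
  (restr_mx M A *m restr_mx N A) (enum_rank [` iA]%fset) (enum_rank [` jA]%fset) =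
  \sum_(k <- A) M i k * N k j.
Proof.
rewrite mxE -sum_enum_val; apply: eq_bigr => k _.
by rewrite !mxE !enum_rankK.
Qed.

Lemma inv_kernelP F A i j : restr_mx F A \in unitmx -> i \in A -> j \in A ->
  \sum_(k <- A) F i k * inv_kernel F A k j = (i == j)%:R.
Proof.
move=> Fu iA jA; rewrite -(restr_mul_entry _ _ iA jA) restr_inv_kernel mulmxV//.
by rewrite mxE (inj_eq enum_rank_inj).
Qed.

Lemma inv_kernel_sym F A i j : (forall i j, F i j = F j i) ->
  inv_kernel F A i j = inv_kernel F A j i.
Proof.
move=> Fs; rewrite /inv_kernel; case: insubP => [i' _ _|_]; case: insubP => [j' _ _|_] //.
have FT : (restr_mx F A)^T = restr_mx F A by apply/matrixP => k l; rewrite !mxE.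
by rewrite -[in LHS]FT -trmx_inv mxE.
Qed.

Lemma ln_det_restr_le S T A c : 0 < c -> coercive S A c -> coercive T A c ->
  ln (\det (restr_mx T A)) - ln (\det (restr_mx S A)) <=
  \sum_(i <- A) \sum_(j <- A) inv_kernel S A i j * T j i - #|` A|%:R.
Proof.
move=> c0 hS hT.
have := posdef_ln_det_le (coercive_posdef c0 hS) (coercive_posdef c0 hT).
have -> : #|` A|%:R = #|{: A}|%:R :> R by rewrite cardfE.
by rewrite -restr_inv_kernel mxtrace_restr.
Qed.

Lemma qform_inv F A x : qform (invmx (restr_mx F A)) (vec A x) =
  \sum_(i <- A) \sum_(j <- A) x i * x j * inv_kernel F A i j.
Proof. by rewrite -restr_inv_kernel qform_restr. Qed.

End RestrictedMatrix.

Section InverseKernel.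
Context {R : realType} {G : countType} (F : G -> G -> R) (A : {fset G}) (c : R).
Hypotheses (c0 : 0 < c) (hF : coercive F A c).
Implicit Types (x y : G -> R).

Local Notation M := (inv_kernel F A).

Definition solve x : G -> R := fun i => \sum_(j <- A) M i j * x j.

Let Fu : restr_mx F A \in unitmx.
Proof. exact: posdef_unit (coercive_posdef c0 hF). Qed.

Lemma solveP x i : i \in A -> \sum_(k <- A) F i k * solve x k = x i.
Proof.
move=> iA; rewrite /solve; under eq_bigr do rewrite mulr_sumr.
rewrite exchange_big/= -[RHS](_ : \sum_(j <- A) (i == j)%:R * x j = _); last first.
  by rewrite sum_indic iA.
rewrite big_seq [RHS]big_seq; apply: eq_bigr => j jA.
by rewrite -(inv_kernelP Fu iA jA) mulr_suml; apply: eq_bigr => k _; rewrite mulrA.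
Qed.

Lemma solve_quad x : \sum_(i <- A) \sum_(j <- A) solve x i * solve x j * F i j =
  \sum_(i <- A) solve x i * x i.
Proof.
rewrite big_seq [RHS]big_seq; apply: eq_bigr => i iA.
rewrite -[in RHS](solveP x iA) mulr_sumr; apply: eq_bigr => j _; ring.
Qed.

Lemma inv_quad x : \sum_(i <- A) \sum_(j <- A) x i * x j * M i j =
  \sum_(i <- A) solve x i * x i.
Proof.
apply: eq_bigr => i _; rewrite /solve mulr_suml; apply: eq_bigr => j _; ring.
Qed.

(** With z = [solve x], coercivity gives c |z|^2 <= <z, x>, and <z, x> <= (c/2) |z|^2 + |x|^2 /
    (2c). *)
Lemma solve_norm x :
  \sum_(i <- A) solve x i ^+ 2 <= (c ^+ 2)^-1 * \sum_(i <- A) x i ^+ 2.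
Proof.
set S := \sum_(i <- A) _; set X := \sum_(i <- A) _.
have h1 : c * S <= \sum_(i <- A) solve x i * x i by rewrite -solve_quad; exact: hF.2.
have h2 : \sum_(i <- A) solve x i * x i <= c / 2 * S + (2 * c)^-1 * X.
  rewrite /S /X !mulr_sumr -big_split/=; apply: ler_sum => i _.
  rewrite -subr_ge0.
  have -> : c / 2 * solve x i ^+ 2 + (2 * c)^-1 * x i ^+ 2 - solve x i * x i =
     (2 * c)^-1 * (c * solve x i - x i) ^+ 2 by field; rewrite gt_eqF.
  by rewrite mulr_ge0 ?sqr_ge0// invr_ge0 mulr_ge0// ltW.
have h3 : c / 2 * S <= (2 * c)^-1 * X by lra.
have c2 : 0 < 2 / c by rewrite divr_gt0.
have := ler_wpM2l (ltW c2) h3.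
have -> : 2 / c * (c / 2 * S) = S by field; rewrite gt_eqF.
by have -> : 2 / c * ((2 * c)^-1 * X) = (c ^+ 2)^-1 * X by field; rewrite gt_eqF.
Qed.

(** Expand the form, which is nonnegative, at [solve x - y]. Equality at y = [solve x] is
    [inv_quad_solve]; this maximum over [y] yields both the monotonicity in the index set and the
    continuity in the parameter. *)
Lemma inv_quad_ge x y : 2 * (\sum_(i <- A) x i * y i) -
   \sum_(i <- A) \sum_(j <- A) y i * y j * F i j <=
   \sum_(i <- A) \sum_(j <- A) x i * x j * M i j.
Proof.
rewrite inv_quad.
have h : 0 <= \sum_(i <- A) \sum_(j <- A)
    (solve x i - y i) * (solve x j - y j) * F i j.
  apply: le_trans (hF.2 _); rewrite mulr_ge0 ?(ltW c0)//.
  by apply: sumr_ge0 => i _; exact: sqr_ge0.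
rewrite -subr_ge0; apply: le_trans h _; rewrite le_eqVlt; apply/orP; left; apply/eqP.
have -> : \sum_(i <- A) \sum_(j <- A) (solve x i - y i) * (solve x j - y j) * F i j =
    \sum_(i <- A) \sum_(j <- A) solve x i * solve x j * F i j -
    2 * (\sum_(i <- A) \sum_(j <- A) y i * (F i j * solve x j)) +
    \sum_(i <- A) \sum_(j <- A) y i * y j * F i j.
  have -> : 2 * (\sum_(i <- A) \sum_(j <- A) y i * (F i j * solve x j)) =
     \sum_(i <- A) \sum_(j <- A) y i * (F i j * solve x j) +
     \sum_(i <- A) \sum_(j <- A) y j * (F j i * solve x i).
    by rewrite mulr_natl mulr2n; congr (_ + _); rewrite exchange_big.
  rewrite opprD addrA -!sumrB -big_split/=; apply: eq_bigr => i _.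
  rewrite -!sumrB -big_split/=; apply: eq_bigr => j _.
  by rewrite (hF.1 j i); ring.
have -> : \sum_(i <- A) \sum_(j <- A) y i * (F i j * solve x j) = \sum_(i <- A) x i * y i.
  rewrite big_seq [RHS]big_seq; apply: eq_bigr => i iA.
  by rewrite -mulr_sumr solveP// mulrC.
by rewrite solve_quad; ring.
Qed.

Lemma inv_quad_solve x : 2 * (\sum_(i <- A) x i * solve x i) -
   \sum_(i <- A) \sum_(j <- A) solve x i * solve x j * F i j =
   \sum_(i <- A) \sum_(j <- A) x i * x j * M i j.
Proof.
rewrite inv_quad solve_quad.
under [X in 2 * X - _]eq_bigr do rewrite mulrC.
ring.
Qed.

Lemma solve_dvec j i : j \in A -> solve (dvec j) i = M i j.
Proof.
move=> jA; rewrite /solve; under eq_bigr do rewrite mulrC /dvec eq_sym.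
by rewrite sum_indic jA.
Qed.

(** Column [j] of the inverse solves the system for [dvec j], so its norm is at most 1/c. *)
Lemma inv_kernel_bound i j : i \in A -> j \in A -> `|M i j| <= c^-1.
Proof.
move=> iA jA; have ci : 0 < c^-1 by rewrite invr_gt0.
rewrite -ler_sqr ?nnegrE ?(ltW ci)// real_normK ?num_real//.
have := solve_norm (dvec j).
have -> : \sum_(k <- A) (dvec j k : R) ^+ 2 = 1.
  under eq_bigr do rewrite expr2 {1}/dvec eq_sym.
  by rewrite sum_indic jA /dvec eqxx.
rewrite mulr1 exprVn; apply: le_trans.
under eq_bigr do rewrite solve_dvec//.
rewrite (big_fsetD1 i)//= lerDl; apply: sumr_ge0 => k _; exact: sqr_ge0.
Qed.

End InverseKernel.

(** * Log-determinants *)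

Lemma ler_addMn {R : realType} (x y M : R) :
  (forall n, x <= y + M * n.+1%:R^-1) -> x <= y.
Proof.
move=> h; have h0 : y + M * n.+1%:R^-1 @[n --> \oo] --> y.
  rewrite -[X in _ --> X]addr0 -(mulr0 M); apply: cvgD; first exact: cvg_cst.
  by apply: cvgMr; exact: cvg_harmonic.
by apply: (cvgr_to_ge h0); near=> n; exact: h.
Unshelve. all: by end_near. Qed.

Lemma expR_taylor1 {R : realType} (y r : R) : `|y| <= r ->
  `|expR y - 1 - y| <= r ^+ 2 * expR r.
Proof.
move=> yr; have r0 : 0 <= r by apply: le_trans yr.
have h1 := expR_ge1Dx y; have h2 := expR_ge1Dx (- y).
have e1 : `|expR y - 1| <= expR r * `|y|.
  have := @expR_lip R r y 0; rewrite expR0 subr0; apply => //.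
  exact: le_trans (ler_norm _) yr.
rewrite ger0_norm; last by lra.
(* e^y - 1 - y <= y (e^y - 1) amounts to e^y (1 - y) <= 1, a consequence of 1 - y <= e^(-y). *)
apply: (@le_trans _ _ (y * (expR y - 1))).
  have h3 : expR y * expR (- y) = 1 by rewrite -expRD subrr expR0.
  have := expR_gt0 y; move: (expR y) (expR (- y)) h1 h2 h3 => a b *; nra.
apply: le_trans (ler_norm _) _; rewrite normrM.
apply: (@le_trans _ _ (r * (expR r * r))); last first.
  by rewrite le_eqVlt; apply/orP; left; apply/eqP; ring.
apply: ler_pM => //; apply: le_trans e1 _.
by rewrite ler_wpM2l// expR_ge0.
Qed.

Lemma sum_nat_avg {R : realType} n (z : R) :
  \sum_(0 <= k < n.+1) (n.+1%:R)^-1 * z = z.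
Proof. by rewrite sumr_const_nat subn0 -[LHS]mulr_natl mulrA divff ?mul1r. Qed.

Fact two_sided {R : realType} (a b S B : R) : b - a - (1 - 0) * S <= B ->
  a - b - (0 - 1) * S <= B -> a = 0 -> `|b - S| <= B.
Proof. by move=> h1 h2 a0; rewrite ler_norml; apply/andP; split; lra. Qed.

Section ExponentialKernel.
Context {R : realType} {G : countType} (W : G -> G -> R).
Context (E : set R -> (G -> R) -> (G -> R)).
Hypotheses (hW : is_graph W) (hE : spectral_resolution W E).
Variables (h : R -> R) (r : R).
Hypothesis hh : wiener (Sp W) r h.
Implicit Types (A : {fset G}) (s : R).

Local Notation K := (Kop W E).
Local Notation wien := (wiener (Sp W)).

Let Sp1 x : Sp W x -> `|x| <= 1. Proof. exact: Sp_le1. Qed.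

Let r0 : 0 <= r. Proof. exact: wiener_ge0 hh. Qed.

Let hr x : Sp W x -> `|h x| <= r. Proof. exact: (wiener_bound Sp1 hh). Qed.

(** A path from the constant 1 at s = 0 to the density e^h at s = 1; the value s = -1 gives the
    inverse density. *)
Definition expf s : R -> R := fun x => expR (s * h x).

Definition cexp : R := 1 + expR r.

Lemma wiener_expf s : `|s| <= 1 -> wien cexp (expf s).
Proof.
move=> s1; have h1 := wiener_exp Sp1 hh s1.
have h2 : wien (1 + `|s| * expR r) (fun x => 1 + (expR (s * h x) - 1)).
  by rewrite -{1}(normr1 R); apply: wienerD h1; exact: wiener_cst.
apply: (@eq_wiener _ _ _ (fun x => 1 + (expR (s * h x) - 1))).
  by move=> x _; rewrite /expf; ring.
by apply: wienerW h2; rewrite lerD2l ler_piMl// expR_ge0.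
Qed.

Lemma sh_bound s x : `|s| <= 1 -> Sp W x -> `|s * h x| <= r.
Proof.
move=> s1 Sx; rewrite normrM; apply: le_trans (hr Sx).
by rewrite ler_piMl.
Qed.

Lemma expf_bound s x : `|s| <= 1 -> Sp W x -> expR (- r) <= expf s x <= expR r.
Proof.
move=> s1 Sx; have := sh_bound s1 Sx; rewrite ler_norml => /andP[h1 h2].
by rewrite !ler_expR h1 h2.
Qed.

Lemma expf_coercive s A : `|s| <= 1 -> coercive (K (expf s)) A (expR (- r)).
Proof.
move=> s1; have hs := wiener_expf s1; split.
  by move=> i j; exact: (Kop_sym hE _ _ (wiener_bounded_meas hW hs)).
by move=> y; apply: (quad_ge hW hE _ _ hs) => x Sx; case/andP: (expf_bound s1 Sx).
Qed.

Let M s A := inv_kernel (K (expf s)) A.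

Lemma inv_kernel_left s A i j : `|s| <= 1 -> i \in A -> j \in A ->
  \sum_(k <- A) M s A i k * K (expf s) k j = (i == j)%:R.
Proof.
move=> s1 iA jA; have hc := expf_coercive A s1.
rewrite eq_sym -(inv_kernelP (F := K (expf s)) (A := A) _ jA iA); last first.
  by apply: posdef_unit; exact: coercive_posdef (expR_gt0 _) hc.
apply: eq_bigr => k _; rewrite mulrC hc.1; congr (_ * _).
by rewrite /M inv_kernel_sym//; exact: hc.1.
Qed.

(** Each entry of the inverse is at most 1 / e^(-r); hence the error that it multiplies is measured
    by the sum of all its entries. *)
Lemma inv_kernel_err_sum s A (P : G -> G -> R) : `|s| <= 1 ->
  `|\sum_(i <- A) \sum_(j <- A) M s A i j * P j i| <=
  expR r * \sum_(i <- A) \sum_(j <- A) `|P i j|.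
Proof.
move=> s1; rewrite [in leRHS]exchange_big/= mulr_sumr.
apply: le_trans (ler_norm_sum _ _ _) _.
rewrite big_seq [leRHS]big_seq; apply: ler_sum => i iA; rewrite mulr_sumr.
apply: le_trans (ler_norm_sum _ _ _) _.
rewrite big_seq [leRHS]big_seq; apply: ler_sum => j jA; rewrite normrM ler_wpM2r//.
have := inv_kernel_bound (expR_gt0 (- r)) (expf_coercive A s1) iA jA.
by rewrite expRN invrK.
Qed.

(** Tangent inequality at [s]. With t = s' - s and u = e^(t h) - 1, K(e^(s' h)) is K(e^(s h)) (1 +
    K(u)) up to the product error, so the trace term reduces to n + Tr K(u). Replacing u by t h
    costs O(t^2) per vertex; the product error is O(|t|) times the boundary. *)
Lemma ln_det_step s s' A : `|s| <= 1 -> `|s'| <= 1 -> `|s' - s| <= 1 ->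
  ln (\det (restr_mx (K (expf s')) A)) - ln (\det (restr_mx (K (expf s)) A)) <=
  (s' - s) * \sum_(i <- A) K h i i +
  expR r * (cexp * (`|s' - s| * expR r) * (boundary_size W A)%:R) +
  #|` A|%:R * ((`|s' - s| * r) ^+ 2 * expR r).
Proof.
move=> s1 s1' t1; set t := s' - s in t1 *.
have hs := wiener_expf s1; have hu := wiener_exp Sp1 hh t1.
set u := (fun x => expR (t * h x) - 1) in hu.
have bs := wiener_bounded_meas hW hs; have bu := wiener_bounded_meas hW hu.
have bh := wiener_bounded_meas hW hh.
apply: le_trans (ln_det_restr_le (expR_gt0 _) (expf_coercive A s1) (expf_coercive A s1')) _.
have TE i j : K (expf s') i j = K (expf s) i j +
    (\sum_(p <- A) K (expf s) i p * K u p j - prod_err W E A (expf s) u i j).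
  rewrite /prod_err opprB [X in _ + X]addrC subrK -(KopD hW hE)//; last exact: bounded_measM.
  apply: eq_Kop => x _; rewrite /expf /u mulrBr mulr1 -expRD addrC subrK.
  by congr expR; rewrite /t; ring.
have -> : \sum_(i <- A) \sum_(j <- A) inv_kernel (K (expf s)) A i j * K (expf s') j i =
    #|` A|%:R + \sum_(i <- A) K u i i -
    \sum_(i <- A) \sum_(j <- A) M s A i j * prod_err W E A (expf s) u j i.
  under eq_bigr do under eq_bigr do rewrite TE mulrDr mulrBr.
  under eq_bigr do rewrite big_split/= sumrB.
  rewrite big_split/= sumrB addrA; congr (_ + _ - _).
    rewrite -[X in _ = X%:R]muln1 natrM -sum_const_fset big_seq [RHS]big_seq.
    by apply: eq_bigr => i iA; rewrite inv_kernel_left// eqxx.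
  rewrite big_seq [RHS]big_seq; apply: eq_bigr => i iA.
  under eq_bigr do rewrite mulr_sumr.
  rewrite exchange_big/= -[RHS](_ : \sum_(p <- A) (i == p)%:R * K u p i = _); last first.
    by rewrite sum_indic iA.
  rewrite big_seq [RHS]big_seq; apply: eq_bigr => p pA.
  rewrite -(inv_kernel_left s1 iA pA) mulr_suml.
  by apply: eq_bigr => j _; rewrite mulrA.
have h1 : \sum_(i <- A) K u i i <= t * \sum_(i <- A) K h i i +
    #|` A|%:R * ((`|t| * r) ^+ 2 * expR r).
  rewrite -sum_const_fset mulr_sumr -big_split/=; apply: ler_sum => i _.
  rewrite -(KopZ hW hE)// -lerBlDl; apply: le_trans (ler_norm _) _.
  apply: (Kop_dist hW hE) => //; first exact: bounded_measZ.
  move=> x Sx.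
  have tx : `|t * h x| <= `|t| * r by rewrite normrM ler_wpM2l// hr.
  apply: le_trans (expR_taylor1 tx) _.
  by rewrite ler_wpM2l ?sqr_ge0// ler_expR ler_piMl.
have h2 : - (\sum_(i <- A) \sum_(j <- A) M s A i j * prod_err W E A (expf s) u j i) <=
    expR r * (cexp * (`|t| * expR r) * (boundary_size W A)%:R).
  apply: le_trans (ler_norm _) _; rewrite normrN.
  apply: le_trans (inv_kernel_err_sum _ _ s1) _.
  rewrite ler_wpM2l ?expR_ge0//; exact: (prod_err_sum hW hE).
rewrite [X in X - _ <= _]addrC addrAC; move: h1 h2.
set a := \sum_(i <- A) K u i i; set b := - _; set c := _%:R * (_ * _).
set e := t * _; set g := expR r * _ => h1 h2.
have -> : b - #|` A|%:R + (#|` A|%:R + a) = a + b by ring.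
by rewrite addrAC; exact: lerD.
Qed.

(** Cut the path from s to s' into N equal steps and add up [ln_det_step]: the terms linear in the
    step keep their total, while the quadratic one, [H] / N, vanishes as N -> oo. The bound is
    one-sided but holds in both directions of travel, which is how [ln_det_expf] uses it. *)
Lemma ln_det_expf_le s s' A : 0 <= s <= 1 -> 0 <= s' <= 1 ->
  ln (\det (restr_mx (K (expf s')) A)) - ln (\det (restr_mx (K (expf s)) A)) -
  (s' - s) * \sum_(i <- A) K h i i <=
  expR r * (cexp * expR r * (boundary_size W A)%:R).
Proof.
move=> /andP[s0 s1] /andP[s0' s1'].
set B := expR r * _.
pose H := #|` A|%:R * (r ^+ 2 * expR r).
apply: (@ler_addMn _ _ _ H) => n.
pose N : R := n.+1%:R; have N0 : 0 < N by rewrite ltr0n.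
pose t k : R := s + k%:R / N * (s' - s).
have t01 k : (k <= n.+1)%N -> `|t k| <= 1.
  move=> kn; have k0 : 0 <= k%:R / N by rewrite divr_ge0// ltW.
  have k1 : k%:R / N <= 1 by rewrite ler_pdivrMr// mul1r ler_nat.
  have -> : t k = (1 - k%:R / N) * s + k%:R / N * s' by rewrite /t; ring.
  move: (k%:R / N) k0 k1 => l l0 l1.
  rewrite ger0_norm; last by rewrite addr_ge0// mulr_ge0// subr_ge0.
  nra.
have tS k : t k.+1 - t k = N^-1 * (s' - s).
  by rewrite /t -natr1; ring.
have ss1 : `|s' - s| <= 1 by rewrite ler_norml; apply/andP; split; lra.
have N1 : `|N^-1 * (s' - s)| <= N^-1.
  rewrite normrM gtr0_norm ?invr_gt0// ler_piMr//.
  by rewrite invr_ge0 ltW.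
have NV : N^-1 <= 1 by rewrite invf_le1// ler1n.
pose L k := ln (\det (restr_mx (K (expf (t k))) A)).
have step k : (k < n.+1)%N -> L k.+1 - L k <=
    N^-1 * ((s' - s) * \sum_(i <- A) K h i i + B + H * N^-1).
  move=> kn; have := @ln_det_step (t k) (t k.+1) A (t01 _ (ltnW kn)) (t01 _ kn).
  rewrite tS => /(_ (le_trans N1 NV))/le_trans; apply.
  have -> : N^-1 * ((s' - s) * \sum_(i <- A) K h i i + B + H * N^-1) =
    N^-1 * (s' - s) * (\sum_(i <- A) K h i i) + N^-1 * B + N^-1 * (H * N^-1) by ring.
  apply: lerD; first apply: lerD => //.
    rewrite /B.
    have -> : N^-1 * (expR r * (cexp * expR r * (boundary_size W A)%:R)) =
      expR r * (cexp * (N^-1 * expR r) * (boundary_size W A)%:R) by ring.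
    rewrite ler_wpM2l ?expR_ge0// ler_wpM2r// ler_wpM2l//.
      by rewrite addr_ge0// expR_ge0.
    by rewrite ler_wpM2r// expR_ge0.
  have -> : N^-1 * (H * N^-1) = #|` A|%:R * ((N^-1 * r) ^+ 2 * expR r).
    by rewrite /H; ring.
  rewrite ler_wpM2l// ler_wpM2r ?expR_ge0// lerXn2r// ?nnegrE ?mulr_ge0//.
    by rewrite invr_ge0 ltW.
  by rewrite ler_wpM2r.
have t0E : t 0%N = s by rewrite /t mul0r mul0r addr0.
have tNE : t n.+1 = s' by rewrite /t divff ?gt_eqF// mul1r addrC subrK.
have : L n.+1 - L 0%N <=
    \sum_(0 <= k < n.+1) N^-1 * ((s' - s) * \sum_(i <- A) K h i i + B + H * N^-1).
  rewrite -telescope_sumr// big_nat_cond [leRHS]big_nat_cond.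
  by apply: ler_sum => k /andP[/andP[_ kn] _]; exact: step.
rewrite sum_nat_avg /L t0E tNE => hle; rewrite lerBlDl; apply: le_trans hle _; rewrite addrA; exact: lexx.
Qed.

Lemma ln_det_expf A :
  `|ln (\det (restr_mx (K (expf 1)) A)) - \sum_(i <- A) K h i i| <=
  expR r * (cexp * expR r * (boundary_size W A)%:R).
Proof.
have d0 : ln (\det (restr_mx (K (expf 0)) A)) = 0.
  rewrite (_ : restr_mx _ _ = 1%:M) ?det1 ?ln1//.
  apply/matrixP => k l; rewrite !mxE.
  rewrite (@eq_Kop _ _ _ _ _ (fun=> 1)); last by move=> x _; rewrite /expf mul0r expR0.
  by rewrite (Kop1 hW hE) (inj_eq val_inj) (inj_eq enum_val_inj).
have i0 : 0 <= (0 : R) <= 1 by rewrite lexx ler01.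
have i1 : 0 <= (1 : R) <= 1 by rewrite lexx ler01.
have h1 := ln_det_expf_le A i0 i1; have h2 := ln_det_expf_le A i1 i0.
exact: two_sided h1 h2 d0.
Qed.

End ExponentialKernel.

(** * Gaussian moments *)

Section GaussianMoments.
Context {R : realType}.
Notation mu := (@lebesgue_measure R).

(** The integrals of f and g over [0, n] differ by F(n) - F(0), which tends to 0. Both functions are
    nonnegative, so monotone convergence produces the half-line integral of f before f is known to
    be integrable. *)
Lemma integral_by_parts_half_line (f g F : R -> R) (c : R) :
  continuous f -> continuous g -> (forall x, 0 <= x -> 0 <= f x) ->
  (forall x, 0 <= x -> 0 <= g x) ->
  (forall x : R, is_derive x 1 F (f x - g x)) ->
  F n%:R @[n --> \oo] --> F 0 ->
  (\int[mu]_(x in `[0%R, +oo[) (g x)%:E = c%:E)%E ->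
  (\int[mu]_(x in `[0%R, +oo[) (f x)%:E = c%:E)%E.
Proof.
move=> cf cg f0 g0 dF F0 gc.
have itvE : `[0%R, +oo[%classic = \bigcup_k `[0%R, (0 + k%:R)%R]%classic :> set R.
  exact: itv_bndy_bigcup_BRight.
have lim (h : R -> R) : continuous h -> (forall x, 0 <= x -> 0 <= h x) ->
    (\int[mu]_(x in `[0%R, (0 + n%:R)%R]) (h x)%:E)%E @[n --> \oo] -->
    (\int[mu]_(x in `[0%R, +oo[) (h x)%:E)%E.
  move=> ch h0; rewrite itvE; apply: ge0_nondecreasing_set_cvg_integral.
  - apply/nondecreasing_seqP => n; rewrite subsetEset; apply: subset_itvl.
    by rewrite bnd_simp lerD2l ler_nat.
  - by move=> n; exact: measurable_itv.
  - move=> n; apply: measurable_funTS; apply/measurable_EFinP.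
    exact: continuous_measurable_fun.
  - by move=> n x /=; rewrite in_itv/= => /andP[x0 _]; rewrite lee_fin h0.
have cfg : continuous (fun x => f x - g x).
  by move=> x; apply: cvgB; [exact: cf|exact: cg].
have cF : continuous F.
  move=> x; apply: differentiable_continuous; apply/derivable1_diffP.
  by have [] := dF x.
have fin (h : R -> R) n : continuous h ->
    mu.-integrable `[0%R, (0 + n%:R)%R] (EFin \o h).
  move=> ch; apply: continuous_compact_integrable; first exact: segment_compact.
  exact: continuous_subspaceT.
have E n : (\int[mu]_(x in `[0%R, (0 + n.+1%:R)%R]) (f x)%:E =
    \int[mu]_(x in `[0%R, (0 + n.+1%:R)%R]) (g x)%:E + (F n.+1%:R - F 0)%:E)%E.
  have := @continuous_FTC2 R (fun x => f x - g x) F 0 (0 + n.+1%:R).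
  rewrite add0r ltr0n => /(_ isT)/(_ (continuous_subspaceT cfg)).
  have h1 : derivable_oo_LRcontinuous F 0 n.+1%:R.
    split.
    - by move=> x _; have [] := dF x.
    - exact: cvg_at_right_filter (cF 0).
    - exact: cvg_at_left_filter (cF _).
  have h2 : {in `]0, n.+1%:R[, F^`()%classic =1 (fun x => f x - g x)}.
    by move=> x _; rewrite derive1E; have [_ ->] := dF x.
  move=> /(_ h1 h2) h3.
  have := fin f n.+1 cf; have := fin g n.+1 cg; rewrite add0r => ig iff.
  rewrite EFinB -h3.
  under [X in _ = (_ + X)%E]eq_integral do rewrite EFinB.
  rewrite integralB// addeC subeK//.
  by apply: integrable_fin_num => //; exact: measurable_itv.
have l1 : (\int[mu]_(x in `[0%R, (0 + n.+1%:R)%R]) (f x)%:E)%E @[n --> \oo] -->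
    (\int[mu]_(x in `[0%R, +oo[) (f x)%:E)%E.
  by have := lim f cf f0; rewrite -cvg_shiftS.
have l2' : (\int[mu]_(x in `[0%R, (0 + n.+1%:R)%R]) (f x)%:E)%E @[n --> \oo] --> (c%:E)%E.
  have hF : (F n.+1%:R - F 0)%:E @[n --> \oo] --> (0 : R)%:E.
    apply: cvg_EFin; first by near=> n.
    rewrite -[X in _ --> X](subrr (F 0)); apply: cvgB; last exact: cvg_cst.
    by move: F0; rewrite -cvg_shiftS.
  have l3 : ((\int[mu]_(x in `[0%R, (0 + n.+1%:R)%R]) (g x)%:E) @[n --> \oo] --> c%:E)%E.
    by rewrite -gc; have := lim g cg g0; rewrite -cvg_shiftS.
  have : ((\int[mu]_(x in `[0%R, (0 + n.+1%:R)%R]) (g x)%:E + (F n.+1%:R - F 0)%:E)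
      @[n --> \oo] --> (c%:E + 0%:E))%E by apply: cvgeD l3 hF.
  by rewrite adde0; apply: cvg_trans; apply: near_eq_cvg; near=> n; rewrite E.
by have := cvg_unique _ l1 l2'; apply.
Unshelve. all: by end_near. Qed.

Variable s : R.
Hypothesis s0 : 0 < s.
Local Notation phi := (normal_pdf 0 s).

Let sn0 : s != 0. Proof. by rewrite gt_eqF. Qed.

Let phiE x : phi x = normal_peak s * expR (- (x ^+ 2 / (s ^+ 2 *+ 2))).
Proof. by rewrite normal_pdfE// /normal_fun subr0 mulNr. Qed.

Let phi_even : phi =1 phi \o -%R.
Proof. by move=> x /=; rewrite !phiE sqrrN. Qed.

Let dphi (x : R) : is_derive x 1 phi (- (x / s ^+ 2) * phi x).
Proof.
rewrite (_ : phi = fun x => normal_peak s * expR (- ((s ^+ 2 *+ 2)^-1 * x ^+ 2))); last first.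
  by apply/funext => y; rewrite phiE mulrC (mulrC (_ ^+ 2)) mulrC.
apply: is_derive_eq.
rewrite /GRing.scale/=; field.
by rewrite sn0.
Qed.

(** This derivative encodes the recursion between the moments of orders k and k + 2. *)
Let mono_deriv k (x : R) :
  is_derive x 1 (fun x => - s ^+ 2 * (x ^+ k.+1 * phi x))
    (x ^+ k.+2 * phi x - s ^+ 2 * k.+1%:R * (x ^+ k * phi x)).
Proof.
have h := dphi x.
have h1 := is_deriveX k.+1 (is_derive_id x (1 : R)).
have h2 := is_deriveZ (- s ^+ 2 : R) (is_deriveM h1 h).
rewrite (_ : (fun x => _) = - s ^+ 2 \*: (id ^+ k.+1 * phi)); last first.
  by apply/funext => y /=; rewrite exprfctE.
apply: is_derive_eq h2 _; rewrite exprfctE /GRing.scale/= mulr1.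
rewrite (exprS x k.+1) (exprS x k); field.
by rewrite sn0.
Qed.

Let phi_cont : continuous phi. Proof. exact: continuous_normal_pdf. Qed.

Let mono_cont (k : nat) : continuous (fun x : R => x ^+ k * phi x).
Proof.
by move=> x; apply: cvgM; [exact: exprn_continuous|exact: phi_cont].
Qed.

Let mono_lim k : (k <= 3)%N ->
  - s ^+ 2 * (n%:R ^+ k.+1 * phi n%:R) @[n --> \oo] --> (0 : R).
Proof.
move=> k3; rewrite -[X in _ --> X](mulr0 (- s ^+ 2)); apply: cvgMr.
apply: norm_cvg0.
pose q := (s ^+ 2 *+ 2)^-1.
have q0 : 0 < q by rewrite invr_gt0 pmulrn_lgt0// exprn_gt0.
(* From e^y >= y^3 / 3! with y = q N^2, the density is at most a constant times N^-6. Since N^(k+1)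
   <= N^4, the product is at most C N^-2 <= C N^-1. *)
pose C := normal_peak s * 6 * (q ^+ 3)^-1.
have C0 : 0 <= C.
  by rewrite !mulr_ge0 ?normal_peak_ge0 ?invr_ge0 ?exprn_ge0 ?(ltW q0).
have bound n : `|n.+1%:R ^+ k.+1 * phi n.+1%:R| <= C * n.+1%:R^-1.
  pose N : R := n.+1%:R; have N1 : 1 <= N by rewrite ler1n.
  have N0 : 0 < N by rewrite ltr0n.
  have e1 : expR (- (N ^+ 2 / (s ^+ 2 *+ 2))) <= 6 * (q ^+ 3 * N ^+ 6)^-1.
    have y0 : 0 <= N ^+ 2 * q by rewrite mulr_ge0 ?sqr_ge0// ltW.
    have := @expR_ge1Dxn _ (N ^+ 2 * q) 2 y0.
    have -> : (N ^+ 2 * q) ^+ 3 = q ^+ 3 * N ^+ 6 by ring.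
    have z0 : 0 < q ^+ 3 * N ^+ 6 by rewrite mulr_gt0// exprn_gt0.
    move: (q ^+ 3 * N ^+ 6) z0 => z z0 h.
    have h6 : z / 6 <= expR (N ^+ 2 * q).
      by apply: le_trans h; rewrite [3`!]/= lerDr.
    have -> : 6 * z^-1 = (z / 6)^-1 by rewrite invfM invrK mulrC.
    by rewrite expRN lef_pV2 ?posrE ?expR_gt0 ?divr_gt0.
  rewrite ger0_norm; last by rewrite mulr_ge0 ?normal_pdf_ge0// exprn_ge0// ltW.
  rewrite phiE -/N.
  apply: (@le_trans _ _ (N ^+ 4 * (normal_peak s * (6 * (q ^+ 3 * N ^+ 6)^-1)))).
    apply: ler_pM => //.
    - by rewrite exprn_ge0// ltW.
    - by rewrite mulr_ge0 ?normal_peak_ge0// expR_ge0.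
    - by rewrite ler_weXn2l.
    - by rewrite ler_wpM2l// normal_peak_ge0.
  have -> : N ^+ 4 * (normal_peak s * (6 * (q ^+ 3 * N ^+ 6)^-1)) =
      C * (N ^+ 2)^-1 by rewrite /C; field; rewrite !gt_eqF.
  rewrite ler_wpM2l// lef_pV2 ?posrE ?exprn_gt0// expr2 ler_peMr// ltW.
rewrite -cvg_shiftS.
apply: (@squeeze_cvgr _ _ _ _ (fun=> 0) (fun n => C * n.+1%:R^-1)).
- by near=> n; rewrite bound normr_ge0.
- exact: cvg_cst.
- by rewrite -(mulr0 C); apply: cvgMr; exact: cvg_harmonic.
Unshelve. all: by end_near. Qed.

Let half_step k c : (k <= 2)%N ->
  (\int[mu]_(x in `[0%R, +oo[) (x ^+ k * phi x)%:E = c%:E)%E ->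
  (\int[mu]_(x in `[0%R, +oo[) (x ^+ k.+2 * phi x)%:E =
    (s ^+ 2 * k.+1%:R * c)%:E)%E.
Proof.
move=> k2 hc.
apply: (@integral_by_parts_half_line _ (fun x => s ^+ 2 * k.+1%:R * (x ^+ k * phi x))
  (fun x => - s ^+ 2 * (x ^+ k.+1 * phi x))).
- exact: mono_cont.
- by move=> x; apply: cvgMr; exact: mono_cont.
- by move=> x x0; rewrite mulr_ge0 ?normal_pdf_ge0// exprn_ge0.
- move=> x x0; apply: mulr_ge0; first by rewrite mulr_ge0// sqr_ge0.
  by rewrite mulr_ge0 ?normal_pdf_ge0// exprn_ge0.
- by move=> x; exact: mono_deriv.
- have z : - s ^+ 2 * ((0 : R) ^+ k.+1 * phi 0) = 0 by rewrite expr0n mul0r mulr0.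
  rewrite [X in _ --> X](_ : _ = 0); last exact: z.
  by apply: mono_lim; exact: leq_trans k2 _.
under eq_integral do rewrite EFinM.
rewrite ge0_integralZl_EFin//.
- by rewrite hc EFinM.
- move=> x /=; rewrite in_itv/= andbT => x0.
  by rewrite lee_fin mulr_ge0 ?normal_pdf_ge0// exprn_ge0.
- apply: measurable_funTS; apply/measurable_EFinP.
  by apply: continuous_measurable_fun; exact: (mono_cont (k := k)).
- by rewrite mulr_ge0// sqr_ge0.
Qed.

Let sym_integral k : ~~ odd k ->
  (\int[mu]_x (x ^+ k * phi x)%:E =
   2%:E * \int[mu]_(x in `[0%R, +oo[) (x ^+ k * phi x)%:E)%E.
Proof.
move=> ek; rewrite ge0_symfun_integralT//.
- by rewrite set_itvcy.
- move=> x; rewrite mulr_ge0 ?normal_pdf_ge0//.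
  by rewrite -[k]odd_double_half (negbTE ek) add0n -mul2n exprM exprn_ge0// sqr_ge0.
- move=> x /=; rewrite phi_even/=; congr (_ * _).
  by rewrite exprNn -signr_odd (negbTE ek) mul1r.
Qed.

Lemma normal_half_integral : (\int[mu]_(x in `[0%R, +oo[) (phi x)%:E = (2^-1)%:E)%E.
Proof.
have := @sym_integral 0 isT; under eq_integral do rewrite expr0 mul1r.
under [in X in _ = X -> _]eq_integral do rewrite expr0 mul1r.
rewrite integral_normal_pdf => h.
have fin : (\int[mu]_(x in `[0%R, +oo[) (phi x)%:E)%E \is a fin_num.
  apply: integrable_fin_num => //; apply: (integrableS measurableT) => //.
  exact: integrable_normal_pdf.
move: h; rewrite -(fineK fin) -EFinM => -[h]; congr EFin.
by apply: (mulfI (x := 2)) => //; rewrite -h divff.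
Qed.

Lemma normal_moment2 : (\int[mu]_x (x ^+ 2 * phi x)%:E = (s ^+ 2)%:E)%E.
Proof.
rewrite sym_integral// (@half_step 0 2^-1)//.
  by rewrite -EFinM; congr EFin; field.
by under eq_integral do rewrite expr0 mul1r; exact: normal_half_integral.
Qed.

Lemma normal_moment4 : (\int[mu]_x (x ^+ 4 * phi x)%:E = (3 * s ^+ 4)%:E)%E.
Proof.
rewrite sym_integral// (@half_step 2 (s ^+ 2 * 1 * 2^-1))//.
  by rewrite -EFinM; congr EFin; field.
apply: (@half_step 0) => //.
by under eq_integral do rewrite expr0 mul1r; exact: normal_half_integral.
Qed.

End GaussianMoments.

Section HasMean.
Context {R : realType} d {Omega : measurableType d} (P : probability Omega R).
Implicit Types (Y Z : Omega -> R).

Definition has_mean Z (z : R) : Prop :=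
  P.-integrable setT (EFin \o Z) /\ (\int[P]_w (Z w)%:E = z%:E)%E.

Lemma eq_has_mean Y Z z : (forall w, Y w = Z w) -> has_mean Y z -> has_mean Z z.
Proof. by move=> /funext->. Qed.

Lemma has_mean_cst z : has_mean (fun=> z) z.
Proof.
split; first exact: finite_measure_integrable_cst.
by have := expectation_cst P z; rewrite unlock.
Qed.

Lemma has_meanD Y Z y z : has_mean Y y -> has_mean Z z ->
  has_mean (fun w => Y w + Z w) (y + z).
Proof.
move=> [iY eY] [iZ eZ]; split; first exact: (integrableD measurableT iY iZ).
under eq_integral do rewrite EFinD.
by rewrite integralD// eY eZ.
Qed.

Lemma has_meanZ c Z z : has_mean Z z -> has_mean (fun w => c * Z w) (c * z).
Proof.
move=> [iZ eZ]; split; first exact: (integrableZl measurableT c iZ).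
under eq_integral do rewrite EFinM.
by rewrite integralZl// eZ.
Qed.

Lemma has_meanB Y Z y z : has_mean Y y -> has_mean Z z ->
  has_mean (fun w => Y w - Z w) (y - z).
Proof.
move=> hY /(has_meanZ (-1)) hZ; rewrite -(mulN1r z).
by apply: eq_has_mean (has_meanD hY hZ) => w; rewrite mulN1r.
Qed.

Lemma has_mean_sum (I : Type) (r : seq I) (Z : I -> Omega -> R) (z : I -> R) :
  (forall i, has_mean (Z i) (z i)) ->
  has_mean (fun w => \sum_(i <- r) Z i w) (\sum_(i <- r) z i).
Proof.
move=> h; elim: r => [|i r IH].
  rewrite big_nil; apply: eq_has_mean (has_mean_cst 0) => w.
  by rewrite big_nil.
rewrite big_cons; apply: eq_has_mean (has_meanD (h i) IH) => w.
by rewrite big_cons.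
Qed.

Lemma has_mean_measurable Z z : has_mean Z z -> measurable_fun setT Z.
Proof. by move=> [/measurable_int/measurable_EFinP]. Qed.

End HasMean.

(** Even powers are nonnegative, so a finite value of the integral also gives integrability. When v
    = 0 the moments vanish because Y = 0 almost surely; otherwise they are computed on the line
    through the pushforward measure. *)
Lemma centered_normal_moments {R : realType} d {Omega : measurableType d}
    (P : probability Omega R) (Y : Omega -> R) (v : R) :
  measurable_fun setT Y -> 0 <= v ->
  (if v == 0 then {ae P, forall w, Y w = 0}
   else forall B : set R, measurable B ->
          P (Y @^-1` B) = normal_prob 0 (Num.sqrt v) B) ->
  has_mean P (fun w => Y w ^+ 2) v /\ has_mean P (fun w => Y w ^+ 4) (3 * v ^+ 2).
Proof.
move=> mY v0 law.
have mYk k : measurable_fun setT (fun w => Y w ^+ k) by exact: measurable_funX.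
suff int k z : ~~ odd k -> (\int[P]_w (Y w ^+ k)%:E = z%:E)%E ->
    has_mean P (fun w => Y w ^+ k) z.
  suff h : (\int[P]_w (Y w ^+ 2)%:E = v%:E)%E /\
      (\int[P]_w (Y w ^+ 4)%:E = (3 * v ^+ 2)%:E)%E.
    by split; apply: int => //; case: h.
  move: law; case: eqVneq => [->|vn0] law.
    suff z k : (\int[P]_w (Y w ^+ k.+1)%:E = 0)%E.
      by rewrite !z expr0n/= mulr0.
    rewrite -(integral0 P setT); apply: ae_eq_integral => //.
    - by apply/measurable_EFinP; exact: mYk.
    - by apply: filterS law => w h _; rewrite h expr0n.
  have s0 : 0 < Num.sqrt v by rewrite sqrtr_gt0 lt_neqAle eq_sym vn0.
  (* On the real line the canonical Borel structure and the one underlying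
     Lebesgue measure differ by their displays only. *)
  have mY' : measurable_fun setT (Y : Omega -> measurableTypeR R) by exact: mY.
  pose nu : {measure set (measurableTypeR R) -> \bar R} :=
    measure_function_pushforward__canonical__measure_function_Measure P mY'.
  have main k z : ~~ odd k ->
      (\int[lebesgue_measure]_x (x ^+ k * normal_pdf 0 (Num.sqrt v) x)%:E = z%:E)%E ->
      (\int[P]_w (Y w ^+ k)%:E = z%:E)%E.
    move=> ek hz.
    have xk0 (x : R) : 0 <= x ^+ k.
      by rewrite -[k]odd_double_half (negbTE ek) add0n -mul2n exprM exprn_ge0// sqr_ge0.
    have mk : measurable_fun setT (fun x : measurableTypeR R => ((x : R) ^+ k)%:E).
      by apply/measurable_EFinP; exact: measurable_funX.
    have := @ge0_integral_pushforward _ _ _ _ R _ mY' P setT _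
      measurableT mk (fun x _ => xk0 x).
    rewrite preimage_setT => <-.
    rewrite -hz.
    have h := @ge0_integral_density _ _ R lebesgue_measure (normal_pdf 0 (Num.sqrt v))
       (normal_pdf_ge0 0 _) (measurable_normal_pdf 0 _) nu (fun x => ((x : R) ^+ k)%:E).
    by apply: h.
  split.
    by apply: main => //; rewrite normal_moment2// sqr_sqrtr.
  apply: main => //; rewrite normal_moment4//.
  by rewrite (exprM _ 2 2) sqr_sqrtr.
move=> ek hz; split=> //; apply/integrableP; split.
  by apply/measurable_EFinP; exact: mYk.
under eq_integral => w _.
  rewrite /= ger0_norm; last first.
    by rewrite -[k]odd_double_half (negbTE ek) add0n -mul2n exprM exprn_ge0// sqr_ge0.
  over.
by rewrite hz ltry.
Qed.

(** * Moments of Gaussian quadratic forms *)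

Section Isserlis.
Context {R : realType} {G : countType} d {Omega : measurableType d}
  (P : probability Omega R) (X : G -> {RV P >-> R}) (K : G -> G -> R).
Hypotheses (hX : centered_gaussian_process X K) (Ks : forall i j, K i j = K j i).
Implicit Types (A : {fset G}) (M : G -> G -> R).

(** The four indices may coincide: [q] adds the coefficients that fall on the same vertex, and the
    sums over [A] expand to the same expression in all cases. *)
Let lin (i j k l : G) (a b c e : R) :
  has_mean P (fun w => (a * X i w + b * X j w + c * X k w + e * X l w) ^+ 2)
    (a^+2 * K i i + b^+2 * K j j + c^+2 * K k k + e^+2 * K l l +
     2 * (a*b*K i j + a*c*K i k + a*e*K i l + b*c*K j k + b*e*K j l + c*e*K k l)) /\
  has_mean P (fun w => (a * X i w + b * X j w + c * X k w + e * X l w) ^+ 4)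
    (3 * (a^+2 * K i i + b^+2 * K j j + c^+2 * K k k + e^+2 * K l l +
     2 * (a*b*K i j + a*c*K i k + a*e*K i l + b*c*K j k + b*e*K j l + c*e*K k l)) ^+2).
Proof.
pose A := [fset i; j; k; l]%fset.
pose q (p : G) := a * dvec i p + b * dvec j p + c * dvec k p + e * dvec l p.
have [iA jA kA lA] : [/\ i \in A, j \in A, k \in A & l \in A].
  by rewrite !inE !eqxx !orbT.
have sumE (g : G -> R) : \sum_(p <- A) q p * g p = a * g i + b * g j + c * g k + e * g l.
  under eq_bigr do rewrite !mulrDl -!mulrA.
  rewrite !big_split/= -!mulr_sumr.
  have D p : p \in A -> \sum_(x <- A) dvec p x * g x = g p.
    move=> pA; under eq_bigr do rewrite /dvec eq_sym.
    by rewrite sum_indic pA.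
  by rewrite !D.
have [v0] := hX A q.
have -> : (fun w => \sum_(p <- A) q p * X p w) =
    fun w => a * X i w + b * X j w + c * X k w + e * X l w.
  by apply/funext => w; rewrite (sumE (fun p => X p w)).
have vE : \sum_(x <- A) \sum_(y <- A) q x * q y * K x y =
    a^+2 * K i i + b^+2 * K j j + c^+2 * K k k + e^+2 * K l l +
     2 * (a*b*K i j + a*c*K i k + a*e*K i l + b*c*K j k + b*e*K j l + c*e*K k l).
  under eq_bigr => x _.
    under eq_bigr do rewrite -mulrA.
    rewrite -mulr_sumr (sumE (K x)); over.
  rewrite (sumE (fun x => a * K x i + b * K x j + c * K x k + e * K x l)).
  rewrite (Ks j i) (Ks k i) (Ks l i) (Ks k j) (Ks l j) (Ks l k); ring.
rewrite vE in v0 *; move=> law.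
apply: centered_normal_moments => //; last first.
  case: eqP law => // _; apply: filterS => w.
  by rewrite (sumE (fun p => X p w)).
by do !apply: measurable_funD; exact: measurable_funM.
Qed.

Lemma gaussian_moment2 i j : has_mean P (fun w => X i w * X j w) (K i j).
Proof.
have h (s : R) := proj1 (lin i j i j 1 s 0 0).
have := has_meanZ (4^-1) (has_meanB (h 1) (h (-1))).
rewrite (_ : 4^-1 * _ = K i j); last by field.
by apply: eq_has_mean => w; field.
Qed.

(* Polarization: 192 x y z t is the sum of e1 e2 e3 (x + e1 y + e2 z + e3 t)^4
   over all signs e1, e2, e3. *)
Lemma gaussian_moment4 i j k l :
  has_mean P (fun w => X i w * X j w * (X k w * X l w))
    (K i j * K k l + K i k * K j l + K i l * K j k).
Proof.
have h (s t u : R) := has_meanZ (s * t * u) (proj2 (lin i j k l 1 s t u)).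
pose h1 s t := has_meanD (h s t 1) (h s t (-1)).
pose h2 s := has_meanD (h1 s 1) (h1 s (-1)).
have := has_meanZ (192^-1) (has_meanD (h2 1) (h2 (-1))).
rewrite (_ : 192^-1 * _ = K i j * K k l + K i k * K j l + K i l * K j k); last by field.
by apply: eq_has_mean => w; field.
Qed.

Definition quad M A (w : Omega) : R :=
  \sum_(i <- A) \sum_(j <- A) X i w * X j w * M i j.

Definition quad_mean M A : R := \sum_(i <- A) \sum_(j <- A) K i j * M i j.

Let T M A := \sum_(i <- A) \sum_(j <- A) \sum_(k <- A) \sum_(l <- A)
  (M i j * M k l * (K i k * K j l + K i l * K j k)).

Let quad_sqr M A : has_mean P (fun w => (quad M A w - quad_mean M A) ^+ 2) (T M A).
Proof.
have h i j k l : has_mean P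
   (fun w => (X i w * X j w * M i j - K i j * M i j) *
             (X k w * X l w * M k l - K k l * M k l))
   (M i j * M k l * (K i k * K j l + K i l * K j k)).
  have := has_meanB (has_meanB (gaussian_moment4 i j k l)
    (has_meanZ (K k l) (gaussian_moment2 i j)))
    (has_meanB (has_meanZ (K i j) (gaussian_moment2 k l)) (has_mean_cst P (K i j * K k l))).
  move=> /(has_meanZ (M i j * M k l)) h1.
  rewrite (_ : M i j * M k l * (_ + _) = M i j * M k l *
    (K i j * K k l + K i k * K j l + K i l * K j k - K k l * K i j -
          (K i j * K k l - K i j * K k l))); last by ring.
  by apply: eq_has_mean h1 => w; ring.
have := has_mean_sum A (fun i => has_mean_sum A (fun j => has_mean_sum A
  (fun k => has_mean_sum A (fun l => h i j k l)))).
apply: eq_has_mean => w; rewrite /quad /quad_mean -sumrB.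
under [in RHS]eq_bigr do rewrite -sumrB.
rewrite expr2 mulr_suml; apply: eq_bigr => i _.
rewrite mulr_suml; apply: eq_bigr => j _.
rewrite mulr_sumr; apply: eq_bigr => k _.
by rewrite mulr_sumr.
Qed.

(** The variance is 2 Tr((M K)^2), at most twice the sum of the squared entries of M K. Column k of
    M K is M applied to column k of K, so it contributes at most kappa sigma; here kappa bounds the
    square of the operator norm of M. *)
Lemma quad_variance M A (kappa sigma : R) : (forall i j, M i j = M j i) ->
  (forall v : G -> R, \sum_(i <- A) (\sum_(j <- A) M i j * v j) ^+ 2 <=
     kappa * \sum_(i <- A) v i ^+ 2) ->
  0 <= kappa -> (forall k, \sum_(i <- A) K i k ^+ 2 <= sigma) ->
  exists2 V, has_mean P (fun w => (quad M A w - quad_mean M A) ^+ 2) V &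
    V <= 2 * kappa * sigma * (#|` A|)%:R.
Proof.
move=> Ms Mk k0 Ksig; exists (T M A); first exact: quad_sqr.
pose N j k := \sum_(i <- A) M j i * K i k.
have TE : T M A = 2 * \sum_(j <- A) \sum_(k <- A) N j k * N k j.
  have E1 : \sum_(i <- A) \sum_(j <- A) \sum_(k <- A) \sum_(l <- A)
      M i j * M k l * (K i k * K j l) = \sum_(j <- A) \sum_(k <- A) N j k * N k j.
    rewrite exchange_big/=; apply: eq_bigr => j _.
    rewrite exchange_big/=; apply: eq_bigr => k _.
    rewrite /N mulr_suml; apply: eq_bigr => i _.
    rewrite mulr_sumr; apply: eq_bigr => l _.
    by rewrite (Ms j i) (Ks l j); ring.
  have E2 : \sum_(i <- A) \sum_(j <- A) \sum_(k <- A) \sum_(l <- A)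
      M i j * M k l * (K i l * K j k) = \sum_(j <- A) \sum_(k <- A) N j k * N k j.
    rewrite exchange_big/= -E1; apply: eq_bigr => j _; apply: eq_bigr => i _.
    apply: eq_bigr => k _; apply: eq_bigr => l _.
    by rewrite (Ms i j); ring.
  rewrite mulrDl !mul1r -{1}E1 -E2 /T -!big_split/=; apply: eq_bigr => i _.
  rewrite -!big_split/=; apply: eq_bigr => j _.
  rewrite -!big_split/=; apply: eq_bigr => k _.
  by rewrite -!big_split/=; apply: eq_bigr => l _; ring.
have NN : \sum_(j <- A) \sum_(k <- A) N j k * N k j <=
    \sum_(k <- A) \sum_(j <- A) N j k ^+ 2.
  apply: (@le_trans _ _ (\sum_(j <- A) \sum_(k <- A)
      (2^-1 * N j k ^+ 2 + 2^-1 * N k j ^+ 2))).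
    apply: ler_sum => j _; apply: ler_sum => k _.
    by have := sqr_ge0 (N j k - N k j); nra.
  under eq_bigr do rewrite big_split/=.
  rewrite big_split/= [X in X + _]exchange_big/= -big_split/=.
  apply: ler_sum => k _; rewrite -big_split/=; apply: ler_sum => j _; lra.
rewrite TE -!mulrA ler_pM2l//; apply: le_trans NN _.
apply: (@le_trans _ _ (\sum_(k <- A) kappa * sigma)).
  apply: ler_sum => k _; apply: le_trans (Mk (fun i => K i k)) _.
  by apply: ler_wpM2l.
by rewrite sum_const_fset mulrC mulrA.
Qed.

End Isserlis.

(** * A law of large numbers for monotone families *)

Lemma sum_inv_sqr {R : realType} n :
  \sum_(0 <= k < n) (k.+1%:R ^+ 2)^-1 <= 2 :> R.
Proof.
(* The correction 1/(n+1) makes the induction work, because 1/(n+2)^2 <= 1/(n+1) - 1/(n+2). *)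
suff h : \sum_(0 <= k < n.+1) (k.+1%:R ^+ 2)^-1 <= 2 - n.+1%:R^-1 :> R.
  apply: (@le_trans _ _ (\sum_(0 <= k < n.+1) (k.+1%:R ^+ 2)^-1)).
    by rewrite big_nat_recr//= lerDl invr_ge0 sqr_ge0.
  by apply: le_trans h _; rewrite lerBlDr lerDl.
elim: n => [|n IH]; first by rewrite big_nat1 expr1n invr1; lra.
rewrite big_nat_recr//=; apply: le_trans (lerD IH (lexx _)) _.
have n1 : 0 < n.+1%:R :> R by rewrite ltr0n.
have -> : n.+2%:R = n.+1%:R + 1 :> R by rewrite -natr1.
move: (n.+1%:R : R) n1 => x x0.
have x1 : 0 < x + 1 by lra.
rewrite -addrA lerD2l addrC -subr_ge0.
rewrite [leRHS](_ : _ = (x * (x + 1) ^+ 2)^-1 ); last by field; rewrite !gt_eqF.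
by rewrite invr_ge0 mulr_ge0 ?sqr_ge0// ltW.
Qed.

Section AlmostSure.
Context {R : realType} d {Omega : measurableType d} (P : probability Omega R).

(** The series of squares has expectation at most [C], so it is finite almost surely and its terms
    tend to 0. *)
Lemma ae_cvg0_summable (Z : nat -> Omega -> R) (z : nat -> R) (C : R) :
  (forall k, has_mean P (fun w => Z k w ^+ 2) (z k)) ->
  (forall n, \sum_(0 <= k < n) z k <= C) ->
  {ae P, forall w, Z n w @[n --> \oo] --> (0 : R)}.
Proof.
move=> hZ zC.
pose S w : \bar R := (\sum_(0 <= k <oo) (Z k w ^+ 2)%:E)%E.
have pos k w : (0 <= (Z k w ^+ 2)%:E)%E by rewrite lee_fin sqr_ge0.
have mZ k : measurable_fun setT (fun w => (Z k w ^+ 2)%:E).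
  by apply/measurable_EFinP; exact: has_mean_measurable (hZ k).
have iS : P.-integrable setT S.
  apply/integrableP; split.
    by apply: ge0_emeasurable_sum => // k w _ _; exact: pos.
  under eq_integral => w _ do rewrite gee0_abs ?nneseries_ge0//.
  rewrite integral_nneseries//.
  apply: (@le_lt_trans _ _ C%:E); last exact: ltry.
  apply: lime_le.
    by apply: is_cvg_nneseries => k _ _; apply: integral_ge0.
  near=> n; rewrite (eq_bigr (fun k => (z k)%:E)); last first.
    by move=> k _; exact: (proj2 (hZ k)).
  by rewrite sumEFin lee_fin.
have := integrable_ae measurableT iS; apply: filterS => w /(_ I) Sw.
have bnd n : \sum_(0 <= k < n) Z k w ^+ 2 <= fine (S w).
  rewrite -lee_fin fineK// -sumEFin.
  by apply: nneseries_lim_ge => k _ _.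
have h1 : cvgn (series (fun k => Z k w ^+ 2)).
  apply: nondecreasing_is_cvgn.
    by apply/nondecreasing_seqP => n; rewrite /series/= big_nat_recr//= lerDl sqr_ge0.
  by exists (fine (S w)) => _ [n _ <-]; exact: bnd.
have h2 := cvg_series_cvg_0 h1.
apply: norm_cvg0.
have := cvg_comp _ _ h2 (@sqrt_continuous R 0).
rewrite sqrtr0; apply: cvg_trans; apply: near_eq_cvg; near=> n.
by rewrite /= sqrtr_sqr.
Unshelve. all: by end_near. Qed.

Section NestedLaw.
Variables (mn : nat -> nat) (Q : nat -> Omega -> R) (e : nat -> R) (C : R).
Hypotheses (C0 : 0 <= C) (mn_homo : {homo mn : p q / (p <= q)%N})
  (mn_unbounded : forall K, exists n, (K <= mn n)%N)
  (Q_homo : forall p q w, (p <= q)%N -> Q p w <= Q q w)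
  (Q_var : forall n, exists2 V, has_mean P (fun w => (Q n w - e n) ^+ 2) V &
     V <= C * (mn n)%:R)
  (e_incr : forall eta : R, 0 < eta -> exists N, forall p q, (N <= p <= q)%N ->
     `|e q - e p| <= C * ((mn q)%:R - (mn p)%:R) + eta * (mn q)%:R).

(** The maximum serves two purposes: it equals (k+1)^2 when m at [p k] does not exceed that value,
    and it keeps the variance at most C / (k+1)^2 when m overshoots it. *)
Let Y (p : nat -> nat) k w : R :=
  (Num.max (mn (p k))%:R (k.+1%:R ^+ 2))^-1 * (Q (p k) w - e (p k)).

Let Y_cvg p : {ae P, forall w, Y p n w @[n --> \oo] --> (0 : R)}.
Proof.
have /boolp.choice[V hV] : forall n, exists V, has_mean P (fun w => (Q n w - e n) ^+ 2) V /\
    V <= C * (mn n)%:R by move=> n; have [V ? ?] := Q_var n; exists V.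
pose M k : R := Num.max (mn (p k))%:R (k.+1%:R ^+ 2).
apply: (@ae_cvg0_summable (Y p) (fun k => (M k)^-1 ^+ 2 * V (p k)) (C * 2)).
  move=> k; apply: eq_has_mean (has_meanZ ((M k)^-1 ^+ 2) (proj1 (hV (p k)))) => w.
  by rewrite /Y exprMn.
move=> n; apply: (@le_trans _ _ (\sum_(0 <= k < n) C * (k.+1%:R ^+ 2)^-1)); last first.
  by rewrite -mulr_sumr ler_wpM2l// sum_inv_sqr.
apply: ler_sum => k _; have k0 : 0 < k.+1%:R ^+ 2 :> R by rewrite exprn_gt0.
have M1 : (mn (p k))%:R <= M k by rewrite le_max lexx.
have M2 : k.+1%:R ^+ 2 <= M k by rewrite le_max lexx orbT.
have M0 : 0 < M k by apply: lt_le_trans M2.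
apply: (@le_trans _ _ ((M k)^-1 ^+ 2 * (C * M k))).
  apply: ler_wpM2l; first exact: sqr_ge0.
  by apply: le_trans (proj2 (hV _)) _; rewrite ler_wpM2l.
rewrite [leLHS](_ : _ = C * (M k)^-1); last by field; rewrite gt_eqF.
by rewrite ler_wpM2l// lef_pV2.
Qed.

(** The first index of size at least k^2; the last one of size below (k+1)^2 is then
    [(lev k.+1).-1]. *)
Let lev k := ex_minn (mn_unbounded (k ^ 2)).

Let levP k : (k ^ 2 <= mn (lev k))%N.
Proof. by rewrite /lev; case: ex_minnP. Qed.

Let lev_min k n : (k ^ 2 <= mn n)%N -> (lev k <= n)%N.
Proof. by rewrite /lev; case: ex_minnP => m _ h /h. Qed.

(** In the block k^2 <= m_n < (k+1)^2 the form lies between its values at the first and last indices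
    of the block, where m varies by at most 2k + 1 however it jumps. The constant 9 collects eta
    (k+1)^2 <= 4 eta m_n for the fluctuation at an end, and C (2k+1) <= eta m_n and eta m_hi <= 4
    eta m_n for the mean. *)
Let squeeze_step (k n : nat) (eta : R) w : 0 < eta -> (0 < k)%N ->
  (k ^ 2 <= mn n < k.+1 ^ 2)%N ->
  C * (2 * k%:R + 1) <= eta * k%:R ^+ 2 ->
  `|Y lev k w| <= eta -> `|Y (fun k => (lev k.+1).-1) k w| <= eta ->
  (forall p q, (lev k <= p <= q)%N ->
     `|e q - e p| <= C * ((mn q)%:R - (mn p)%:R) + eta * (mn q)%:R) ->
  `|Q n w - e n| <= 9 * eta * (mn n)%:R.
Proof.
move=> eta0 k0 /andP[kn nk] kC Ylo Yhi inc.
pose lo := lev k; pose hi := (lev k.+1).-1.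
have lon : (lo <= n)%N by exact: lev_min.
have nlev : (n < lev k.+1)%N.
  rewrite ltnNge; apply/negP => /mn_homo h.
  by have := leq_ltn_trans h nk; rewrite ltnNge levP.
have nhi : (n <= hi)%N by rewrite /hi -ltnS prednK//; apply: leq_ltn_trans nlev.
have hik : (mn hi < k.+1 ^ 2)%N.
  rewrite ltnNge; apply/negP => /lev_min; rewrite leqNgt /hi prednK ?leqnn//.
  exact: leq_ltn_trans nlev.
have klo := levP k.
have mlo : (mn lo <= mn n)%N by exact: mn_homo.
have mhi : (mn n <= mn hi)%N by exact: mn_homo.
have ll (p : nat) : (mn p <= k.+1 ^ 2)%N ->
    `|(Num.max (mn p)%:R (k.+1%:R ^+ 2))^-1 * (Q p w - e p)| <= eta ->
    `|Q p w - e p| <= eta * k.+1%:R ^+ 2.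
  move=> h; rewrite max_r; last by rewrite -natrX ler_nat.
  have z0 : 0 < k.+1%:R ^+ 2 :> R by rewrite exprn_gt0.
  by rewrite normrM ger0_norm ?invr_ge0 ?(ltW z0)// ler_pdivrMl// mulrC.
have Qlo := ll lo (leq_trans mlo (ltnW nk)) Ylo.
have Qhi := ll hi (ltnW hik) Yhi.
have q1 := @Q_homo lo n w lon; have q2 := @Q_homo n hi w nhi.
have i1 := inc lo n; rewrite leqnn lon in i1; have {}i1 := i1 isT.
have i2 := inc n hi; rewrite lon nhi in i2; have {}i2 := i2 isT.
have K1 : 1 <= k%:R :> R by rewrite ler1n.
have r1 : k%:R ^+ 2 <= (mn lo)%:R :> R by rewrite -natrX ler_nat.
have r2 : (mn lo)%:R <= (mn n)%:R :> R by rewrite ler_nat.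
have r3 : (mn n)%:R <= (mn hi)%:R :> R by rewrite ler_nat.
have r4 : (mn hi)%:R <= k.+1%:R ^+ 2 :> R by rewrite -natrX ler_nat ltnW.
have kS : k.+1%:R = k%:R + 1 :> R by rewrite -natr1.
rewrite kS in Qlo Qhi r4.
move: i1 i2 Qlo Qhi q1 q2 kC r1 r2 r3 r4 K1.
rewrite -/lo -/hi.
move: (Q lo w) (Q hi w) (Q n w) (e lo) (e hi) (e n) (mn lo)%:R (mn hi)%:R (mn n)%:R (k%:R : R).
clear -C0 eta0 => Ql Qh Qn el eh en ml mh mm x i1 i2 Qlo Qhi q1 q2 kC r1 r2 r3 r4 K1.
have c1 : C * (mm - ml) <= eta * x ^+ 2.
  by apply: le_trans kC; apply: ler_wpM2l => //; nra.
have c2 : C * (mh - mm) <= eta * x ^+ 2.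
  by apply: le_trans kC; apply: ler_wpM2l => //; nra.
have s1 : eta * (x + 1) ^+ 2 <= 4 * (eta * mm).
  by rewrite [leRHS]mulrCA; apply: ler_wpM2l; [exact: ltW|nra].
have s2 : eta * x ^+ 2 <= eta * mm by rewrite ler_pM2l//; lra.
have s3 : eta * mh <= eta * (x + 1) ^+ 2 by rewrite ler_pM2l.
rewrite -mulrA; move: (eta * (x + 1) ^+ 2) (eta * x ^+ 2) (eta * mm) (eta * mh) (C * (mm - ml)) (C * (mh - mm)) i1 i2 Qlo Qhi c1 c2 s1 s2 s3.
move=> a1 a2 a3 a4 a5 a6.
rewrite !ler_norml => /andP[? ?] /andP[? ?] /andP[? ?] /andP[? ?] *.
by apply/andP; split; lra.
Qed.

Lemma nested_law_of_large_numbers :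
  {ae P, forall w, (Q n w - e n) / (mn n)%:R @[n --> \oo] --> (0 : R)}.
Proof.
have := Y_cvg lev; apply: filterS2 (Y_cvg (fun k => (lev k.+1).-1)) => w hhi hlo.
apply/cvgrPdist_le => eps eps0; pose eta := eps / 9.
have eta0 : 0 < eta by rewrite divr_gt0.
have [N hN] := e_incr eta0.
have [K1 _ hK1] : \forall k \near \oo, `|Y lev k w| <= eta.
  by move/cvgrPdist_le: hlo => /(_ _ eta0); apply: filterS => k; rewrite sub0r normrN.
have [K2 _ hK2] : \forall k \near \oo, `|Y (fun k => (lev k.+1).-1) k w| <= eta.
  by move/cvgrPdist_le: hhi => /(_ _ eta0); apply: filterS => k; rewrite sub0r normrN.
(* For k >= K3 one has C (2k+1) <= 3 C k <= eta k^2. The entry [(mn N).+1] of K ensures that [lev k]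
   is at least N, where [e_incr] applies. *)
pose K3 := (Num.truncn (3 * C / eta)).+1.
pose K := maxn (maxn K1 K2) (maxn K3 (mn N).+1).
have [n0 hn0] := mn_unbounded (K ^ 2).
exists n0 => // n /= n0n.
have Kn : (K ^ 2 <= mn n)%N by apply: leq_trans hn0 (mn_homo n0n).
have mn0 : (0 < mn n)%N.
  apply: leq_trans Kn; rewrite expn_gt0; apply/orP; left.
  by rewrite /K !leq_max ltn0Sn !orbT.
have [k k1 k2] : exists2 k, (k ^ 2 <= mn n)%N & (mn n < k.+1 ^ 2)%N.
  have ex : exists k, (k ^ 2 <= mn n)%N by exists 0%N.
  have ub i : (i ^ 2 <= mn n)%N -> (i <= mn n)%N.
    by apply: leq_trans; rewrite -mulnn; case: i => // i; rewrite leq_pmull.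
  have [k k1 kmax] := ex_maxnP ex ub; exists k => //.
  by rewrite ltnNge; apply/negP => /kmax; rewrite ltnn.
have Kk : (K <= k)%N.
  rewrite leqNgt; apply/negP => kK.
  have : (k.+1 ^ 2 <= K ^ 2)%N by rewrite leq_exp2r.
  by move=> h; have := leq_trans k2 (leq_trans h Kn); rewrite ltnn.
have /and4P[k1' k2' k3' k4'] : [&& K1 <= k, K2 <= k, K3 <= k & mn N < k]%N.
  by move: Kk; rewrite /K !geq_max => /andP[/andP[-> ->] /andP[-> ->]].
rewrite sub0r normrN normrM normfV (ger0_norm (ler0n _ _)).
rewrite ler_pdivrMr ?ltr0n//.
have -> : eps = 9 * eta by rewrite /eta; field.
apply: (@squeeze_step k) => //.
- exact: leq_ltn_trans k4'.
- by rewrite k1 k2.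
- have kpos : 1 <= k%:R :> R by rewrite ler1n; exact: leq_ltn_trans k4'.
  have : 3 * C / eta < k%:R.
    apply: (@lt_le_trans _ _ K3%:R); last by rewrite ler_nat.
    by rewrite /K3 truncnS_gt.
  rewrite ltr_pdivrMr// mulrC; move: (k%:R : R) kpos => x x1 h.
  apply: (@le_trans _ _ (3 * C * x)); last by rewrite expr2 mulrA ler_wpM2r//; lra.
  by rewrite (mulrC 3) -mulrA; apply: ler_wpM2l => //; lra.
- exact: hK1.
- exact: hK2.
- move=> p q /andP[lp pq]; apply: hN; rewrite pq andbT.
  apply: leq_trans lp; rewrite leqNgt; apply/negP => /ltnW/mn_homo h.
  have := leq_trans (levP k) h.
  by rewrite leqNgt => /negP; apply; apply: leq_trans k4' _; rewrite -mulnn leq_pmull//; lia.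
Qed.

End NestedLaw.
End AlmostSure.

Section DoubleSum.
Context {R : realType} {G : choiceType}.
Implicit Types (A B : {fset G}) (g b : G -> G -> R).

Lemma sum_fsetD A B (u : G -> R) : (A `<=` B)%fset ->
  \sum_(i <- B) u i = \sum_(i <- A) u i + \sum_(i <- (B `\` A)%fset) u i.
Proof.
move=> AB; rewrite (big_fsetID _ (mem A))/=; congr (_ + _).
  apply: eq_fbigl => i; rewrite !inE/=; apply: andb_idl; exact: (fsubsetP AB).
by apply: eq_fbigl => i; rewrite !inE/= andbC.
Qed.

Lemma double_sum_le A B g : (A `<=` B)%fset -> (forall i j, 0 <= g i j) ->
  \sum_(i <- A) \sum_(j <- A) g i j <= \sum_(i <- B) \sum_(j <- B) g i j.
Proof.
move=> AB g0; apply: (@le_trans _ _ (\sum_(i <- A) \sum_(j <- B) g i j)).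
  by apply: ler_sum => i _; exact: sum_fset_le.
by apply: sum_fset_le => // i; exact: sumr_ge0.
Qed.

(** Only the pairs with an index in B minus A change, and each such row or column has sum at most
    D. *)
Lemma double_sum_incr A B g b (D : R) : (A `<=` B)%fset ->
  (forall i j, `|g i j| <= b i j) -> (forall i j, b i j = b j i) ->
  (forall i (F : {fset G}), \sum_(j <- F) b i j <= D) ->
  `|\sum_(i <- B) \sum_(j <- B) g i j - \sum_(i <- A) \sum_(j <- A) g i j| <=
  2 * D * ((#|` B|)%:R - (#|` A|)%:R).
Proof.
move=> AB gb bs bD; pose H := (B `\` A)%fset.
have cH : (#|` H|)%:R = (#|` B|)%:R - (#|` A|)%:R :> R.
  by rewrite cardfsDS// natrB//; exact: fsubset_leq_card.
have row (F : {fset G}) : \sum_(i <- H) \sum_(j <- F) b i j <= (#|` H|)%:R * D.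
  by rewrite -sum_const_fset; apply: ler_sum.
rewrite (sum_fsetD _ AB) -/H.
have -> : \sum_(i <- A) \sum_(j <- B) g i j =
   \sum_(i <- A) \sum_(j <- A) g i j + \sum_(i <- A) \sum_(j <- H) g i j.
  by rewrite -big_split; apply: eq_bigr => i _; rewrite /= (sum_fsetD _ AB).
have e (x y z : R) : x + y + z - x = y + z by ring.
rewrite e -cH {e}.
have -> : 2 * D * (#|` H|)%:R = (#|` H|)%:R * D + (#|` H|)%:R * D by ring.
apply: le_trans (ler_normD _ _) _; apply: lerD.
  rewrite exchange_big/=; apply: le_trans (row A).
  apply: le_trans (ler_norm_sum _ _ _) _; apply: ler_sum => j _.
  apply: le_trans (ler_norm_sum _ _ _) _; apply: ler_sum => i _.
  by rewrite bs.
apply: le_trans (row B).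
apply: le_trans (ler_norm_sum _ _ _) _; apply: ler_sum => i _.
by apply: le_trans (ler_norm_sum _ _ _) _; apply: ler_sum => j _.
Qed.

(** Schur's test on a finite set; [D ^+ 2] is then an admissible [kappa] in [quad_variance]. *)
Lemma row_sum_operator A g (D : R) (v : G -> R) : (forall i j, g i j = g j i) ->
  (forall i, i \in A -> \sum_(j <- A) `|g i j| <= D) -> 0 <= D ->
  \sum_(i <- A) (\sum_(j <- A) g i j * v j) ^+ 2 <= D ^+ 2 * \sum_(i <- A) v i ^+ 2.
Proof.
move=> gs gD D0.
apply: (@le_trans _ _ (\sum_(i <- A) D * \sum_(j <- A) `|g i j| * v j ^+ 2)).
  rewrite big_seq [leRHS]big_seq; apply: ler_sum => i iA.
  apply: le_trans (weighted_sum_sqr _ _ _) _; apply: ler_wpM2r; last exact: gD.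
  by apply: sumr_ge0 => j _; rewrite mulr_ge0// sqr_ge0.
rewrite -mulr_sumr expr2 -mulrA ler_wpM2l// exchange_big/= mulr_sumr.
rewrite big_seq [leRHS]big_seq; apply: ler_sum => j jA.
rewrite -mulr_suml; apply: ler_wpM2r; first exact: sqr_ge0.
by apply: le_trans (gD j jA); apply: ler_sum => i _; rewrite gs.
Qed.

End DoubleSum.

Lemma cvg0_combine {R : realType} (t u v z : nat -> R) :
  (forall n, t n = u n - v n + z n) -> u @ \oo --> 0 -> v @ \oo --> 0 ->
  z @ \oo --> 0 -> t @ \oo --> 0.
Proof.
move=> /funext-> hu hv hz; rewrite [X in _ --> X](_ : _ = 0 - 0 + 0).
  exact: cvgD (cvgB hu hv) hz.
by rewrite subrr addr0.
Qed.

(** * Laws of large numbers for the plug-in and inverse quadratic forms *)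

Section QuadraticLaw.
Context {R : realType} {G : countType} (W : G -> G -> R).
Context (E : set R -> (G -> R) -> (G -> R)).
Hypotheses (hW : is_graph W) (hE : spectral_resolution W E).
Context d {Omega : measurableType d} (P : probability Omega R).
Variables (X : G -> {RV P >-> R}) (Gn : nat -> {fset G}) (f0 : R -> R) (C0 : R).
Hypotheses (hf0 : wiener (Sp W) C0 f0)
  (hX : centered_gaussian_process X (Kop W E f0))
  (Gn_sub : forall p q, (p <= q)%N -> (Gn p `<=` Gn q)%fset)
  (Gn_unbounded : forall K, exists n, (K <= #|` Gn n|)%N)
  (Gn_boundary : forall eta : R, 0 < eta -> exists N, forall n, (N <= n)%N ->
     (boundary_size W (Gn n))%:R <= eta * (#|` Gn n|)%:R).

Local Notation K := (Kop W E).
Local Notation m := (fun n => #|` Gn n|).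
Local Notation wien := (wiener (Sp W)).

Let D1 x : Sp W x -> `|x| <= 1. Proof. exact: Sp_le1. Qed.

Let C00 : 0 <= C0. Proof. exact: wiener_ge0 hf0. Qed.

Let Ks i j : K f0 i j = K f0 j i.
Proof. exact: (Kop_sym hE _ _ (wiener_bounded_meas hW hf0)). Qed.

Let K_le i j : `|K f0 i j| <= C0. Proof. exact: Kop_bound. Qed.

Let Ksig (A : {fset G}) k : \sum_(i <- A) K f0 i k ^+ 2 <= C0 ^+ 2.
Proof.
apply: (@le_trans _ _ (\sum_(i <- A) C0 * `|K f0 i k|)).
  by apply: ler_sum => i _; rewrite -real_normK ?num_real// expr2 ler_wpM2r.
by rewrite -mulr_sumr expr2 ler_wpM2l//; exact: (Kop_col hW hE k A hf0).
Qed.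

Let m_homo : {homo m : p q / (p <= q)%N}.
Proof. by move=> p q pq; apply: fsubset_leq_card; exact: Gn_sub. Qed.

Lemma boundary_ratio (e l : nat -> R) (D : R) :
  (forall n, `|e n - l n| <= D * (boundary_size W (Gn n))%:R) ->
  (e n - l n) / (m n)%:R @[n --> \oo] --> (0 : R).
Proof.
move=> el; apply/cvgrPdist_le => eps eps0.
have D0 : 0 < `|D| + 1 by rewrite ltr_wpDl.
have [|N hN] := Gn_boundary (eta := eps / (`|D| + 1)); first by rewrite divr_gt0.
exists N => // n /= Nn; rewrite sub0r normrN normrM normfV (ger0_norm (ler0n _ _)).
have [->|m0] := eqVneq (m n) 0%N; first by rewrite invr0 mulr0 ltW.
rewrite ler_pdivrMr ?ltr0n ?lt0n//.
apply: le_trans (el n) _; have := hN n Nn.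
move: (boundary_size _ _)%:R (ler0n R (boundary_size W (Gn n))) => b b0 h.
apply: (@le_trans _ _ ((`|D| + 1) * b)).
  by apply: ler_wpM2r => //; have := ler_norm D; lra.
rewrite -ler_pdivlMl// mulrA (mulrC _ eps); exact: h.
Qed.

Section DominatedForm.
Variables (a b : G -> G -> R) (D : R).
Hypotheses (as_ : forall i j, a i j = a j i) (bs : forall i j, b i j = b j i)
  (ab : forall i j, `|a i j| <= b i j) (bD : forall i (F : {fset G}), \sum_(j <- F) b i j <= D).

(* The kernel of the form with general term
   a i j x_i x_j + b i j (x_i ^ 2 + x_j ^ 2) / 2, a sum of nonnegative terms,
   hence a form that increases with the index set. *)
Definition dominated_kernel (A : {fset G}) (i j : G) : R :=
  a i j + (i == j)%:R * \sum_(l <- A) b i l.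

Let b0 i j : 0 <= b i j. Proof. exact: le_trans (normr_ge0 _) (ab i j). Qed.

Let D0 : 0 <= D.
Proof.
have [k] := Gn_unbounded 1; rewrite cardfs_gt0 => /fset0Pn[i _].
by have := bD i fset0; rewrite big_seq_fset0.
Qed.

(** Used with x i j = X_i X_j for the form and with x = K(f0) for its mean; the symmetry of [b]
    spreads the diagonal correction evenly over both indices. *)
Let formE (x : G -> G -> R) (A : {fset G}) : (forall i j, x i j = x j i) ->
  \sum_(i <- A) \sum_(j <- A) x i j * dominated_kernel A i j =
  \sum_(i <- A) \sum_(j <- A) (x i j * a i j + b i j * (2^-1 * (x i i + x j j))).
Proof.
move=> xs; rewrite /dominated_kernel.
have h1 : \sum_(i <- A) \sum_(j <- A) x i j * ((i == j)%:R * \sum_(l <- A) b i l) =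
   \sum_(i <- A) \sum_(j <- A) x i i * b i j.
  rewrite big_seq [RHS]big_seq; apply: eq_bigr => i iA.
  rewrite -mulr_sumr; under eq_bigr do rewrite mulrCA.
  by rewrite sum_indic iA.
have h2 : \sum_(i <- A) \sum_(j <- A) x i i * b i j =
   \sum_(i <- A) \sum_(j <- A) b i j * (2^-1 * (x i i + x j j)).
  have h3 : \sum_(i <- A) \sum_(j <- A) x i i * b i j =
      \sum_(i <- A) \sum_(j <- A) x j j * b i j.
    by rewrite exchange_big/=; apply: eq_bigr => i _; apply: eq_bigr => j _; rewrite bs.
  transitivity (2^-1 * (\sum_(i <- A) \sum_(j <- A) x i i * b i j +
     \sum_(i <- A) \sum_(j <- A) x j j * b i j)); first by rewrite -h3; field.
  rewrite -big_split mulr_sumr; apply: eq_bigr => i _; rewrite /= -big_split mulr_sumr.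
  by apply: eq_bigr => j _; rewrite /=; ring.
under eq_bigr do under eq_bigr do rewrite mulrDr.
under eq_bigr do rewrite big_split/=.
rewrite big_split/= h1 h2 -big_split; apply: eq_bigr => i _.
by rewrite /= -big_split.
Qed.

(** The kernel has row sums at most 2D, hence the variance constant, the first summand of [C]. The
    second summand bounds the increments of the mean per added vertex. *)
Lemma dominated_form_law : {ae P, forall w,
  (quad X (dominated_kernel (Gn n)) (Gn n) w -
   quad_mean (K f0) (dominated_kernel (Gn n)) (Gn n)) / (m n)%:R
  @[n --> \oo] --> (0 : R)}.
Proof.
pose C := 2 * (2 * D) ^+ 2 * C0 ^+ 2 + 2 * (2 * C0 * D).
have C1 : 0 <= 2 * (2 * D) ^+ 2 * C0 ^+ 2 by rewrite !mulr_ge0 ?sqr_ge0.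
have C2 : 0 <= 2 * (2 * C0 * D) by rewrite !mulr_ge0.
apply: (@nested_law_of_large_numbers _ _ _ _ m _ _ C) => //.
- exact: addr_ge0.
- move=> p q w pq; rewrite /quad !formE; try by move=> i j; rewrite mulrC.
  apply: double_sum_le; first exact: Gn_sub.
  move=> i j; move: (X i w) (X j w) => x y.
  have := ab i j; rewrite ler_norml => /andP[h1 h2].
  have := sqr_ge0 (x - y); have := sqr_ge0 (x + y); nra.
- move=> n; have [||||V hV VC] := @quad_variance _ _ _ _ _ _ _ hX Ks
     (dominated_kernel (Gn n)) (Gn n) ((2 * D) ^+ 2) (C0 ^+ 2).
  + by move=> i j; rewrite /dominated_kernel as_ eq_sym; case: eqP => [->//|_]; rewrite !mul0r.
  + move=> v; apply: row_sum_operator; last by rewrite mulr_ge0.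
      by move=> i j; rewrite /dominated_kernel as_ eq_sym; case: eqP => [->//|_]; rewrite !mul0r.
    move=> i iA; rewrite mulrDl mul1r.
    apply: (@le_trans _ _ (\sum_(j <- Gn n) (b i j + (i == j)%:R * \sum_(l <- Gn n) b i l))).
      apply: ler_sum => j _; apply: le_trans (ler_normD _ _) _.
      rewrite lerD// ger0_norm// mulr_ge0// sumr_ge0//.
    by rewrite big_split/= sum_indic iA lerD.
  + by rewrite sqr_ge0.
  + by move=> k; exact: Ksig.
  by exists V => //; apply: le_trans VC _; rewrite ler_wpM2r// lerDl.
- move=> eta eta0; exists 0%N => p q /andP[_ pq].
  rewrite /quad_mean !formE//.
  pose g i j := K f0 i j * a i j + b i j * (2^-1 * (K f0 i i + K f0 j j)).
  apply: le_trans (@double_sum_incr _ _ _ _ g (fun i j => 2 * C0 * b i j) (2 * C0 * D) (Gn_sub pq) _ _ _) _.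
  + move=> i j; rewrite /g; apply: le_trans (ler_normD _ _) _.
    have h1 : `|K f0 i j * a i j| <= C0 * b i j.
      by rewrite normrM; apply: ler_pM.
    have h2 : `|2^-1 * (K f0 i i + K f0 j j)| <= C0.
      rewrite normrM ger0_norm// ler_pdivrMl//; apply: le_trans (ler_normD _ _) _.
      by rewrite mulrDl mul1r lerD.
    have h3 : `|b i j * (2^-1 * (K f0 i i + K f0 j j))| <= C0 * b i j.
      by rewrite normrM (ger0_norm (b0 i j)) mulrC ler_wpM2r.
    by apply: le_trans (lerD h1 h3) _; rewrite -mulrA [leRHS]mulrDl !mul1r.
  + by move=> i j; rewrite bs.
  + by move=> i F; rewrite -mulr_sumr ler_wpM2l// mulr_ge0.
  have pqR : 0 <= (m q)%:R - (m p)%:R :> R by rewrite subr_ge0 ler_nat m_homo.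
  have := mulr_ge0 C1 pqR; have := mulr_ge0 (ltW eta0) (ler0n R (m q)).
  by rewrite /C mulrDl; lra.
Qed.

End DominatedForm.

(** K(g) is the dominated kernel of K(g) minus that of 0, both with b = |K(g)|: the diagonal
    corrections cancel, and each piece obeys [dominated_form_law]. The mean Tr(K_n(f0) K_n(g)) is
    then replaced by Tr K_n(f0 g) at the cost of the boundary. *)
Lemma kernel_form_law (C : R) g : wien C g -> {ae P, forall w,
  (quad X (K g) (Gn n) w - \sum_(i <- Gn n) K (fun x => f0 x * g x) i i) / (m n)%:R
  @[n --> \oo] --> (0 : R)}.
Proof.
move=> hg.
have gs i j : K g i j = K g j i.
  exact: (Kop_sym hE _ _ (wiener_bounded_meas hW hg)).
have h1 := @dominated_form_law (K g) (fun i j => `|K g i j|) C gs.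
have h2 := @dominated_form_law (fun _ _ => 0) (fun i j => `|K g i j|) C (fun _ _ => erefl).
have bs i j : `|K g i j| = `|K g j i| by rewrite gs.
have bC i (F : {fset G}) : \sum_(j <- F) `|K g i j| <= C by exact: Kop_row.
have {}h1 := h1 bs (fun _ _ => lexx _) bC.
have {}h2 := h2 bs (fun _ _ => eq_ind_r (fun z => z <= _) (normr_ge0 _) (normr0 R)) bC.
apply: filterS2 h1 h2 => w h1 h2.
have h3 : (quad_mean (K f0) (K g) (Gn n) - \sum_(i <- Gn n) K (fun x => f0 x * g x) i i)
    / (m n)%:R @[n --> \oo] --> (0 : R).
  apply: (@boundary_ratio _ _ (C0 * C)) => n.
  rewrite /quad_mean -sumrB; apply: le_trans (prod_err_sum hW hE (Gn n) hf0 hg).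
  apply: le_trans (ler_norm_sum _ _ _) _.
  rewrite big_seq [leRHS]big_seq; apply: ler_sum => i iA.
  rewrite [X in `|X|](_ : _ = prod_err W E (Gn n) f0 g i i).
    by rewrite [leRHS](big_fsetD1 i)//= lerDl sumr_ge0.
  by congr (_ - _); apply: eq_bigr => j _; rewrite gs.
apply: (cvg0_combine _ h1 h2 h3) => n.
rewrite -mulrBl -mulrDl; congr (_ / _).
have q1 : quad X (dominated_kernel (K g) (fun i j => `|K g i j|) (Gn n)) (Gn n) w -
    quad X (dominated_kernel (fun _ _ => 0) (fun i j => `|K g i j|) (Gn n)) (Gn n) w =
    quad X (K g) (Gn n) w.
  rewrite /quad -sumrB; apply: eq_bigr => i _; rewrite -sumrB; apply: eq_bigr => j _.
  by rewrite /dominated_kernel; ring.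
have q2 : quad_mean (K f0) (dominated_kernel (K g) (fun i j => `|K g i j|) (Gn n)) (Gn n) -
    quad_mean (K f0) (dominated_kernel (fun _ _ => 0) (fun i j => `|K g i j|) (Gn n)) (Gn n) =
    quad_mean (K f0) (K g) (Gn n).
  rewrite /quad_mean -sumrB; apply: eq_bigr => i _; rewrite -sumrB; apply: eq_bigr => j _.
  by rewrite /dominated_kernel; ring.
by rewrite -q1 -q2; ring.
Qed.

Section InverseForm.
Variables (h : R -> R) (r : R).
Hypothesis hh : wien r h.

Local Notation F := (K (expf h 1)).
Local Notation g := (fun x => f0 x * expf h (-1) x).

Let one1 : `|1 : R| <= 1. Proof. by rewrite normr1. Qed.
Let oneN1 : `|-1 : R| <= 1. Proof. by rewrite normrN1. Qed.

Let hg : wien (C0 * cexp r) g.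
Proof. by apply: wienerM => //; exact: wiener_expf hW _ _ hh _ oneN1. Qed.

Let Fc A : coercive F A (expR (- r)).
Proof. exact: expf_coercive. Qed.

(** Since f0 = e^h g, K_A(f0) is K_A(e^h) K_A(g) minus the product error. Multiplying by the inverse
    leaves Tr K_A(g) and the trace of the inverse against the error, bounded by
    [inv_kernel_err_sum]. *)
Lemma inverse_form_mean A :
  `|quad_mean (K f0) (inv_kernel F A) A - \sum_(i <- A) K g i i| <=
  expR r * (cexp r * (C0 * cexp r)) * (boundary_size W A)%:R.
Proof.
have err := prod_err_sum hW hE A (wiener_expf hW hh one1) hg.
rewrite -[leRHS]mulrA; apply: le_trans (ler_wpM2l (expR_ge0 r) err).
apply: le_trans (inv_kernel_err_sum hW hE hh _ _ one1).
rewrite -normrN opprB le_eqVlt; apply/orP; left; apply/eqP; congr `|_|.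
have f0E i j : K f0 i j = K (fun x => expf h 1 x * g x) i j.
  apply: eq_Kop => x _; rewrite mulrCA /expf -expRD.
  by rewrite mul1r mulN1r subrr expR0 mulr1.
rewrite /quad_mean exchange_big/= -sumrB big_seq [RHS]big_seq.
apply: eq_bigr => j jA; rewrite /prod_err.
under [RHS]eq_bigr do rewrite mulrBr mulr_sumr.
rewrite sumrB; congr (_ - _).
  rewrite exchange_big/=.
  under eq_bigr do under eq_bigr do rewrite mulrA.
  under eq_bigr do rewrite -mulr_suml.
  rewrite [RHS](_ : _ = \sum_(p <- A) (j == p)%:R * K g p j); last first.
    by rewrite big_seq [RHS]big_seq; apply: eq_bigr => p pA; rewrite (inv_kernel_left hW hE hh).
  by rewrite sum_indic jA.
apply: eq_bigr => i _; rewrite f0E mulrC (inv_kernel_sym _ _ _ (Fc A).1).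
by [].
Qed.

Lemma inverse_form_law : {ae P, forall w,
  (quad X (inv_kernel F (Gn n)) (Gn n) w - \sum_(i <- Gn n) K g i i) / (m n)%:R
  @[n --> \oo] --> (0 : R)}.
Proof.
pose e n := quad_mean (K f0) (inv_kernel F (Gn n)) (Gn n).
pose L := expR r * (cexp r * (C0 * cexp r)).
have cexp0 : 0 <= cexp r by rewrite addr_ge0// expR_ge0.
have L0 : 0 <= L by rewrite !mulr_ge0 ?expR_ge0.
pose C := 2 * (expR (- r) ^+ 2)^-1 * C0 ^+ 2 + C0 * cexp r.
have C1 : 0 <= 2 * (expR (- r) ^+ 2)^-1 * C0 ^+ 2 by rewrite !mulr_ge0 ?invr_ge0 ?sqr_ge0.
have C2 : 0 <= C0 * cexp r by rewrite mulr_ge0.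
have main : {ae P, forall w, (quad X (inv_kernel F (Gn n)) (Gn n) w - e n) / (m n)%:R
    @[n --> \oo] --> (0 : R)}.
  apply: (@nested_law_of_large_numbers _ _ _ _ m _ _ C) => //.
  - exact: addr_ge0.
  - move=> p q w pq; rewrite /quad.
    have AB := Gn_sub pq; have cp := Fc (Gn p); have cq := Fc (Gn q).
    pose y := solve F (Gn p) (fun i => X i w).
    (* The maximizer for the smaller set, extended by 0, is a competitor for the larger one, whence
       the monotonicity. *)
    pose z i := if i \in Gn p then y i else 0.
    rewrite -(inv_quad_solve (expR_gt0 _) cp).
    apply: le_trans (inv_quad_ge (expR_gt0 _) cq _ z).
    have z1 (u : G -> R) : \sum_(i <- Gn q) u i * z i = \sum_(i <- Gn p) u i * y i.
      rewrite (@sum_fset_sub _ _ (Gn p))//; last by move=> i /negbTE; rewrite /z => ->; rewrite mulr0.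
      by rewrite big_seq [RHS]big_seq; apply: eq_bigr => i iA; rewrite /z iA.
    rewrite z1 lerD2l lerN2 le_eqVlt; apply/orP; left; apply/eqP.
    transitivity (\sum_(i <- Gn q) (\sum_(j <- Gn p) F i j * y j) * z i).
      apply: eq_bigr => i _; rewrite -(z1 (F i)) mulr_suml; apply: eq_bigr => j _; ring.
    rewrite (z1 (fun i => \sum_(j <- Gn p) F i j * y j)).
    by apply: eq_bigr => i _; rewrite mulr_suml; apply: eq_bigr => j _; rewrite /y; ring.
  - move=> n; have [||||V hV VC] := @quad_variance _ _ _ _ _ _ _ hX Ks
       (inv_kernel F (Gn n)) (Gn n) ((expR (- r) ^+ 2)^-1) (C0 ^+ 2).
    + by move=> i j; apply: inv_kernel_sym; exact: (Fc (Gn n)).1.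
    + by move=> v; exact: solve_norm (expR_gt0 _) (Fc (Gn n)) v.
    + by rewrite invr_ge0 sqr_ge0.
    + by move=> k; exact: Ksig.
    by exists V => //; apply: le_trans VC _; rewrite ler_wpM2r// lerDl.
  (* The mean is within L delta_n of a trace whose increments are at most C0 [cexp r] per vertex.
     The boundary errors at p and at q add up to 2 L eta' m_q <= eta m_q; they are the reason for
     the eta term in [e_incr]. *)
  - move=> eta eta0; pose eta' := eta / (2 * L + 1).
    have L1 : 0 < 2 * L + 1 by lra.
    have eta'0 : 0 < eta' by rewrite divr_gt0.
    have [N hN] := Gn_boundary eta'0; exists N => p q /andP[Np pq].
    have hp := hN p Np; have hq := hN q (leq_trans Np pq).
    have mp := inverse_form_mean (Gn p); have mq := inverse_form_mean (Gn q).
    have tr : `|\sum_(i <- Gn q) K g i i - \sum_(i <- Gn p) K g i i| <=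
        C0 * cexp r * ((m q)%:R - (m p)%:R).
      rewrite (sum_fsetD _ (Gn_sub pq)) addrC addKr.
      rewrite -natrB ?m_homo// -cardfsDS ?Gn_sub// mulrC -sum_const_fset.
      apply: le_trans (ler_norm_sum _ _ _) _; apply: ler_sum => i _.
      exact: Kop_bound.
    have pqR : (m p)%:R <= (m q)%:R :> R by rewrite ler_nat m_homo.
    rewrite -/L in mp mq; rewrite -/(e p) -/(e q) in mp mq *.
    have l1 : L * (boundary_size W (Gn p))%:R <= L * (eta' * (m q)%:R).
      by apply: ler_wpM2l => //; apply: le_trans hp _; rewrite ler_pM2l.
    have l2 : L * (boundary_size W (Gn q))%:R <= L * (eta' * (m q)%:R).
      exact: ler_wpM2l.
    have l3 : 2 * (L * (eta' * (m q)%:R)) <= eta * (m q)%:R.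
      have z2 (z x : R) : 0 <= z -> 0 <= x ->
          2 * (z * (eta / (2 * z + 1) * x)) <= eta * x.
        move=> z0 x0; have z1 : 0 < 2 * z + 1 by lra.
        rewrite (_ : 2 * _ = 2 * z * (eta / (2 * z + 1)) * x); last by ring.
        rewrite ler_wpM2r// mulrA ler_pdivrMr// mulrDr mulr1 (mulrC eta).
        by rewrite lerDl ltW.
      exact: z2.
    have l4 : 0 <= 2 * (expR (- r) ^+ 2)^-1 * C0 ^+ 2 * ((m q)%:R - (m p)%:R).
      by rewrite mulr_ge0// subr_ge0.
    have l5 : C * ((m q)%:R - (m p)%:R) = 2 * (expR (- r) ^+ 2)^-1 * C0 ^+ 2 * ((m q)%:R - (m p)%:R) + C0 * cexp r * ((m q)%:R - (m p)%:R) by rewrite -mulrDl.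
    rewrite l5; move: mp mq tr l1 l2 l3 l4; rewrite !ler_norml => /andP[? ?] /andP[? ?] /andP[? ?] *; apply/andP; split; lra.
apply: filterS main => w hw.
have h3 := @boundary_ratio e (fun n => \sum_(i <- Gn n) K g i i) L (fun n => inverse_form_mean (Gn n)).
apply: (cvg0_combine _ hw (cvg_cst 0) h3) => n.
by rewrite subr0 -mulrDl addrA subrK.
Qed.

End InverseForm.
End QuadraticLaw.

(** * Normalized traces *)

Section AverageSpectralMeasure.
Context {R : realType} {G : countType} (W : G -> G -> R).
Context (E : set R -> (G -> R) -> (G -> R)).
Hypotheses (hW : is_graph W) (hE : spectral_resolution W E).
Implicit Types (g : R -> R) (A : {fset G}).

Local Notation K := (Kop W E).
Local Notation bmeas := (@bounded_meas R G W).
Local Notation wien := (wiener (Sp W)).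

Let D1 x : Sp W x -> `|x| <= 1. Proof. exact: Sp_le1. Qed.

Let mSp : measurable (Sp W). Proof. exact: Sp_measurable. Qed.

Lemma integral_spectral_measure i g : measurable_fun setT g ->
  (forall x, 0 <= g x) -> bmeas g ->
  (\int[spectral_measure hE (dvec_l2 i)]_x (g x)%:E = (K g i i)%:E)%E.
Proof.
move=> mg g0 bg.
rewrite (ge0_negligible_integral (N := ~` Sp W))//.
- rewrite setTD setCK (Kop_diag hW hE)// (JintE hE (dvec_l2 i)) /Rintegral fineK//.
  by have := integrable_fin_num mSp (bounded_meas_integrable hW hE (dvec_l2 i) bg).
- exact: measurableC.
- exact/measurable_EFinP.
- by move=> x _; rewrite lee_fin.
- by rewrite -(spectral_measureI_Sp hW); [rewrite setICl measure0|exact: measurableC].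
Qed.

(** [avg_mu] is a bare set function; induction on the vertices builds a true measure that agrees
    with the unnormalized sum on Borel sets. *)
Lemma integral_avg_mu A g : measurable_fun setT g ->
  (forall x, 0 <= g x) -> bmeas g ->
  (\int[avg_mu E A]_x (g x)%:E =
   (#|` A|%:R^-1 * \sum_(i <- A) K g i i)%:E)%E.
Proof.
move=> mg g0 bg.
have mgE : measurable_fun setT (EFin \o g) by exact/measurable_EFinP.
have main (s : seq G) : exists m : {measure set R -> \bar R},
    (forall B, measurable B -> (\sum_(i <- s) Defs.mu E i i B)%:E = m B) /\
    (\int[m]_x (g x)%:E = (\sum_(i <- s) K g i i)%:E)%E.
  elim: s => [|i s [m [mE mI]]].
    exists mzero; split=> [B mB|]; first by rewrite big_nil.
    by rewrite big_nil integral_measure_zero.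
  exists (measure_add (spectral_measure hE (dvec_l2 i)) m); split=> [B mB|].
    rewrite big_cons EFinD mE// [RHS]measure_addE spectral_measureE//.
    by rewrite /Defs.mu asboolT.
  rewrite ge0_integral_measure_add//; last by move=> x _; rewrite lee_fin.
  by rewrite mI integral_spectral_measure// big_cons EFinD.
have [m [mE mI]] := main A.
have c0 : 0 <= (#|` A|%:R : R)^-1 by rewrite invr_ge0.
rewrite (@eq_integral_measurable _ _ _ _ (mscale (NngNum c0) m)); last first.
  by move=> B mB; rewrite /mscale /= -mE// EFinM.
rewrite ge0_integral_mscale//; last by move=> x _; rewrite lee_fin.
by rewrite mI -EFinM.
Qed.

Variables (Gn : nat -> {fset G}) (nu : {measure set R -> \bar R}).
Hypotheses (Gn_pos : \forall n \near \oo, (0 < #|` Gn n|)%N)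
  (hnu : weak_cvg (fun n => avg_mu E (Gn n)) nu).

Let cont_meas g : continuous g -> measurable_fun setT g.
Proof. exact: continuous_measurable_fun. Qed.

Let avg g n := #|` Gn n|%:R^-1 * \sum_(i <- Gn n) K g i i.

Lemma avg_cvg_integral g (M : R) : continuous g -> (forall x, 0 <= g x <= M) ->
  ((avg g n)%:E @[n --> \oo] --> \int[nu]_x (g x)%:E)%E.
Proof.
move=> cg gM; have gM' x : `|g x| <= M.
  by have /andP[g0 g1] := gM x; rewrite ger0_norm.
have := hnu cg; move=> /(_ (ex_intro _ M gM')).
apply: cvg_trans; apply: near_eq_cvg; near=> n.
rewrite integral_avg_mu//; first exact: cont_meas.
  by move=> x; have /andP[] := gM x.
by split; [apply: measurable_funTS; exact: cont_meas|exists M => x _].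
Unshelve. all: by end_near. Qed.

Lemma limit_measure_mass : nu setT = 1%E.
Proof.
have h : ((avg (fun=> 1) n)%:E @[n --> \oo] --> \int[nu]_x (1 : R)%:E)%E.
  by apply: (@avg_cvg_integral (fun=> 1) 1); [move=> x; exact: cvg_cst|move=> x; rewrite ler01 lexx].
rewrite integral_cst// mul1e in h.
apply: cvg_unique h _ => //.
apply: cvg_near_cst; near=> n.
rewrite /avg; under eq_bigr do rewrite (Kop1 hW hE) eqxx.
rewrite sum_const_fset mulr1 mulVf// pnatr_eq0 -lt0n.
by near: n.
Unshelve. all: by end_near. Qed.

(** Test the weak convergence with a tent function on the ball: it vanishes on the spectrum, so all
    the averages are 0 and so is the limit integral. *)
Lemma limit_measure_ball (q r : R) : 0 < r -> (forall x, `|x - q| < r -> ~ Sp W x) ->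
  nu.-negligible [set x | `|x - q| < r].
Proof.
move=> r0 out; pose g (x : R) := Num.max 0 (r - `|x - q|).
have cg : continuous g.
  move=> x; apply: (@continuous_max _ _ (fun=> 0) (fun x => r - `|x - q|)).
    exact: cvg_cst.
  apply: cvgB; first exact: cvg_cst.
  by apply: cvg_norm; apply: cvgB; [exact: cvg_id|exact: cvg_cst].
have gb x : 0 <= g x <= r.
  by rewrite /g le_max lexx/= ge_max (ltW r0)/= gerBl.
have h0 : (\int[nu]_x (g x)%:E = 0)%E.
  apply: cvg_unique (avg_cvg_integral cg gb) _ => //.
  apply: cvg_near_cst; near=> n.
  rewrite /avg big1 ?mulr0// => i _.
  rewrite (@eq_Kop _ _ _ _ g (fun x => 0 * 1)).
    by rewrite (KopZ hW hE) ?mul0r//; exact: (bounded_meas_cst W 1).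
  move=> x Sx; rewrite mul0r /g max_l// subr_le0 leNgt; apply/negP => h.
  exact: out h Sx.
have : ae_eq nu setT (EFin \o g) (cst 0%E).
  apply/ae_eq_integral_abs => //.
    by apply/measurable_EFinP; exact: cont_meas.
  rewrite -[RHS]h0; apply: eq_integral => x _.
  by rewrite /= ger0_norm//; have /andP[] := gb x.
apply: negligibleS => x /= xq /(_ I) [] /eqP.
by rewrite /g eq_le ge_max lexx/= subr_le0 leNgt xq.
Unshelve. all: by end_near. Qed.

(** The complement of the spectrum is open, hence a countable union of balls with rational centers
    and radii 1/(k+1), each negligible. *)
Lemma limit_measure_Sp : nu (~` Sp W) = 0%E.
Proof.
pose U : set R := ~` Sp W.
have oU : open (U : set R^o) by apply: closed_openC; exact: Sp_closed.
pose ball_in (p : rat * nat) : set R := [set x | `|x - ratr p.1| < p.2.+1%:R^-1].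
pose F n : set R := if choice.unpickle n is Some p then
  (if `[< ball_in p `<=` U >] then ball_in p else set0) else set0.
have hF k : nu.-negligible (F k).
  rewrite /F; case: choice.unpickle => [p|]; last exact: negligible_set0.
  case: asboolP => [pU|_]; last exact: negligible_set0.
  by apply: limit_measure_ball => //; rewrite invr_gt0.
have UF : U `<=` \bigcup_k F k.
  move=> x Ux; move: oU; rewrite openE => /(_ _ Ux) /nbhs_ballP[e /= e0 he].
  have e2 : 0 < e / 2 by rewrite divr_gt0.
  have [k _ hk] : \forall k \near \oo, k.+1%:R^-1 < e / 2 :> R.
    by have /cvgr_lt := @cvg_harmonic R; apply.
  have k0 : 0 < k.+1%:R^-1 :> R by rewrite invr_gt0.
  have [q /andP[q1 q2]] : exists q : rat, x - k.+1%:R^-1 < ratr q < x.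
    have [|q] := @rat_in_itvoo R (x - k.+1%:R^-1) x; first by rewrite gtrBl.
    by rewrite in_itv/= => ?; exists q.
  have qU : ball_in (q, k) `<=` U.
    move=> y; rewrite /ball_in/= => yq; apply: he; rewrite /ball/=.
    rewrite -(subrKA (ratr q)) (splitr e); apply: le_lt_trans (ler_normD _ _) _.
    have kk := hk k (leqnn k); apply: ltrD; last by rewrite distrC (lt_trans yq).
    by apply: lt_trans kk; rewrite ger0_norm ?subr_ge0 ?ltW// ltrBlDl -ltrBlDr.
  have [n Fn] : exists n, F n = ball_in (q, k).
    by exists (choice.pickle (q, k)); rewrite /F choice.pickleK asboolT.
  exists n => //; rewrite Fn /ball_in/= ger0_norm ?subr_ge0 ?ltW//.
  by rewrite ltrBlDl -ltrBlDr.
apply: measure_negligible; first exact: measurableC.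
exact: negligibleS UF (negligible_bigcup hF).
Qed.

Lemma limit_measure_of_Sp : nu (Sp W) = 1%E.
Proof.
have h := measureU nu mSp (measurableC mSp) (setICr _).
rewrite -limit_measure_mass; transitivity (nu (Sp W) + nu (~` Sp W))%E.
  by rewrite limit_measure_Sp adde0.
by rewrite -h; congr (nu _); exact: setUv.
Qed.

Lemma limit_integrable g : bmeas g -> nu.-integrable (Sp W) (EFin \o g).
Proof.
move=> [mg [M gM]]; apply: measurable_bounded_integrable => //.
  by rewrite limit_measure_of_Sp ltry.
exists M; split; first exact: num_real.
by move=> x Mx y Sy; apply: le_trans (ltW Mx); exact: gM.
Qed.

Local Notation I := (fun g => \int[nu]_(x in Sp W) g x).

Lemma limit_dist f g (e : R) : bmeas f -> bmeas g ->
  (forall x, Sp W x -> `|f x - g x| <= e) -> `|I f - I g| <= e.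
Proof.
move=> bf bg fg.
have bfg : bmeas (fun x => f x + -1 * g x).
  by apply: bounded_measD => //; apply: bounded_measM => //; exact: bounded_meas_cst.
have E1 : I f - I g = I (fun x => f x - g x).
  by rewrite -RintegralB//; exact: limit_integrable.
rewrite E1; have i1 : nu.-integrable (Sp W) (EFin \o (fun x => f x - g x)).
  have := limit_integrable bfg; rewrite (_ : (fun x => f x + -1 * g x) = fun x => f x - g x)//.
  by apply/funext => x; rewrite mulN1r.
apply: le_trans (le_normr_Rintegral mSp i1) _.
apply: le_trans (le_Rintegral mSp _ (limit_integrable (bounded_meas_cst W e)) fg) _.
  exact: integrable_norm i1.
by rewrite Rintegral_cst// limit_measure_of_Sp mulr1.
Qed.

(** Polynomials are unbounded on the line while weak convergence tests bounded functions; composing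
    with this retraction onto [-1, 1] changes nothing on the spectrum. *)
Let clamp (x : R) : R := Num.max (-1) (Num.min 1 x).

Let clampE x : Sp W x -> clamp x = x.
Proof.
move=> /D1; rewrite ler_norml => /andP[h1 h2].
by rewrite /clamp min_r// max_r.
Qed.

Let clamp_le1 x : `|clamp x| <= 1.
Proof.
rewrite ler_norml /clamp le_max lexx/= ge_max ge_min lexx/= andbT.
lra.
Qed.

Let avg_poly_cvg p : avg (horner p) n @[n --> \oo] --> I (horner p).
Proof.
(* Adding [M] makes the test function nonnegative, as [avg_cvg_integral] requires; it is removed at
   the end because [nu] has mass 1 on the spectrum. *)
pose M := palpha p; pose g x := p.[clamp x] + M.
have cl : continuous clamp.
  have c1 : continuous (fun x : R => Num.min 1 x).
    by move=> x; exact: (@continuous_min _ _ (fun=> 1) id x (cvg_cst _) cvg_id).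
  by move=> x; exact: (@continuous_max _ _ (fun=> -1) _ x (cvg_cst _) (c1 x)).
have cg : continuous g.
  move=> x; apply: cvgD; last exact: cvg_cst.
  apply: (@continuous_comp _ _ _ clamp (horner p)); first exact: cl.
  exact: continuous_horner.
have pM x : `|p.[clamp x]| <= M by exact: horner_palpha.
have gb x : 0 <= g x <= M + M.
  by have := pM x; rewrite ler_norml /g => /andP[? ?]; apply/andP; split; lra.
have bp : bmeas (horner p) by exact: bounded_meas_poly.
have bM := bounded_meas_cst W M.
have h := avg_cvg_integral cg gb.
have gE : (\int[nu]_x (g x)%:E = (I (horner p) + M)%:E)%E.
  rewrite (ge0_negligible_integral (N := ~` Sp W))//.
  - rewrite setTD setCK (_ : I (horner p) + M = I (fun x => p.[x] + M)).
      rewrite /Rintegral fineK; last first.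
        by have := integrable_fin_num mSp (limit_integrable (bounded_measD bp bM)).
      by apply: eq_integral => x /set_mem/clampE; rewrite /g => ->.
    rewrite RintegralD//; try exact: limit_integrable.
    by rewrite Rintegral_cst// limit_measure_of_Sp mulr1.
  - exact: measurableC.
  - by apply/measurable_EFinP; exact: cont_meas.
  - by move=> x _; rewrite lee_fin; have /andP[] := gb x.
  - exact: limit_measure_Sp.
rewrite gE in h; move/fine_cvgP: h => [_ h].
have -> : I (horner p) = I (horner p) + M - M by rewrite addrK.
apply: cvg_trans (cvgB h (cvg_cst M)); apply: near_eq_cvg; near=> n.
have m0 : (#|` Gn n|)%:R != 0 :> R by rewrite pnatr_eq0 -lt0n; near: n.
change (#|` Gn n|%:R^-1 * \sum_(i <- Gn n) K g i i - M =
  #|` Gn n|%:R^-1 * \sum_(i <- Gn n) K (horner p) i i).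
have -> : \sum_(i <- Gn n) K g i i = \sum_(i <- Gn n) K (horner p) i i + #|` Gn n|%:R * M.
  rewrite -sum_const_fset -big_split; apply: eq_bigr => i _ /=.
  rewrite (@eq_Kop _ _ _ _ g (fun x => p.[x] + M * 1)); last first.
    by move=> x Sx; rewrite /g clampE// mulr1.
  rewrite (KopD hW hE)//; last by apply: bounded_measM => //; exact: bounded_meas_cst.
  by rewrite (KopZ hW hE) ?(Kop1 hW hE) ?eqxx ?mulr1//; exact: bounded_meas_cst.
by rewrite mulrDr mulrA mulVf// mul1r addrK.
Unshelve. all: by end_near. Qed.

Lemma trace_cvg (C : R) g : wien C g ->
  (\sum_(i <- Gn n) K g i i) / (#|` Gn n|)%:R @[n --> \oo] --> I g.
Proof.
move=> hg; have bg := wiener_bounded_meas hW hg.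
have -> : (fun n => (\sum_(i <- Gn n) K g i i) / (#|` Gn n|)%:R) = avg g.
  by apply/funext => n; rewrite /avg mulrC.
apply/cvgrPdist_le => e e0; have e3 : 0 < e / 3 by rewrite divr_gt0.
have [p _ gp] := hg _ e3; have bp : bmeas (horner p) by exact: bounded_meas_poly.
have h1 := limit_dist bg bp gp.
have /cvgrPdist_le/(_ _ e3) := @avg_poly_cvg p; apply: filterS => n h2.
have h3 : `|avg (horner p) n - avg g n| <= e / 3.
  rewrite /avg -mulrBr -sumrB normrM ger0_norm ?invr_ge0//.
  apply: (@le_trans _ _ (#|` Gn n|%:R^-1 * (#|` Gn n|%:R * (e / 3)))).
    rewrite ler_wpM2l ?invr_ge0// -sum_const_fset; apply: le_trans (ler_norm_sum _ _ _) _.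
    by apply: ler_sum => i _; rewrite distrC; exact: (Kop_dist hW hE).
  have [->|m0] := eqVneq (#|` Gn n|) 0%N; first by rewrite invr0 mul0r ltW.
  by rewrite mulKf// pnatr_eq0.
move: h1 h2 h3; move: (I g) (I (horner p)) (avg g n) (avg (horner p) n) => x1 x2 x3 x4.
rewrite !ler_norml => /andP[? ?] /andP[? ?] /andP[? ?]; apply/andP; split; lra.
Qed.

End AverageSpectralMeasure.

(** * Consistency *)

Section ApproximateMinimizers.
Context {R : realType} (D : set R) (a b : R) (h : R -> R -> R).

Definition log_close (e s t : R) : Prop := forall x, D x -> `|h s x - h t x| <= e.

(** A countable dense family in [a, b], indexed by all rationals: an almost sure limit can be
    required at all its members at once. *)
Definition clamp_rat (q : rat) : R := Num.max a (Num.min b (ratr q)).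

Lemma log_closeC e s t : log_close e s t -> log_close e t s.
Proof. by move=> st x Dx; rewrite distrC st. Qed.

(** Compactness makes the pointwise continuity in the parameter uniform over [D]: all the h s share
    the Lipschitz constant rho, so closeness at x extends to the ball of radius [r] around x, where
    2 rho r <= e / 2. *)
Lemma log_close_near (rho t e : R) : compact (D : set R^o) ->
  (forall x, D x -> `|x| <= 1) ->
  (forall s, s \in `[a, b] -> wiener D rho (h s)) ->
  (forall x, D x -> {within `[a, b], continuous (fun s => h s x)}) ->
  t \in `[a, b] -> 0 < e ->
  \forall s \near nbhs t, s \in `[a, b] -> log_close e s t.
Proof.
move=> cD D1 hw hc tab e0.
have rho0 : 0 <= rho by exact: wiener_ge0 (hw t tab).
pose r := e / (4 * (rho + 1)).
have r0 : 0 < r by rewrite divr_gt0// mulr_gt0// ltr_wpDl.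
have rE : 4 * (rho * r) <= e.
  rewrite mulrA /r mulrA ler_pdivrMr ?mulr_gt0 ?ltr_wpDl// mulrC.
  by rewrite ler_pM2l//; lra.
have cov := (iffRL (near_covering_withinP _)) ((iffLR (compact_near_coveringP _)) cD).
have main : \forall s \near within `[a, b] (nbhs t),
    D `<=` (fun x => `|h s x - h t x| <= e).
  apply: cov => x Dx.
  have hcx := (iffLR (subspace_continuousP _ _)) (hc x Dx) t tab.
  have e2 : 0 < e / 2 by rewrite divr_gt0.
  have /cvgrPdist_le/(_ _ e2) Vn := hcx.
  exists ([set y | `|x - y| < r], [set s | s \in `[a, b] /\ `|h t x - h s x| <= e / 2]).
    split=> /=; first by apply/nbhs_ballP; exists r.
    by apply: filterI; [exact: withinT|exact: Vn].
  move=> [y s] /= [xy [sab hs]] Dy.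
  have l1 := wiener_lip D1 (hw s sab) Dy Dx; have l2 := wiener_lip D1 (hw t tab) Dx Dy.
  have l3 : rho * `|x - y| <= rho * r by rewrite ler_wpM2l// ltW.
  rewrite distrC in l1.
  move: l1 l2 l3 rE hs; rewrite (distrC y x); move: (rho * r) (rho * `|x - y|) => u v.
  rewrite !ler_norml => /andP[? ?] /andP[? ?] ? ? /andP[? ?]; apply/andP; split; lra.
exact: main.
Qed.

Hypothesis ab : a <= b.

Lemma clamp_rat_in q : clamp_rat q \in `[a, b].
Proof. by rewrite in_itv/= /clamp_rat le_max lexx/= ge_max ab ge_min lexx. Qed.

Lemma clamp_rat_dense t r : t \in `[a, b] -> 0 < r ->
  exists q, `|t - clamp_rat q| < r.
Proof.
rewrite in_itv/= => /andP[at_ tb] r0.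
have [|q] := @rat_in_itvoo R t (t + r); first by rewrite ltrDl.
rewrite in_itv/= => /andP[q1 q2]; exists q.
rewrite /clamp_rat /Num.max /Num.min; move: q1 q2; move: (ratr q) => y q1 q2.
by case: (ltP b y) => by_; case: ifP => h1; rewrite ltr_norml; apply/andP; split; lra.
Qed.

Variables (theta0 S : R) (c : nat -> R -> R) (l : R -> R) (eta tn : nat -> R).
Hypotheses (th0 : theta0 \in `[a, b]) (S0 : 0 <= S)
  (h_near : forall t (e : R), t \in `[a, b] -> 0 < e ->
    \forall s \near nbhs t, s \in `[a, b] -> log_close e s t)
  (cS : \forall n \near \oo, forall e s t : R, 0 < e -> s \in `[a, b] -> t \in `[a, b] ->
    log_close e s t -> c n s <= c n t + S * e)
  (lS : forall e s t : R, 0 < e -> s \in `[a, b] -> t \in `[a, b] ->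
    log_close e s t -> l s <= l t + S * e)
  (c_dense : forall q, c n (clamp_rat q) @[n --> \oo] --> l (clamp_rat q))
  (c_theta0 : c n theta0 @[n --> \oo] --> l theta0)
  (l_min : forall t, t \in `[a, b] -> t <> theta0 -> l theta0 < l t)
  (eta0 : eta n @[n --> \oo] --> (0 : R))
  (tnP : \forall n \near \oo,
    tn n \in `[a, b] /\ c n (tn n) <= c n theta0 + eta n).

(** By compactness of [a, b] it is enough that each x other than theta0 has a neighborhood which tn
    n eventually avoids. Limits of c n are known only at theta0 and at the points clamp_rat q, so x
    is compared with a nearby clamp_rat q: three uses of S e <= Delta / 8 and three limits within
    Delta / 8 lose only 6/8 of the gap Delta. *)
Lemma approximate_minimizers_cvg : tn n @[n --> \oo] --> theta0.
Proof.
apply/cvgrPdist_lt => eps eps0.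
have cov := (iffLR (compact_near_coveringP _)) (@segment_compact R a b).
(* The equation tn n = s lets a covering argument, which quantifies over all s, speak of the moving
   point tn n. *)
have main : \forall n \near \oo, `[a, b]%classic `<=` (fun s => tn n = s -> `|theta0 - s| < eps).
  apply: cov => x xab.
  have [->|xt] := eqVneq x theta0.
    exists ([set s | `|theta0 - s| < eps], setT).
      by split=> /=; [apply/nbhs_ballP; exists eps|exact: filterT].
    by move=> [s n] /= [].
  pose Delta := l x - l theta0.
  have D0 : 0 < Delta by rewrite subr_gt0 l_min//; exact/eqP.
  pose e := Delta / (8 * (S + 1)).
  have e0 : 0 < e by rewrite divr_gt0// mulr_gt0// ltr_wpDl.
  have Se : 8 * (S * e) <= Delta.
    rewrite mulrA /e mulrA ler_pdivrMr ?mulr_gt0 ?ltr_wpDl// mulrC.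
    by rewrite ler_pM2l//; lra.
  have Un := h_near xab e0.
  have /nbhs_ballP[r /= r0 hr] := Un.
  have [q qx] := clamp_rat_dense xab r0.
  have qab := clamp_rat_in q; have qe := hr _ qx qab.
  have d8 : 0 < Delta / 8 by rewrite divr_gt0.
  have /cvgrPdist_le/(_ _ d8) h1 := @c_dense q.
  have /cvgrPdist_le/(_ _ d8) h2 := c_theta0.
  have /cvgrPdist_le/(_ _ d8) h3 := eta0.
  exists ([set s | s \in `[a, b] -> log_close e s x],
    [set n | [/\ forall e s t : R, 0 < e -> s \in `[a, b] -> t \in `[a, b] ->
        log_close e s t -> c n s <= c n t + S * e,
      `|l (clamp_rat q) - c n (clamp_rat q)| <= Delta / 8,
      `|l theta0 - c n theta0| <= Delta / 8,
      `|0 - eta n| <= Delta / 8 &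
      tn n \in `[a, b] /\ c n (tn n) <= c n theta0 + eta n]]).
    by split=> //=; near=> n; split; near: n.
  move=> [s n] /= [sx [cn k1 k2 k3 [sab k4]]] sE; rewrite sE in sab k4.
  exfalso; have {}sx := sx sab.
  have m1 := cn _ _ _ e0 qab xab qe.
  have m2 := cn _ _ _ e0 xab sab (log_closeC sx).
  have m3 := lS e0 xab qab (log_closeC qe).
  move: k1 k2 k3 k4 m1 m2 m3 Se D0; rewrite /Delta.
  rewrite !ler_norml => /andP[? ?] /andP[? ?] /andP[? ?] *; lra.
near=> n; have [tab _] : tn n \in `[a, b] /\ c n (tn n) <= c n theta0 + eta n by near: n.
have hn : `[a, b]%classic `<=` (fun s => tn n = s -> `|theta0 - s| < eps) by near: n.
exact: hn tab erefl.
Unshelve. all: by end_near. Qed.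

End ApproximateMinimizers.

(** These facts turn the maximality of a likelihood into near-minimality of the normalized contrast:
    the common log (2 pi) term and the factor m cancel, and replacement errors are carried along as
    e + e. *)
Fact contrast_le {R : realFieldType} (m k x y x' y' : R) : 0 < m ->
  - 2^-1 * (m * k + m * x + y) <= - 2^-1 * (m * k + m * x' + y') ->
  x' + y' / m <= x + y / m.
Proof.
move=> m0 le; rewrite -(ler_pM2l m0) !mulrDr !(mulrC m (_ / m)) !mulfVK ?gt_eqF//.
by move: le; rewrite !mulNr lerN2 ler_pM2l ?invr_gt0// -!addrA lerD2l.
Qed.

Fact contrast_le0 {R : realFieldType} (m k x y x' y' : R) : 0 < m ->
  - 2^-1 * (m * k + m * x + y) <= - 2^-1 * (m * k + m * x' + y') ->
  x' + y' / m <= x + y / m + 0.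
Proof. by rewrite addr0; exact: contrast_le. Qed.

Fact log_det_contrast_le {R : realFieldType} (m k d1 d2 v1 v2 t1 t2 e : R) :
  0 < m -> `|d1 / m - t1| <= e -> `|d2 / m - t2| <= e ->
  - 2^-1 * (m * k + d1 + v1) <= - 2^-1 * (m * k + d2 + v2) ->
  t2 + v2 / m <= t1 + v1 / m + (e + e).
Proof.
move=> m0; have E d : d = m * (d / m) by rewrite mulrC mulfVK// gt_eqF.
move=> l1 l2; rewrite {1}(E d1) {1}(E d2) => /(contrast_le m0).
by move: l1 l2; rewrite !ler_norml => /andP[? ?] /andP[? ?]; lra.
Qed.

Fact corrected_contrast_le {R : realFieldType} (m k x1 x2 q1 q2 z1 z2 e : R) :
  0 < m -> `|q1 / m - z1| <= e -> `|q2 / m - z2| <= e ->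
  - 2^-1 * (m * k + m * x1 + q1) <= - 2^-1 * (m * k + m * x2 + q2) ->
  x2 + z2 <= x1 + z1 + (e + e).
Proof.
move=> m0 l1 l2 /(contrast_le m0).
by move: l1 l2; rewrite !ler_norml => /andP[? ?] /andP[? ?]; lra.
Qed.

Fact inv_quad_rearrange {R : realType} (x zs zt Ls Lt e e' : R) :
  x - zs = Ls -> x - zt <= Lt -> zt - zs <= e -> e <= e' -> Ls <= Lt + e'.
Proof. lra. Qed.

(** * Continuity of the contrasts in the parameter, and consistency on a fixed path *)

Section Consistency.
Context {R : realType} {G : countType} (W : G -> G -> R).
Context (E : set R -> (G -> R) -> (G -> R)).
Hypotheses (hW : is_graph W) (hE : spectral_resolution W E).
Context d {Omega : measurableType d} (P : probability Omega R).
Variables (X : G -> {RV P >-> R}) (Gn : nat -> {fset G}) (nu : {measure set R -> \bar R}).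
Variables (rho a b theta0 : R) (h : R -> R -> R).
Hypotheses (ab : a <= b) (th0 : theta0 \in `[a, b])
  (hh : forall t, t \in `[a, b] -> wiener (Sp W) rho (h t))
  (h_near : forall t e : R, t \in `[a, b] -> 0 < e ->
     \forall s \near nbhs t, s \in `[a, b] -> log_close (Sp W) h e s t)
  (h_inj : forall t, t \in `[a, b] ->
     {ae nu, forall x, Sp W x -> h t x = h theta0 x} -> t = theta0)
  (hX : centered_gaussian_process X (Kop W E (expf (h theta0) 1)))
  (Gn_sub : forall p q, (p <= q)%N -> (Gn p `<=` Gn q)%fset)
  (Gn_unbounded : forall K, exists n, (K <= #|` Gn n|)%N)
  (Gn_boundary : forall eta : R, 0 < eta -> exists N, forall n, (N <= n)%N ->
     (boundary_size W (Gn n))%:R <= eta * (#|` Gn n|)%:R)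
  (hnu : weak_cvg (fun n => avg_mu E (Gn n)) nu).

Local Notation K := (Kop W E).
Local Notation m := (fun n => #|` Gn n|).
Local Notation wien := (wiener (Sp W)).
Local Notation close := (log_close (Sp W) h).
Local Notation I := (fun g => \int[nu]_(x in Sp W) g x).
Local Notation clampq := (clamp_rat a b).

Let D1 x : Sp W x -> `|x| <= 1. Proof. exact: Sp_le1. Qed.
Let mSp : measurable (Sp W). Proof. exact: Sp_measurable. Qed.
Let one1 : `|1 : R| <= 1. Proof. by rewrite normr1. Qed.
Let oneN1 : `|-1 : R| <= 1. Proof. by rewrite normrN1. Qed.
Let rho0 : 0 <= rho. Proof. exact: wiener_ge0 (hh th0). Qed.

Let Gn_pos : \forall n \near \oo, (0 < #|` Gn n|)%N.
Proof.
have [n hn] := Gn_unbounded 1; exists n => // k nk.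
by apply: leq_trans hn _; apply: fsubset_leq_card; exact: Gn_sub.
Qed.

Definition log_limit t : R := I (h t).
Definition ratio_limit t : R := I (fun x => expf (h theta0) 1 x * expf (h t) (-1) x).

Definition plugin_form n t w : R := quad X (K (expf (h t) (-1))) (Gn n) w.
Definition likelihood_form n t w : R :=
  quad X (inv_kernel (K (expf (h t) 1)) (Gn n)) (Gn n) w.
Definition squared_norm n w : R := \sum_(i <- Gn n) X i w ^+ 2.

Lemma expf_close (s e t1 t2 : R) : `|s| <= 1 -> t1 \in `[a, b] -> t2 \in `[a, b] ->
  close e t1 t2 ->
  forall x, Sp W x -> `|expf (h t1) s x - expf (h t2) s x| <= expR rho * e.
Proof.
move=> s1 t1ab t2ab c x Sx.
have b1 := sh_bound hW (hh t1ab) s1 Sx; have b2 := sh_bound hW (hh t2ab) s1 Sx.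
apply: le_trans (expR_lip (le_trans (ler_norm _) b1) (le_trans (ler_norm _) b2)) _.
rewrite ler_pM2l ?expR_gt0// -mulrBr normrM; apply: le_trans (c x Sx).
by rewrite ler_piMl.
Qed.

Let ratio_wiener t : t \in `[a, b] ->
  wien (cexp rho * cexp rho) (fun x => expf (h theta0) 1 x * expf (h t) (-1) x).
Proof.
by move=> tab; apply: wienerM => //; [exact: (wiener_expf hW (hh th0))|exact: (wiener_expf hW (hh tab))].
Qed.

Lemma log_limit_close e s t : s \in `[a, b] -> t \in `[a, b] -> close e s t ->
  log_limit s <= log_limit t + e.
Proof.
move=> sab tab c; rewrite -lerBlDl; apply: le_trans (ler_norm _) _.
apply: (limit_dist hW hE Gn_pos hnu) => //; exact: wiener_bounded_meas (hh _).
Qed.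

Lemma trace_close n e s t : 0 < e -> s \in `[a, b] -> t \in `[a, b] -> close e s t ->
  (\sum_(i <- Gn n) K (h s) i i) / (m n)%:R <=
  (\sum_(i <- Gn n) K (h t) i i) / (m n)%:R + e.
Proof.
move=> e0 sab tab c.
have [m0|m0] := eqVneq (m n) 0%N; first by rewrite m0 invr0 !mulr0 add0r ltW.
rewrite ler_pdivrMr ?ltr0n ?lt0n// mulrDl mulfVK ?pnatr_eq0// mulrC -sum_const_fset.
rewrite -big_split; apply: ler_sum => i _ /=; rewrite -lerBlDl.
apply: le_trans (ler_norm _) _.
by apply: (Kop_dist hW hE) => //; exact: wiener_bounded_meas (hh _).
Qed.

Lemma ratio_limit_close e s t : s \in `[a, b] -> t \in `[a, b] -> close e s t ->
  ratio_limit s <= ratio_limit t + expR rho * (expR rho * e).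
Proof.
move=> sab tab c; rewrite -lerBlDl; apply: le_trans (ler_norm _) _.
apply: (limit_dist hW hE Gn_pos hnu); try exact: wiener_bounded_meas (ratio_wiener _).
move=> x Sx; rewrite -mulrBr normrM; apply: ler_pM => //; last exact: expf_close.
have /andP[_] := expf_bound hW (hh th0) one1 Sx.
by rewrite ger0_norm// expR_ge0.
Qed.

Lemma plugin_form_close n w e s t : s \in `[a, b] -> t \in `[a, b] -> close e s t ->
  plugin_form n s w <= plugin_form n t w + expR rho * e * squared_norm n w.
Proof.
move=> sab tab c; rewrite -lerBlDl; apply: le_trans (ler_norm _) _.
have ws := wiener_expf hW (hh sab) oneN1; have wt := wiener_expf hW (hh tab) oneN1.
have bs := wiener_bounded_meas hW ws; have bt := wiener_bounded_meas hW wt.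
have wd := wienerD ws (wienerZ (-1) wt).
apply: le_trans (quad_le hW hE (M := expR rho * e) (Gn n) (fun i => X i w) wd _); last first.
  by move=> x Sx; rewrite mulN1r; exact: expf_close.
rewrite /plugin_form /quad -sumrB le_eqVlt; apply/orP; left; apply/eqP; congr `|_|.
apply: eq_bigr => i _; rewrite -sumrB; apply: eq_bigr => j _.
rewrite (KopD hW hE)//; last by apply: bounded_measM => //; exact: bounded_meas_cst.
by rewrite (KopZ hW hE)// mulN1r mulrBr.
Qed.

(** The maximizer [z] of the variational formula at [s] is a competitor at [t], so only the form of
    K(e^(h t)) - K(e^(h s)) at [z] matters, and |z|^2 <= e^(2 rho) |X|^2. *)
Lemma likelihood_form_close n w e s t : 0 < e -> s \in `[a, b] -> t \in `[a, b] ->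
  close e s t -> likelihood_form n s w <=
    likelihood_form n t w + expR rho * e * (expR (2 * rho) * squared_norm n w).
Proof.
move=> e0 sab tab c; pose A := Gn n; pose x i := X i w.
have ws := wiener_expf hW (hh sab) one1; have wt := wiener_expf hW (hh tab) one1.
have bs := wiener_bounded_meas hW ws; have bt := wiener_bounded_meas hW wt.
have cs := expf_coercive hW hE (hh sab) A one1.
have ct := expf_coercive hW hE (hh tab) A one1.
have r0 := expR_gt0 (- rho).
pose z := solve (K (expf (h s) 1)) A x.
have l1 := inv_quad_solve r0 cs x; have l2 := inv_quad_ge r0 ct x z.
rewrite -/z in l1.
have l3 : \sum_(i <- A) \sum_(j <- A) z i * z j * K (expf (h t) 1) i j -
    \sum_(i <- A) \sum_(j <- A) z i * z j * K (expf (h s) 1) i j <=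
    expR rho * e * \sum_(i <- A) z i ^+ 2.
  have wd := wienerD wt (wienerZ (-1) ws).
  apply: le_trans (ler_norm _) _.
  apply: le_trans (quad_le hW hE (M := expR rho * e) A z wd _); last first.
    by move=> y Sy; rewrite mulN1r; apply: expf_close => //; exact: log_closeC.
  rewrite -sumrB le_eqVlt; apply/orP; left; apply/eqP; congr `|_|.
  apply: eq_bigr => i _; rewrite -sumrB; apply: eq_bigr => j _.
  rewrite (KopD hW hE)//; last by apply: bounded_measM => //; exact: bounded_meas_cst.
  by rewrite (KopZ hW hE)// mulN1r mulrBr.
have l4 : \sum_(i <- A) z i ^+ 2 <= expR (2 * rho) * squared_norm n w.
  apply: le_trans (solve_norm r0 cs x) _.
  by rewrite expRN exprVn invrK -expRM_natl.
have l5 : expR rho * e * \sum_(i <- A) z i ^+ 2 <=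
    expR rho * e * (expR (2 * rho) * squared_norm n w).
  by apply: ler_wpM2l l4; rewrite mulr_ge0 ?expR_ge0// ltW.
exact: inv_quad_rearrange l1 l2 l3 l5.
Qed.

Lemma ratio_limit_theta0 : ratio_limit theta0 = 1.
Proof.
rewrite /ratio_limit (_ : (fun x => _) = fun=> 1); last first.
  by apply/funext => x; rewrite /expf -expRD mul1r mulN1r subrr expR0.
by rewrite Rintegral_cst// (limit_measure_of_Sp hW hE Gn_pos hnu) mulr1.
Qed.

(* Kullback-Leibler: the integrand of the difference is exp y - 1 - y, where
   y = log (f_theta0 / f_t). *)
Lemma limit_contrast_min t : t \in `[a, b] -> t <> theta0 ->
  log_limit theta0 + ratio_limit theta0 < log_limit t + ratio_limit t.
Proof.
move=> tab tne; rewrite ratio_limit_theta0.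
pose y x := h theta0 x - h t x; pose u x := expR (y x) - 1 - y x.
have u0 x : 0 <= u x by have := expR_ge1Dx (y x); rewrite /u; lra.
have b0 := wiener_bounded_meas hW (hh th0); have bt := wiener_bounded_meas hW (hh tab).
have br := wiener_bounded_meas hW (ratio_wiener tab).
have rE x : expf (h theta0) 1 x * expf (h t) (-1) x = expR (y x).
  by rewrite /expf -expRD mul1r mulN1r.
have int := limit_integrable hW hE Gn_pos hnu.
(* [v] equals [u], but is written as a combination of functions whose integrals are the limits in
   the statement. *)
pose v x := expf (h theta0) 1 x * expf (h t) (-1) x + (h t x + -1 * (h theta0 x + 1)).
have vu x : v x = u x by rewrite /v rE /u /y; lra.
have b1 := bounded_meas_cst W (1 : R); have bN1 := bounded_meas_cst W (-1 : R).
have b2 := bounded_measM bN1 (bounded_measD b0 b1).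
have b3 := bounded_measD bt b2; have bv := bounded_measD br b3.
have IE : I v = ratio_limit t + (log_limit t + -1 * (log_limit theta0 + 1)).
  rewrite RintegralD//; try exact: int.
  rewrite RintegralD//; try exact: int.
  rewrite RintegralZl//; last by apply: int; exact: bounded_measD.
  rewrite RintegralD//; try exact: int.
  by rewrite Rintegral_cst// (limit_measure_of_Sp hW hE Gn_pos hnu) mulr1.
have fin := integrable_fin_num mSp (int _ bv).
have Iv0 : 0 <= I v.
  rewrite /Rintegral fine_ge0// integral_ge0// => x _.
  by rewrite lee_fin vu.
rewrite ltNge; apply/negP => le.
have {}Iv0 : I v = 0 by apply/eqP; rewrite eq_le Iv0 andbT IE; lra.
apply: tne; apply: h_inj => //.
have : ae_eq nu (Sp W) (EFin \o v) (cst 0%E).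
  apply/ae_eq_integral_abs => //; first by apply/measurable_EFinP; exact: (proj1 bv).
  rewrite (eq_integral (EFin \o v)); last first.
    by move=> x _; rewrite /= ger0_norm// vu.
  transitivity ((I v)%:E); last by rewrite Iv0.
  by rewrite /Rintegral fineK//; exact: fin.
apply: filterS => x hx Sx; have /= [] := hx Sx.
rewrite vu /u => ux; have [|yn0] := eqVneq (y x) 0; first by rewrite /y; lra.
by have := expR_gt1Dx yn0; lra.
Qed.

(** All that is asked of a sample path. theta0 is listed apart because it need not be of the form
    clampq q. *)
Definition regular_path w : Prop :=
  [/\ exists2 B : R, 0 <= B & \forall n \near \oo, squared_norm n w <= B * (m n)%:R,
      forall q, plugin_form n (clampq q) w / (m n)%:R @[n --> \oo] -->
        ratio_limit (clampq q),
      forall q, likelihood_form n (clampq q) w / (m n)%:R @[n --> \oo] -->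
        ratio_limit (clampq q),
      plugin_form n theta0 w / (m n)%:R @[n --> \oo] --> ratio_limit theta0 &
      likelihood_form n theta0 w / (m n)%:R @[n --> \oo] --> ratio_limit theta0].

Let wf0 := wiener_expf hW (hh th0) one1.

Let add_trace (F T : nat -> R) (z : R) :
  (F n - T n) / (m n)%:R @[n --> \oo] --> (0 : R) ->
  T n / (m n)%:R @[n --> \oo] --> z -> F n / (m n)%:R @[n --> \oo] --> z.
Proof.
move=> h1 h2; rewrite -[X in _ --> X]add0r; apply: cvg_trans (cvgD h1 h2).
by apply: near_eq_cvg; near=> n; rewrite /= -[LHS]/(_ / _ + _ / _) -mulrDl subrK.
Unshelve. all: by end_near. Qed.

Lemma plugin_form_cvg t : t \in `[a, b] -> {ae P, forall w,
  plugin_form n t w / (m n)%:R @[n --> \oo] --> ratio_limit t}.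
Proof.
move=> tab; have wt := wiener_expf hW (hh tab) oneN1.
have := kernel_form_law hW hE wf0 hX Gn_sub Gn_unbounded Gn_boundary wt.
apply: filterS => w hw; apply: add_trace hw _.
exact: (trace_cvg hW hE Gn_pos hnu (ratio_wiener tab)).
Qed.

Lemma likelihood_form_cvg t : t \in `[a, b] -> {ae P, forall w,
  likelihood_form n t w / (m n)%:R @[n --> \oo] --> ratio_limit t}.
Proof.
move=> tab.
have := inverse_form_law hW hE wf0 hX Gn_sub Gn_unbounded Gn_boundary (hh tab).
apply: filterS => w hw; apply: add_trace hw _.
exact: (trace_cvg hW hE Gn_pos hnu (ratio_wiener tab)).
Qed.

(** The law for g = 1, whose kernel is the identity, controls |X_n|^2 / m_n. *)
Lemma squared_norm_bounded : {ae P, forall w, exists2 B : R, 0 <= B &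
  \forall n \near \oo, squared_norm n w <= B * (m n)%:R}.
Proof.
have w1 : wien `|1 : R| (fun=> 1) by exact: wiener_cst.
have := kernel_form_law hW hE wf0 hX Gn_sub Gn_unbounded Gn_boundary w1.
apply: filterS => w hw.
have := trace_cvg hW hE Gn_pos hnu (wienerM D1 wf0 w1); move=> /(add_trace hw).
set z := I _ => hz.
exists (`|z| + 1); first by rewrite addr_ge0.
have /cvgrPdist_le/(_ _ ltr01) := hz; apply: filterS2 Gn_pos => n n0.
rewrite ler_norml => /andP[+ _].
have -> : quad X (K (fun=> 1)) (Gn n) w = squared_norm n w.
  rewrite /quad /squared_norm big_seq [RHS]big_seq; apply: eq_bigr => i iA.
  under eq_bigr do rewrite (Kop1 hW hE) mulrC.
  by rewrite sum_indic iA expr2.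
rewrite -ler_pdivrMr ?ltr0n// => h1.
by have := ler_norm z; lra.
Qed.

Lemma ae_regular_path : {ae P, forall w, regular_path w}.
Proof.
have dense (f : R -> nat -> Omega -> R) : (forall t, t \in `[a, b] ->
      {ae P, forall w, f t n w / (m n)%:R @[n --> \oo] --> ratio_limit t}) ->
    {ae P, forall w, forall q, f (clampq q) n w / (m n)%:R @[n --> \oo] -->
      ratio_limit (clampq q)}.
  (* The rationals are enumerated through [unpickle], so that the exceptional sets form a
     sequence. *)
  move=> hf; pose A k w := if @choice.unpickle rat k is Some q then
      f (clampq q) n w / (m n)%:R @[n --> \oo] --> ratio_limit (clampq q) else True.
  have hA : {ae P, forall w, forall k, A k w}.
    apply: ae_foralln => k; rewrite /A; case: choice.unpickle => [q|]; last exact: aeW.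
    by apply: hf; exact: clamp_rat_in.
  apply: filterS hA => w hw q; have := hw (choice.pickle q).
  by rewrite /A choice.pickleK.
have h1 := squared_norm_bounded.
have h2 := dense (fun t n w => plugin_form n t w) plugin_form_cvg.
have h3 := dense (fun t n w => likelihood_form n t w) likelihood_form_cvg.
have h4 := plugin_form_cvg th0; have h5 := likelihood_form_cvg th0.
apply: filterS2 h5 (filterI h1 (filterI h2 (filterI h3 h4))) => w w5 [w1 [w2 [w3 w4]]].
by split.
Qed.

(** [A] is the logarithmic part of the contrast, [Z] the quadratic part, and [eta] absorbs
    replacement errors. In [S], 1 and [SZ] are the moduli of these parts and the last summand is
    that of [ratio_limit]. *)
Lemma contrast_consistency (A Z : nat -> R -> R) (SZ : R) (eta tn : nat -> R) :
  0 <= SZ ->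
  (forall n e s t, 0 < e -> s \in `[a, b] -> t \in `[a, b] -> close e s t ->
     A n s <= A n t + e) ->
  (\forall n \near \oo, forall e s t, 0 < e -> s \in `[a, b] -> t \in `[a, b] ->
     close e s t -> Z n s <= Z n t + SZ * e) ->
  (forall t, t \in `[a, b] -> A n t @[n --> \oo] --> log_limit t) ->
  (forall q, Z n (clampq q) @[n --> \oo] --> ratio_limit (clampq q)) ->
  Z n theta0 @[n --> \oo] --> ratio_limit theta0 ->
  eta n @[n --> \oo] --> (0 : R) ->
  (\forall n \near \oo, tn n \in `[a, b] /\
     A n (tn n) + Z n (tn n) <= A n theta0 + Z n theta0 + eta n) ->
  tn n @[n --> \oo] --> theta0.
Proof.
move=> SZ0 Ac Zc Al Zq Z0 eta0 tnP.
pose S := 1 + SZ + expR rho * expR rho.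
have r0 : 0 <= expR rho * expR rho by rewrite mulr_ge0 ?expR_ge0.
apply: (@approximate_minimizers_cvg R (Sp W) a b h ab theta0 S (fun n t => A n t + Z n t)
  (fun t => log_limit t + ratio_limit t) eta tn) => //.
- by rewrite !addr_ge0.
- apply: filterS Zc => n hn e s t e0 sab tab c.
  have l1 := Ac n e s t e0 sab tab c; have l2 := hn e s t e0 sab tab c.
  have l3 := mulr_ge0 r0 (ltW e0); rewrite /S !mulrDl mul1r; lra.
- move=> e s t e0 sab tab c.
  have l1 := log_limit_close sab tab c; have l2 := ratio_limit_close sab tab c.
  have l3 := mulr_ge0 SZ0 (ltW e0); rewrite /S !mulrDl mul1r; rewrite mulrA in l2; lra.
- by move=> q; apply: cvgD; [apply: Al; exact: clamp_rat_in|exact: Zq].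
- by apply: cvgD => //; exact: Al.
- by move=> t tab tne; exact: limit_contrast_min.
Qed.

Lemma plugin_consistency w (eta tn : nat -> R) : regular_path w ->
  eta n @[n --> \oo] --> (0 : R) ->
  (\forall n \near \oo, tn n \in `[a, b] /\
     log_limit (tn n) + plugin_form n (tn n) w / (m n)%:R <=
     log_limit theta0 + plugin_form n theta0 w / (m n)%:R + eta n) ->
  tn n @[n --> \oo] --> theta0.
Proof.
move=> [[B B0 hB] hq _ h0 _] eta0 tnP.
apply: (@contrast_consistency (fun _ => log_limit)
  (fun n t => plugin_form n t w / (m n)%:R) (expR rho * B)) eta0 tnP => //.
- by rewrite mulr_ge0 ?expR_ge0.
- by move=> n e s t _; exact: log_limit_close.
- apply: filterS2 hB Gn_pos => n hn n0 e s t e0 sab tab c.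
  have m0 : 0 < (m n)%:R :> R by rewrite ltr0n.
  rewrite ler_pdivrMr// mulrDl mulfVK ?gt_eqF//.
  apply: le_trans (plugin_form_close n w sab tab c) _; rewrite lerD2l.
  apply: le_trans (ler_wpM2l (mulr_ge0 (expR_ge0 _) (ltW e0)) hn) _.
  by rewrite le_eqVlt; apply/orP; left; apply/eqP; ring.
- by move=> t tab; exact: cvg_cst.
Qed.

Lemma likelihood_consistency w (A : nat -> R -> R) (eta tn : nat -> R) :
  regular_path w ->
  (forall n e s t, 0 < e -> s \in `[a, b] -> t \in `[a, b] -> close e s t ->
     A n s <= A n t + e) ->
  (forall t, t \in `[a, b] -> A n t @[n --> \oo] --> log_limit t) ->
  eta n @[n --> \oo] --> (0 : R) ->
  (\forall n \near \oo, tn n \in `[a, b] /\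
     A n (tn n) + likelihood_form n (tn n) w / (m n)%:R <=
     A n theta0 + likelihood_form n theta0 w / (m n)%:R + eta n) ->
  tn n @[n --> \oo] --> theta0.
Proof.
move=> [[B B0 hB] _ hq _ h0] Ac Al eta0 tnP.
apply: (@contrast_consistency A
  (fun n t => likelihood_form n t w / (m n)%:R) (expR rho * (expR (2 * rho) * B))) eta0 tnP => //.
- by rewrite !mulr_ge0 ?expR_ge0.
- apply: filterS2 hB Gn_pos => n hn n0 e s t e0 sab tab c.
  have m0 : 0 < (m n)%:R :> R by rewrite ltr0n.
  rewrite ler_pdivrMr// mulrDl mulfVK ?gt_eqF//.
  apply: le_trans (likelihood_form_close n w e0 sab tab c) _; rewrite lerD2l.
  apply: (@le_trans _ _ (expR rho * e * (expR (2 * rho) * (B * (m n)%:R)))).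
    by rewrite !ler_wpM2l ?mulr_ge0 ?expR_ge0// ltW.
  by rewrite le_eqVlt; apply/orP; left; apply/eqP; ring.
Qed.

(** The bound does not depend on [t], so it may be used at the random maximizer as well as at
    theta0. *)
Lemma log_det_close t n : t \in `[a, b] ->
  `|ln (\det (restr_mx (K (expf (h t) 1)) (Gn n))) / (m n)%:R -
    (\sum_(i <- Gn n) K (h t) i i) / (m n)%:R| <=
  expR rho * (cexp rho * expR rho) * ((boundary_size W (Gn n))%:R / (m n)%:R).
Proof.
move=> tab; rewrite -mulrBl normrM normfV (ger0_norm (ler0n _ _)) [leRHS]mulrA.
rewrite ler_wpM2r ?invr_ge0// -[leRHS]mulrA.
have l := ln_det_expf hW hE (hh tab) (Gn n).
exact l.
Qed.

Lemma boundary_ratio_cvg0 : (boundary_size W (Gn n))%:R / (m n)%:R @[n --> \oo] --> (0 : R).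
Proof.
have := @boundary_ratio R G W Gn Gn_boundary (fun n => (boundary_size W (Gn n))%:R) (fun=> 0) 1.
move=> H; have {}H := H _; have {}H : ((boundary_size W (Gn n))%:R - 0) / (m n)%:R @[n --> \oo] --> (0 : R).
  by apply: H => n; rewrite subr0 mul1r ger0_norm.
by under eq_fun do rewrite -(subr0 (boundary_size W (Gn _))%:R).
Qed.

Lemma log_trace_cvg t : t \in `[a, b] ->
  (\sum_(i <- Gn n) K (h t) i i) / (m n)%:R @[n --> \oo] --> log_limit t.
Proof. by move=> tab; exact: (trace_cvg hW hE Gn_pos hnu (hh tab)). Qed.

(** Bound |x_i x_j| by half of x_i^2 + x_j^2; the rows and columns of |K| then have sums at most
    [cexp rho]. *)
Lemma corrected_form_close (B : G -> G -> R) (u : R) n t w : t \in `[a, b] ->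
  0 <= u -> (forall i j, i \in Gn n -> j \in Gn n -> `|B i j - 1| <= u) ->
  `|quad X (fun i j => B i j * K (expf (h t) (-1)) i j) (Gn n) w -
    plugin_form n t w| <= u * (cexp rho * squared_norm n w).
Proof.
move=> tab u0 Bu; have wt := wiener_expf hW (hh tab) oneN1.
pose A := Gn n; pose k i j := `|K (expf (h t) (-1)) i j|.
have ks i j : k i j = k j i.
  by rewrite /k (Kop_sym hE _ _ (wiener_bounded_meas hW wt)).
have kC i : \sum_(j <- A) k i j <= cexp rho by exact: (Kop_row hW hE i A wt).
apply: (@le_trans _ _ (\sum_(i <- A) \sum_(j <- A)
    u * (k i j * (2^-1 * X i w ^+ 2) + k j i * (2^-1 * X j w ^+ 2)))).
  rewrite /plugin_form /quad -sumrB; apply: le_trans (ler_norm_sum _ _ _) _.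
  rewrite big_seq [leRHS]big_seq; apply: ler_sum => i iA.
  rewrite -sumrB; apply: le_trans (ler_norm_sum _ _ _) _.
  rewrite big_seq [leRHS]big_seq; apply: ler_sum => j jA.
  rewrite (_ : _ - _ = (B i j - 1) * (K (expf (h t) (-1)) i j * (X i w * X j w))); last by ring.
  rewrite normrM; apply: ler_pM => //; first exact: Bu.
  rewrite normrM -/(k i j) (ks j i) -mulrDr ler_wpM2l ?normr_ge0//.
  move: (X i w) (X j w) => x y; rewrite ler_norml.
  have := sqr_ge0 (x - y); have := sqr_ge0 (x + y).
  by rewrite sqrrD sqrrB => *; apply/andP; split; lra.
under eq_bigr do rewrite -mulr_sumr.
rewrite -mulr_sumr ler_wpM2l//.
under eq_bigr do rewrite big_split/=.
rewrite big_split/= [X in _ + X]exchange_big/= -big_split/= /squared_norm mulr_sumr.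
apply: ler_sum => i _; rewrite -mulr_suml.
have := ler_wpM2r (sqr_ge0 (X i w)) (kC i); lra.
Qed.

End Consistency.

(** * Application to the four estimators *)

Unset Implicit Arguments.

Local Open Scope fset_scope.
Local Open Scope classical_set_scope.
Local Open Scope ring_scope.

Theorem theorem3p1 (R : realType) (G : countType) (W : G -> G -> R)
  (E : set R -> (G -> R) -> (G -> R)) (Gn : nat -> {fset G})
  (rho a b theta0 : R) (f : R -> R -> R)
  (d : measure_display) (Omega : measurableType d) (Pr : probability Omega R)
  (X : G -> {RV Pr >-> R}) (nu : {measure set R -> \bar R})
  (hW : is_graph W)
  (hE : spectral_resolution W E)
  (hGn : forall n, (Gn n `<=` Gn n.+1)%fset)
  (hGoo : (#|` Gn n|%:R : R) @[n --> \oo] --> +oo)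
  (hrho : 0 < rho)
  (htheta0 : a < theta0 < b)
  (hX : centered_gaussian_process X (Kop W E (f theta0)))
  (hdelta : (fun n => (boundary_size W (Gn n))%:R : R^o) =o_\oo
            (fun n => #|` Gn n|%:R : R^o))
  (* injectivity of t |-> f t, densities being identified nu-almost everywhere *)
  (hinj : forall t s, t \in `[a, b] -> s \in `[a, b] ->
            {ae nu, forall x, Sp W x -> f t x = f s x} -> t = s)
  (hcont : forall x, Sp W x -> {within `[a, b], continuous (fun t => f t x)})
  (hF : forall t, t \in `[a, b] -> in_Frho (hull W) rho (f t))
  (hnu : weak_cvg (fun n => avg_mu E (Gn n)) nu) :
  [/\ forall theta_hat : nat -> Omega -> R,
        (forall n w, maximizes `[a, b]
           (fun t => L_hat W E (f t) (obs X (Gn n) w)) (theta_hat n w)) ->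
        {ae Pr, forall w, theta_hat n w @[n --> \oo] --> theta0},
      forall theta_bar : nat -> Omega -> R,
        (forall n w, maximizes `[a, b]
           (fun t => L_bar W E nu (f t) (obs X (Gn n) w)) (theta_bar n w)) ->
        {ae Pr, forall w, theta_bar n w @[n --> \oo] --> theta0},
      forall theta_tilde : nat -> Omega -> R,
        (forall n w, maximizes `[a, b]
           (fun t => L_tilde W E nu (f t) (obs X (Gn n) w)) (theta_tilde n w)) ->
        {ae Pr, forall w, theta_tilde n w @[n --> \oo] --> theta0} &
      forall P : nat, (0 < P)%N ->
        poly_on (hull W) P (f theta0) \/
        (forall t, t \in `[a, b] -> poly_on (hull W) P (fun x => (f t x)^-1)) ->
        finite_set (VP W E P) ->
        (\forall n \near \oo, forall v, VP W E P v ->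
           exists i j, [/\ i \in Gn n, j \in Gn n & mu E i j = v]) ->
        forall u_ : nat -> R, (forall n, 0 < u_ n) -> u_ @ \oo --> 0 ->
        (\forall n \near \oo, forall i j, i \in Gn n -> j \in Gn n ->
           (`|Bcorr W E P (Gn n) i j - 1| <= (u_ n)%:E)%E) ->
        forall theta_u : nat -> Omega -> R,
        (forall n w, maximizes `[a, b]
           (fun t => L_u W E P nu (f t) (obs X (Gn n) w)) (theta_u n w)) ->
        {ae Pr, forall w, theta_u n w @[n --> \oo] --> theta0}].
Proof.
have /andP[ath thb] := htheta0.
have ab : a <= b by exact/ltW/(lt_trans ath).
have th0 : theta0 \in `[a, b] by rewrite in_itv/= !ltW.
(* The development runs on log-densities: their series place them in the Wiener class with the same
   radius rho for all t. *)
pose h t x := ln (f t x).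
have D1 x : Sp W x -> `|x| <= 1 by exact: Sp_le1.
have Sp_hull x : Sp W x -> hull W x by exact: sub_Rhull.
have fpos t x : t \in `[a, b] -> Sp W x -> 0 < f t x.
  by move=> tab /Sp_hull; case: (hF t tab) => -[+ _] _; apply.
have hh t : t \in `[a, b] -> wiener (Sp W) rho (h t).
  move=> tab; have [_ [c [hc arho]]] := hF t tab.
  by apply: (wiener_series D1 arho) => x /Sp_hull; exact: hc.
have cSp : compact (Sp W : set R^o).
  apply: (@subclosed_compact R^o _ (`[-1, 1]%classic : set R)).
  - exact: (Sp_closed hW).
  - exact: (@segment_compact R).
  - by move=> x /D1; rewrite /= in_itv/= ler_norml.
have hc x : Sp W x -> {within `[a, b], continuous (fun t => h t x)}.
  move=> Sx; apply/subspace_continuousP => t tab.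
  have := (iffLR (subspace_continuousP _ _)) (hcont x Sx) t tab => ft.
  exact: (continuous_cvg _ (continuous_ln (fpos t x tab Sx)) ft).
have h_near (t e : R) : t \in `[a, b] -> 0 < e ->
    \forall s \near nbhs t, s \in `[a, b] -> log_close (Sp W) h e s t.
  exact: log_close_near cSp D1 hh hc.
have expfE t x : t \in `[a, b] -> Sp W x -> expf (h t) 1 x = f t x.
  by move=> tab Sx; rewrite /expf mul1r lnK// posrE fpos.
have expfN t x : t \in `[a, b] -> Sp W x -> expf (h t) (-1) x = (f t x)^-1.
  by move=> tab Sx; rewrite /expf mulN1r expRN lnK// posrE fpos.
have KE t : t \in `[a, b] -> Kop W E (f t) = Kop W E (expf (h t) 1).
  by move=> tab; apply/funext => i; apply/funext => j; apply: eq_Kop => x Sx; rewrite expfE.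
have KN t : t \in `[a, b] -> Kop W E (fun y => (f t y)^-1) = Kop W E (expf (h t) (-1)).
  by move=> tab; apply/funext => i; apply/funext => j; apply: eq_Kop => x Sx; rewrite expfN.
have h_inj t : t \in `[a, b] -> {ae nu, forall x, Sp W x -> h t x = h theta0 x} ->
    t = theta0.
  move=> tab hae; apply: hinj => //; apply: filterS hae => x hx Sx.
  by rewrite -expfE// -(expfE theta0)// /expf hx.
rewrite KE// in hX.
have Gn_sub p q : (p <= q)%N -> (Gn p `<=` Gn q)%fset.
  by move=> /subnK <-; elim: (q - p)%N => // n; rewrite addSn => /fsubset_trans; apply.
have Gn_unbounded N : exists n, (N <= #|` Gn n|)%N.
  have /cvgryPge/(_ N%:R)[n _ hn] := hGoo; exists n.
  by have := hn n (leqnn n); rewrite ler_nat.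
have Gn_boundary (eta : R) : 0 < eta -> exists N, forall n, (N <= n)%N ->
     (boundary_size W (Gn n))%:R <= eta * (#|` Gn n|)%:R.
  move=> eta0; have /eqoP/(_ _ eta0)[N _ hN] := hdelta; exists N => n Nn.
  by have := hN n Nn; rewrite !ger0_norm.
have Gn_pos : \forall n \near \oo, 0 < (#|` Gn n|)%:R :> R.
  have [n hn] := Gn_unbounded 1%N; exists n => // k nk.
  by rewrite ltr0n; apply: leq_trans hn _; apply: fsubset_leq_card; exact: Gn_sub.
have regular := ae_regular_path hW hE ab th0 hh hX Gn_sub
  Gn_unbounded Gn_boundary hnu.
have quadE M A w : qform (restr_mx M A) (obs X A w) = quad X M A w.
  exact: (qform_restr M A (fun i => X i w)).
have quad_invE F A w : qform (invmx (restr_mx F A)) (obs X A w) =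
    quad X (inv_kernel F A) A w.
  exact: (qform_inv F A (fun i => X i w)).
have tilde_qform t A w : t \in `[a, b] ->
    qform (Kmx W E (fun y => (f t y)^-1) A) (obs X A w) =
    quad X (Kop W E (expf (h t) (-1))) A w.
  by move=> tab; rewrite /Kmx KN// quadE.
have hat_qform t A w : t \in `[a, b] ->
    qform (invmx (Kmx W E (f t) A)) (obs X A w) =
    quad X (inv_kernel (Kop W E (expf (h t) 1)) A) A w.
  by move=> tab; rewrite /Kmx KE// quad_invE.
have logE t : log_int W nu (f t) = log_limit W nu h t by [].
have cvg0 : (fun=> 0 : R) @ \oo --> (0 : R) by exact: cvg_cst.
split.
- move=> tn tnP; apply: filterS regular => w rw.
  pose C := expR rho * (cexp rho * expR rho).
  pose delta n : R := (boundary_size W (Gn n))%:R / (#|` Gn n|)%:R.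
  have eta0 : C * delta n + C * delta n @[n --> \oo] --> (0 : R).
    have d0 := boundary_ratio_cvg0 Gn_boundary.
    rewrite -[X in _ --> X](addr0 0) -[X in X + X](mulr0 C).
    by apply: cvgD; apply: cvgMr.
  (* The normalized trace of K(ln f_t) stands in for ln det: it is easily compared between close
     parameters, and the uniform error C delta_n / m_n, incurred at the maximizer and at theta0,
     goes into the slack. *)
  apply: (likelihood_consistency hW hE ab th0 hh h_near h_inj Gn_sub
    Gn_unbounded hnu
    (A := fun n t => (\sum_(i <- Gn n) Kop W E (h t) i i) / (#|` Gn n|)%:R) rw _ _ eta0).
  + by move=> n e s t e0 sab tab; exact: (trace_close hW hE Gn hh n e0 sab tab).
  + by move=> t tab; exact: (log_trace_cvg hW hE hh Gn_sub Gn_unbounded hnu tab).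
  near=> n; have m0 : 0 < (#|` Gn n|)%:R :> R by near: n.
  have [tab max] := tnP n w; split=> //; have := max _ th0.
  rewrite /L_hat !hat_qform// /Kmx !KE// => le.
  have l1 := log_det_close hW hE Gn hh n tab.
  have l2 := log_det_close hW hE Gn hh n th0.
  exact (log_det_contrast_le m0 l2 l1 le).
- move=> tn tnP; apply: filterS regular => w rw.
  apply: (likelihood_consistency hW hE ab th0 hh h_near h_inj Gn_sub
    Gn_unbounded hnu (A := fun=> log_limit W nu h) rw _ _ cvg0).
  + by move=> n e s t _; exact: (log_limit_close hW hE hh Gn_sub Gn_unbounded hnu).
  + by move=> t _; exact: cvg_cst.
  near=> n; have m0 : 0 < (#|` Gn n|)%:R :> R by near: n.
  have [tab max] := tnP n w; split=> //; have := max _ th0.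
  rewrite /L_bar !hat_qform// !logE => le.
  exact (contrast_le0 m0 le).
- move=> tn tnP; apply: filterS regular => w rw.
  apply: (plugin_consistency hW hE ab th0 hh h_near h_inj Gn_sub
    Gn_unbounded hnu rw cvg0).
  near=> n; have m0 : 0 < (#|` Gn n|)%:R :> R by near: n.
  have [tab max] := tnP n w; split=> //; have := max _ th0.
  rewrite /L_tilde !tilde_qform// !logE => le.
  exact (contrast_le0 m0 le).
move=> Q Q0 _ _ _ u u0 ucvg Bu tn tnP; apply: filterS regular => w rw.
have [[B B0 hB] _ _ _ _] := rw.
(* The correction perturbs the normalized form by at most u_n [cexp rho] B, once at the maximizer
   and once at theta0. *)
pose eta n := u n * (cexp rho * B) + u n * (cexp rho * B).
have eta0 : eta n @[n --> \oo] --> (0 : R).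
  rewrite -[X in _ --> X](addr0 0) -[X in X + X](mul0r (cexp rho * B)).
  by apply: cvgD; apply: cvgMl.
apply: (plugin_consistency hW hE ab th0 hh h_near h_inj Gn_sub
  Gn_unbounded hnu rw eta0).
have u_form t A w' : t \in `[a, b] ->
    qform (Qmx W E Q (fun y => (f t y)^-1) A) (obs X A w') =
    quad X (fun i j => fine (Bcorr W E Q A i j) * Kop W E (expf (h t) (-1)) i j) A w'.
  by move=> tab; rewrite /Qmx KN// quadE.
near=> n; have m0 : 0 < (#|` Gn n|)%:R :> R by near: n.
have [tab max] := tnP n w; split=> //; have := max _ th0.
rewrite /L_u !u_form// !logE => le.
have Bn : forall i j, i \in Gn n -> j \in Gn n ->
    (`|Bcorr W E Q (Gn n) i j - 1| <= (u n)%:E)%E by near: n.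
have Bf i j : i \in Gn n -> j \in Gn n -> `|fine (Bcorr W E Q (Gn n) i j) - 1| <= u n.
  move=> iA jA; have := Bn i j iA jA.
  (* An infinite correction would contradict the finite bound, so [fine] loses nothing. *)
  by case: (Bcorr W E Q (Gn n) i j) => [r||]//=; rewrite lee_fin.
have hBn : squared_norm X Gn n w <= B * (#|` Gn n|)%:R by near: n.
have ub t : t \in `[a, b] -> `|quad X (fun i j => fine (Bcorr W E Q (Gn n) i j) *
    Kop W E (expf (h t) (-1)) i j) (Gn n) w / (#|` Gn n|)%:R -
    plugin_form W E X Gn h n t w / (#|` Gn n|)%:R| <= u n * (cexp rho * B).
  move=> t_ab; rewrite -mulrBl normrM normfV (ger0_norm (ler0n _ _)) ler_pdivrMr//.
  apply: le_trans (corrected_form_close hW hE X hh w t_ab (ltW (u0 n)) Bf) _.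
  rewrite -!mulrA; apply: ler_wpM2l; first exact: ltW.
  by apply: ler_wpM2l => //; rewrite addr_ge0 ?expR_ge0.
exact (corrected_contrast_le m0 (ub _ th0) (ub _ tab) le).
Unshelve. all: by end_near. Qed.
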